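(* Fix a prime power $q$. Then $$\#\{n\in\mathbb{N}:\ n\le x,\ \gcd(n,q)=1\ \text{and}\ \operatorname{Aut}_q(n)\neq\operatorname{Aff}_q(n)\}=o(x)\qquad\text{as }x\to\infty,$$ that is, the set of integers $n$ coprime to $q$ with $\operatorname{Aut}_q(n)\neq\operatorname{Aff}_q(n)$ has density zero.
   Context: $\mathbb{N}$ is the set of positive integers. For $n$ coprime to $q$, let $\mathbb{Z}_n=\mathbb{Z}/n\mathbb{Z}$ and let $\langle q\rangle$ be the subgroup of $\mathbb{Z}_n^\times$ generated by $q$. The cyclotomic association scheme $\operatorname{Cyc}(\langle q\rangle,\mathbb{Z}_n)$ is the pair $(\mathbb{Z}_n,\pi)$ with coloring $\pi(x,y):=(y-x)\langle q\rangle$ (the orbit of $y-x$ under multiplication by $\langle q\rangle$), and $\operatorname{Aut}_q(n):=\operatorname{Aut}(\operatorname{Cyc}(\langle q\rangle,\mathbb{Z}_n))$ is the group of all permutations $\sigma$ of $\mathbb{Z}_n$ with $\pi(\sigma x,\sigma y)=\pi(x,y)$ for all $x,y\in\mathbb{Z}_n$. The $q$-affine group is $\operatorname{Aff}_q(n):=\{x\mapsto kx+b:\ k\in\langle q\rangle,\ b\in\mathbb{Z}_n\}\le\operatorname{Sym}(\mathbb{Z}_n)$. It is a subgroup of $\operatorname{Aut}_q(n)$. *)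

(* Defs.v *)
From mathcomp Require Import all_boot all_order all_fingroup all_solvable all_algebra.
From mathcomp Require Import all_classical all_reals all_analysis.

Set Implicit Arguments.
Unset Strict Implicit.
Unset Printing Implicit Defensive.

Import Order.TTheory GRing.Theory Num.Theory.

(* Z/nZ is represented by 'I_n with the operations Zp_add, Zp_opp and Zp_mul,
   which reduce modulo n for every n.  The type 'Z_n is not used because 'Z_1
   is Z/2Z, whereas n = 1 must denote the trivial ring. *)

(* For q coprime to n the powers with natural exponents already form a group;
   see [q_powers_cycle]. *)
Definition q_powers (q n : nat) : {set 'I_n} :=
  [set a : 'I_n | `[< exists i : nat, a = q ^ i %[mod n] >]]%SET.

Definition cyc_color (q n : nat) (x y : 'I_n) : {set 'I_n} :=
  [set Zp_mul (Zp_add y (Zp_opp x)) a | a in q_powers q n]%SET.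

Definition color_aut (T : finType) (C : eqType) (pi : T -> T -> C) :
    {set {perm T}} :=
  [set s : {perm T} | [forall x, forall y, pi (s x) (s y) == pi x y]]%SET.

Definition Aut_q (q n : nat) : {set {perm 'I_n}} := color_aut (@cyc_color q n).

Definition Aff_q (q n : nat) : {set {perm 'I_n}} :=
  [set s : {perm 'I_n} | [exists k in q_powers q n, exists b : 'I_n,
     forall x, s x == Zp_add (Zp_mul k x) b]]%SET.

(* The number of positive integers n <= x coprime to q with
   Aut_q(n) <> Aff_q(n); for x >= 0 the natural number Num.truncn x is the
   floor of x. *)
Definition exceptional_count (R : realType) (q : nat) (x : R) : nat :=
  #|[set n : 'I_(Num.truncn x).+1 |
      [&& (0 < n)%N, coprime n q & Aut_q q n != Aff_q q n]]%SET|.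

Lemma q_powers_cycle (q m : nat) (u : {unit 'I_m.+2}) :
  val u = (q%:R)%R :> 'I_m.+2 ->
  q_powers q m.+2 = [set val v | v in <[u]>%g]%SET.
Proof.
move=> uq; apply/setP => a; rewrite inE; apply/asboolP/imsetP.
- case=> i ai; exists (u ^+ i)%g; first exact: mem_cycle.
  apply: val_inj; rewrite unit_Zp_expg /= uq Zp_nat /= modnXm -ai.
  by rewrite modn_small.
- case=> v /cycleP[i ->] ->; exists i.
  by rewrite unit_Zp_expg /= uq Zp_nat /= modn_mod modnXm.
Qed.

Lemma color_aut_group_set (T : finType) (C : eqType) (pi : T -> T -> C) :
  group_set (color_aut pi).
Proof.
apply/group_setP; split=> [|s t].
  by rewrite inE; apply/forallP => x; apply/forallP => y; rewrite !perm1.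
rewrite !inE => /forallP hs /forallP ht.
apply/forallP => x; apply/forallP => y; rewrite !permM.
by rewrite (eqP (forallP (ht _) _)) (eqP (forallP (hs _) _)).
Qed.

Lemma Aff_q_sub_Aut_q (q n : nat) :
  (0 < n)%N -> coprime n q -> Aff_q q n \subset Aut_q q n.
Proof.
case: n => [//|m] _ cnq; apply/fintype.subsetP => s; rewrite !inE.
case/existsP => k /andP[]; rewrite inE => /asboolP[i ki].
case/existsP => b /forallP hs; apply/forallP => x; apply/forallP => y.
rewrite /cyc_color (eqP (hs x)) (eqP (hs y)).
have -> : Zp_add (Zp_add (Zp_mul k y) b) (Zp_opp (Zp_add (Zp_mul k x) b)) =
          Zp_mul k (Zp_add y (Zp_opp x)).
  rewrite Zp_mul_addr; change (Zp_mul k y + b - (Zp_mul k x + b) = Zp_mul k y + Zp_mul k (- x))%R.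
  rewrite opprD addrACA subrr addr0; congr (_ + _)%R; apply/eqP.
  rewrite eq_sym -subr_eq0 opprK; apply/eqP.
  change (Zp_add (Zp_mul k (- x)%R) (Zp_mul k x) = 0%R); rewrite -Zp_mul_addr.
  change (Zp_mul k (- x + x)%R = 0%R); rewrite addNr.
  by apply: val_inj; rewrite /= muln0 mod0n.
set d := Zp_add _ _; apply/eqP/finset.setP => z; apply/imsetP/imsetP.
- case=> a; rewrite inE => /asboolP[j aj] ->; exists (Zp_mul k a).
    rewrite inE; apply/asboolP; exists (i + j)%N.
    by rewrite /= modn_mod expnD -modnMml -modnMmr ki aj modnMml modnMmr.
  by rewrite Zp_mulA (Zp_mulC k d).
- case=> a; rewrite inE => /asboolP[j aj] ->.
  have kK : Zp_mul k (inZp (q ^ (i * (totient m.+1).-1))) = Zp1.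
    apply: val_inj; rewrite /= modnMmr -modnMml ki modnMml -expnD.
    rewrite -mulnS prednK ?totient_gt0 // mulnC expnM -modnXm.
    by rewrite Euler_exp_totient 1?coprime_sym // modnXm exp1n.
  exists (Zp_mul (inZp (q ^ (i * (totient m.+1).-1))) a).
    rewrite inE; apply/asboolP; exists (i * (totient m.+1).-1 + j)%N.
    by rewrite /= modn_mod modnMml -modnMmr aj modnMmr -expnD.
  by rewrite [Zp_mul _ a in RHS]Zp_mulC (Zp_mulC k) -!Zp_mulA (Zp_mulC a)
     (Zp_mulA k) kK Zp_mul1z.
Qed.
(* Lets the Landau notations be used at +oo. *)
Canonical pinfty_filter_on (R : numFieldType) : filter_on R :=
  FilterType (pinfty_nbhs R) _.

(* Main.v *)
From HB Require Import structures.
Require Import Defs.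
From mathcomp Require Import all_boot all_order all_fingroup all_solvable all_algebra.
From mathcomp Require Import all_classical all_reals all_analysis.
From mathcomp Require Import all_field zify ring lra.

(* Let s be a color automorphism of Z_n.  After composing with an affine map, s
   fixes 0 and 1.  If p^a exactly divides n and m = n / p^a, comparing
   residues modulo p^a and m gives s x - s y = q^i (x - y) mod p^a with
   q^i = 1 mod m.  If these q^i are squares modulo p, Carlitz's theorem shows
   that s is the identity modulo p; if moreover some prime r dividing m has
   p^(a-1) | ord_r(q), then q^i = 1 mod p forces q^i = 1 mod p^a, and s is the
   identity modulo p^a.  So it suffices that almost every n has a prime factor
   r with l^k | ord_r(q), for l different from the characteristic or
   (l^k = 2 with q not a square), and no large square factor.

   By Turan's inequality this follows once the reciprocals of these primes r
   have a divergent sum.  Write q as a power of the prime g.  It is enough to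
   treat the primes r = 1 mod m, with m a power of l, modulo which y^l = g
   does not have two roots.  If their reciprocals had a finite sum, sieving
   would give a positive proportion of a in a box of Z[zeta_m] whose norm n is
   squarefree, with all its prime factors large, 1 mod m, and with two roots
   of y^l = g.  Every choice of roots modulo the prime factors of n defines a
   lattice of index n in Z[zeta_m, g^(1/l)]; by the pigeonhole principle it
   contains a point of norm O(n), and this point determines the choices.  Since
   n typically has many prime factors, this produces more points than the
   volume allows. *)

Import Order.TTheory GRing.Theory Num.Theory.
Import numFieldNormedType.Exports.
Local Open Scope classical_set_scope.
Local Open Scope ring_scope.

Set Implicit Arguments.
Unset Strict Implicit.
Unset Printing Implicit Defensive.

(** * Norms of polynomials modulo a monic polynomial *)

(** Divergence over primes of this kind is usually read off from Chebotarev's theorem for Q(zeta_m,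
    g^(1/l)); here size bounds on norms take its place. Cyclotomic norms are used because a prime
    not dividing m and not 1 modulo m divides such a norm at least twice once it divides it:
    squarefreeness alone puts all prime factors in the class 1 modulo m. The sieve must count the a
    with r | N(a) or r^2 | N(a) even for r beyond the side of the box; packing does this, since
    nonzero differences within one residue condition have norm at least r or r^2. The pigeonhole
    point determines the choices because its norm is n times a cofactor at most K, while all primes
    of n exceed y >= K: two evaluation points that differ modulo r would force r^2 into the norm,
    hence r into the cofactor. The number of points is O(N^d) with a constant independent of V,
    whereas V choices give 2^V points for each a. The norm of a nonzero point is shown to be nonzero
    by a g-adic descent, which needs g prime to m; hence m = 1 in the case l = p = 2. Large square
    factors are discarded so that finitely many l^k cover all n at once. *)

Definition comp_mx (R : nzRingType) n (f : {poly R}) : 'M[R]_n.+1 :=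
  \matrix_(i, j) if i == n :> nat then - f`_j else (i.+1 == j :> nat)%:R.

(* The determinant of multiplication by [a] on R[X]/(f), for f monic of degree
   n.+1. *)
Definition pnorm (R : comNzRingType) n (f a : {poly R}) : R :=
  \det (horner_mx (comp_mx n f) a).

Lemma pnormM (R : comNzRingType) n (f a b : {poly R}) :
  pnorm n f (a * b) = pnorm n f a * pnorm n f b.
Proof. by rewrite /pnorm rmorphM /= -det_mulmx. Qed.

Lemma pnormC (R : comNzRingType) n (f : {poly R}) c :
  pnorm n f c%:P = c ^+ n.+1.
Proof. by rewrite /pnorm horner_mx_C det_scalar. Qed.

Lemma map_comp_mx (R S : nzRingType) (h : {rmorphism R -> S}) n (f : {poly R}) :
  map_mx h (comp_mx n f) = comp_mx n (map_poly h f).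
Proof.
apply/matrixP => i j; rewrite !mxE coef_map.
by case: eqP => _; rewrite ?rmorphN ?rmorph_nat.
Qed.

Lemma map_pnorm (R S : comNzRingType) (h : {rmorphism R -> S}) n (f a : {poly R}) :
  h (pnorm n f a) = pnorm n (map_poly h f) (map_poly h a).
Proof. by rewrite /pnorm -det_map_mx map_horner_mx map_comp_mx. Qed.

(** All rows but the last shift t^i to t^(i+1); the last one is f(t) = 0 solved for t^(n+1). The
    powers of a root thus form a right eigenvector over any commutative ring. *)
Lemma comp_mx_root (R : comNzRingType) n (f : {poly R}) t :
  f \is monic -> size f = n.+2 -> root f t ->
  comp_mx n f *m (\col_(i < n.+1) t ^+ i) = t *: (\col_i t ^+ i).
Proof.
move=> fmon fs /rootP ft; apply/matrixP => i j; rewrite !mxE.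
have [iN|iN] := eqVneq (i : nat) n.
  rewrite iN; move: ft; rewrite horner_coef fs big_ord_recr /=.
  have -> : f`_n.+1 = 1 by move/monicP: fmon; rewrite lead_coefE fs.
  rewrite mul1r => /eqP; rewrite addrC addr_eq0 exprS => /eqP ->.
  rewrite -sumrN; apply: eq_bigr => k _.
  by rewrite !mxE iN eqxx mulNr.
have iS : (i.+1 < n.+1)%N by rewrite ltnS ltn_neqAle iN -ltnS ltn_ord.
rewrite (bigD1 (Ordinal iS)) //= !mxE (negPf iN) /= eqxx mul1r -exprS.
rewrite big1 ?addr0 // => k kn; rewrite !mxE (negPf iN).
case: eqP => [E|_]; last by rewrite mul0r.
by case/eqP: kn; apply: val_inj.
Qed.

Lemma horner_comp_mx_root (R : comNzRingType) n (f a : {poly R}) t :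
  f \is monic -> size f = n.+2 -> root f t ->
  horner_mx (comp_mx n f) a *m (\col_(i < n.+1) t ^+ i) =
  a.[t] *: (\col_i t ^+ i).
Proof.
move=> fmon fs ft; elim/poly_ind: a => [|a c IH].
  by rewrite rmorph0 horner0 mul0mx scale0r.
rewrite rmorphD rmorphM /= horner_mx_X horner_mx_C mulmxDl hornerD hornerM.
rewrite hornerX hornerC -[_ * comp_mx n f]/(_ *m comp_mx n f) -mulmxA.
by rewrite comp_mx_root // -scalemxAr IH mul_scalar_mx scalerA scalerDl mulrC.
Qed.

(** The eigenvectors of the roots form a Vandermonde matrix, which diagonalizes multiplication by
    [a]. Asking for unit differences rather than distinct roots lets this apply in Z/r^2. *)
Lemma pnorm_roots (R : comUnitRingType) n (f a : {poly R}) (t : 'I_n.+1 -> R) :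
  f \is monic -> size f = n.+2 -> (forall i, root f (t i)) ->
  (forall i j, i != j -> t i - t j \is a GRing.unit) ->
  pnorm n f a = \prod_i a.[t i].
Proof.
move=> fmon fs ft tu; pose V := Vandermonde n.+1 (\row_j t j).
have E : horner_mx (comp_mx n f) a *m V = V *m diag_mx (\row_j a.[t j]).
  apply/matrixP => i j; rewrite mul_mx_diag !mxE.
  have /matrixP/(_ i 0) := horner_comp_mx_root a fmon fs (ft j).
  rewrite !mxE mulrC => <-; apply: eq_bigr => k _.
  by rewrite !mxE.
have Vu : \det V \is a GRing.unit.
  rewrite det_Vandermonde; apply: rpred_prod => i _; apply: rpred_prod => j ij.
  by rewrite !mxE tu // neq_ltn ij orbT.
apply: (mulrI Vu); rewrite mulrC -det_mulmx E det_mulmx det_diag.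
by congr (_ * _); apply: eq_bigr => i _; rewrite mxE.
Qed.

(** Multiplication by [a] kills the vector of powers of t; applying the adjugate gives det * 1 = 0
    in the first coordinate. The argument works in any commutative ring, so [dvdz_pnorm] can take a
    composite modulus. *)
Lemma pnorm_root0 (R : comNzRingType) n (f a : {poly R}) t :
  f \is monic -> size f = n.+2 -> root f t -> root a t -> pnorm n f a = 0.
Proof.
move=> fmon fs ft /rootP at0.
have := horner_comp_mx_root a fmon fs ft; rewrite at0 scale0r => E.
have := congr1 (mulmx (\adj (horner_mx (comp_mx n f) a))) E.
rewrite mulmxA mul_adj_mx mulmx0 mul_scalar_mx => /matrixP/(_ 0 0).
by rewrite !mxE expr0 mulr1.
Qed.

(* Two independent vectors killed modulo r make two elementary divisors of M
   divisible by r. *)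
Lemma dvdz_det_kernel k (M : 'M[int]_k) (F : fieldType) (r : nat)
    (K : 'M[F]_(k, 2)) :
  r \in [pchar F] -> map_mx intr M *m K = 0 -> \rank K = 2%N ->
  (r%:Z ^+ 2 %| \det M)%Z.
Proof.
move=> rF MK rK; have [L Lu [G Gu [d _ ED]]] := int_Smith_normal_form M.
set D := \matrix_(_, _) _ in ED.
pose h := map_mx (intr : int -> F).
have hu k' (A : 'M[int]_k') : A \in unitmx -> h _ _ A \in unitmx.
  rewrite !unitmxE => Au; rewrite det_map_mx; exact: (rmorph_unit (intr : {rmorphism int -> F})).
pose w := h _ _ G *m K.
have Dw (i : 'I_k) j : (d`_i)%:~R * w i j = 0 :> F.
  have : h _ _ D *m w = 0.
    apply: (can_inj (mulKmx (hu _ _ Lu))); rewrite mulmx0 -MK ED /w.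
    by rewrite /h !map_mxM !mulmxA.
  move/matrixP/(_ i j); rewrite mxE (bigD1 i) //= mxE [D _ _]mxE eqxx mulr1n.
  rewrite big1 ?addr0 => [->|x xi]; first by rewrite mxE.
  rewrite mxE [D _ _]mxE; case: eqP => [E|_]; last by rewrite mulr0n mul0r.
  by case/eqP: xi; apply: val_inj.
have rw : \rank w = 2%N by rewrite /w eqmxMfull ?rK // row_full_unit hu.
have [i0 wi0] : exists i, row i w != 0.
  apply/existsP; apply: contraT; rewrite negb_exists => /forallP w0.
  suff: w = 0 by move=> E; move: rw; rewrite E mxrank0.
  by apply/row_matrixP => i; rewrite row0; apply/eqP; move: (w0 i); rewrite negbK.
(* If row [i0] were the only nonzero one, [w] would factor through a single row and have rank at
   most 1. *)
have [i1 i10 wi1] : exists2 i, i != i0 & row i w != 0.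
  have [/exists_inP //|] := boolP [exists i in [pred i | i != i0], row i w != 0].
  rewrite negb_exists_in => /forall_inP w0.
  suff E : w = delta_mx i0 (0 : 'I_1) *m row i0 w.
    have := mxrankM_maxr (delta_mx i0 (0 : 'I_1)) (row i0 w).
    by rewrite -E rw => /leq_trans/(_ (rank_leq_row _)).
  apply/row_matrixP => i; rewrite row_mul.
  have [->|ii] := eqVneq i i0.
    by apply/rowP => j; rewrite !mxE big_ord1 !mxE !eqxx mul1r.
  have := w0 i ii; rewrite negbK => /eqP ->.
  by apply/rowP => j; rewrite !mxE big_ord1 !mxE (negPf ii) mul0r.
have rd (i : 'I_k) : row i w != 0 -> (r %| d`_i)%Z.
  move=> wi; rewrite (dvdz_pcharf rF); apply: contraNT wi => di.
  apply/eqP/rowP => j; rewrite [LHS]mxE [RHS]mxE; apply: (mulfI di).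
  by rewrite Dw mulr0.
have ED' : D = diag_mx (\row_(i < k) d`_i).
  by apply/matrixP => i j; rewrite !mxE -val_eqE.
rewrite ED !det_mulmx; apply: dvdz_mulr; apply: dvdz_mull.
rewrite ED' det_diag (bigD1 i0) //= (bigD1 i1) //= !mxE mulrA.
by apply: dvdz_mulr; rewrite expr2; apply: dvdz_mul; apply: rd.
Qed.

(** The powers of t and those of t' are two columns killed by multiplication by [a] modulo r; their
    first two rows form an invertible Vandermonde block, so they have rank 2. *)
Lemma pnorm_two_roots n (f a : {poly int}) (F : fieldType) (r : nat) (t t' : F) :
  r \in [pchar F] -> f \is monic -> size f = n.+2 -> t != t' ->
  root (map_poly intr f) t -> root (map_poly intr f) t' ->
  root (map_poly intr a) t -> root (map_poly intr a) t' ->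
  (r%:Z ^+ 2 %| pnorm n f a)%Z.
Proof.
move=> rF fmon fs tt ft ft' at0 at0'.
have gmon : (map_poly intr f : {poly F}) \is monic by apply: monic_map.
have gs : size (map_poly intr f : {poly F}) = n.+2.
  by rewrite size_map_poly_id0 // (monicP fmon) oner_neq0.
have n1 : (0 < n)%N.
  have := @max_poly_roots F (map_poly intr f) [:: t; t'].
  rewrite monic_neq0 //= ft ft' gs inE tt /= => /(_ isT isT isT); by case: (n).
pose K := \matrix_(i < n.+1, j < 2) (if j == 0 then t else t') ^+ i.
apply: (@dvdz_det_kernel _ _ F r K rF).
  rewrite -[map_mx _ _]/(map_mx (intr : {rmorphism int -> F}) _) map_horner_mx map_comp_mx.
  apply/matrixP => i j.
  pose u := if j == 0 then t else t'.
  have gu : root (map_poly intr f) u by rewrite /u; case: ifP.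
  have au : root (map_poly intr a) u by rewrite /u; case: ifP.
  have /matrixP/(_ i 0) := horner_comp_mx_root (map_poly intr a) gmon gs gu.
  rewrite (rootP au) scale0r !mxE => E; rewrite -[RHS]E; apply: eq_bigr => k _.
  by rewrite !mxE.
apply/eqP; rewrite eqn_leq rank_leq_col /=.
pose P := \matrix_(i < 2, j < n.+1) (i == j :> nat)%:R : 'M[F]_(2, n.+1).
apply: leq_trans (mxrankM_maxr P K).
have PK i j : (P *m K) i j = (if j == 0 then t else t') ^+ i.
  have ip : (i < n.+1)%N by rewrite (leq_trans (ltn_ord i)).
  rewrite !mxE (bigD1 (Ordinal ip)) //= !mxE eqxx mul1r big1 ?addr0 // => k kn.
  rewrite !mxE; case: eqP => [E|_]; last by rewrite mul0r.
  by case/eqP: kn; apply: val_inj.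
have -> : P *m K = Vandermonde 2 (\row_(j < 2) if j == 0 then t else t').
  by apply/matrixP => i j; rewrite PK !mxE.
rewrite mxrank_unit // unitmxE unitfE det_Vandermonde.
apply/prodf_neq0 => i _; apply/prodf_neq0 => j ij; rewrite !mxE subr_eq0.
by case: i j ij => [[|[|//]] ?] [[|[|//]] ?] //= _; rewrite eq_sym.
Qed.

(** * The norm of Z[zeta_m] *)

Lemma intr_Zp_eq0 k (x : int) : (1 < k)%N -> (x%:~R == 0 :> 'Z_k) = (k %| x)%Z.
Proof.
move=> k1; have E n : (n%:R == 0 :> 'Z_k) = (k %| n)%N.
  by rewrite -val_eqE /= val_Zp_nat.
by case: x => n; rewrite ?NegzE ?rmorphN /= ?oppr_eq0 E.
Qed.

Lemma horner_map_intr (R : comNzRingType) (a : {poly int}) (t : int) :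
  (map_poly intr a).[t%:~R] = (a.[t])%:~R :> R.
Proof. exact: (horner_map (intr : {rmorphism int -> R})). Qed.

Lemma dvdz_pnorm n (f a : {poly int}) (k : nat) (t : int) :
  f \is monic -> size f = n.+2 -> (0 < k)%N ->
  (k %| f.[t])%Z -> (k %| a.[t])%Z -> (k %| pnorm n f a)%Z.
Proof.
move=> fmon fs; case: k => [//|[_ _ _|k _]]; first by rewrite dvd1z.
rewrite -!(@intr_Zp_eq0 k.+2) // -!horner_map_intr => ft at0.
rewrite -[intr _]/((intr : {rmorphism int -> 'Z_k.+2}) _) map_pnorm.
apply/eqP/pnorm_root0; [exact: monic_map | | exact: ft | exact: at0].
by rewrite size_map_poly_id0 // (monicP fmon) oner_neq0.
Qed.

Section CyclotomicNorm.

Variables (m : nat) (m_gt0 : (0 < m)%N).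

Definition cnorm (a : {poly int}) : int := pnorm (totient m).-1 'Phi_m a.

Lemma totient_pred : (totient m).-1.+1 = totient m.
Proof. by rewrite prednK // totient_gt0. Qed.

Lemma size_Cyclotomic_pred : size 'Phi_m = (totient m).-1.+2.
Proof. by rewrite size_Cyclotomic totient_pred. Qed.

(** As a root of X^m - 1, z is a root of some Phi_d with d | m; then z^d = 1, and primitivity forces
    d = m. The characteristic does not matter. *)
Lemma Cyclotomic_prim_root (F : fieldType) (z : F) :
  m.-primitive_root z -> root (map_poly intr 'Phi_m) z.
Proof.
move=> pz; have := prod_Cyclotomic m_gt0.
move/(congr1 (map_poly (intr : int -> F))).
rewrite rmorph_prod rmorphB rmorph1 /= map_polyXn => E.
have : root ('X^m - 1) z by rewrite rootE !hornerE prim_expr_order // subrr.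
rewrite -E => /rootP; rewrite horner_prod => /eqP; rewrite prodf_seq_eq0.
case/hasP => d; rewrite -dvdn_divisors //= => dm rd.
suff md : (m %| d)%N by rewrite (_ : m = d) //; apply/eqP; rewrite eqn_dvd md.
have d0 : (0 < d)%N by apply: dvdn_gt0 dm.
rewrite (prim_order_dvd pz) -subr_eq0.
have := prod_Cyclotomic d0; move/(congr1 (map_poly (intr : int -> F))).
rewrite rmorph_prod rmorphB rmorph1 /= map_polyXn => /(congr1 (horner^~ z)).
rewrite !hornerE => <-; rewrite horner_prod prodf_seq_eq0.
by apply/hasP; exists d; rewrite // -dvdn_divisors.
Qed.

End CyclotomicNorm.

Lemma prim_root_family m (F : fieldType) (z : F) :
  (0 < m)%N -> m.-primitive_root z ->
  exists2 t : 'I_(totient m).-1.+1 -> F,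
    injective t & forall i, m.-primitive_root (t i).
Proof.
move=> m_gt0 pz.
have cardE : (totient m).-1.+1 = #|[pred k : 'I_m | coprime m k]|.
  rewrite totient_pred // totient_count_coprime big_mkord -sum1_card [RHS]big_mkcond.
  by apply: eq_bigr => i _; rewrite inE; case: coprime.
pose t i := z ^+ (enum_val (cast_ord cardE i) : 'I_m).
exists t => [i j /eqP|i]; rewrite /t.
  rewrite (eq_prim_root_expr pz) !modn_small // => /eqP/val_inj.
  by move=> /enum_val_inj/cast_ord_inj.
rewrite (prim_root_exp_coprime _ pz) coprime_sym.
by have := enum_valP (cast_ord cardE i).
Qed.

Lemma cnorm_prod m (F : fieldType) (a : {poly int})
    (t : 'I_(totient m).-1.+1 -> F) :
  (0 < m)%N -> injective t -> (forall i, m.-primitive_root (t i)) ->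
  (cnorm m a)%:~R = \prod_i (map_poly intr a).[t i].
Proof.
move=> m_gt0 tinj tp; rewrite -[LHS]/((intr : {rmorphism int -> F}) _).
rewrite map_pnorm; apply: pnorm_roots.
- by apply: monic_map; apply: Cyclotomic_monic.
- rewrite size_map_poly_id0 ?size_Cyclotomic_pred //.
  by rewrite (monicP (Cyclotomic_monic m)) oner_neq0.
- by move=> i; apply: Cyclotomic_prim_root.
- by move=> i j ij; rewrite unitfE subr_eq0 (inj_eq tinj).
Qed.

Lemma fin_prim_root (F : finFieldType) m :
  (0 < m)%N -> (m %| #|F|.-1)%N -> exists z : F, m.-primitive_root z.
Proof.
move=> m_gt0 mF; have F1 := finRing_gt1 F.
pose rs := [seq x <- enum F | x != 0].
have F0 : (0 < #|F|.-1)%N by rewrite -subn1 subn_gt0.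
have srs : size rs = #|F|.-1.
  rewrite size_filter -(cardC1 (0 : F)) cardE enumT -!sum1_size -sum1_count.
  by rewrite big_filter.
have /hasP[z _ pz] : has (#|F|.-1).-primitive_root rs.
  apply: has_prim_root => //; last by rewrite srs.
    apply/allP => x; rewrite mem_filter => /andP[x0 _]; rewrite unity_rootE.
    by apply/eqP/(mulfI x0); rewrite mulr1 -exprS prednK ?expf_card // ltnW.
  by rewrite filter_uniq // enum_uniq.
by exists (z ^+ (#|F|.-1 %/ m)); apply: dvdn_prim_root.
Qed.

(** By Euler, m divides r^(totient m) - 1, so the field with r^(totient m) elements contains the
    root. *)
Lemma pchar_prim_root_field m r :
  prime r -> (0 < m)%N -> coprime r m ->
  exists (F : finFieldType) (z : F), r \in [pchar F] /\ m.-primitive_root z.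
Proof.
move=> pr m_gt0 cop.
have [|F rF cF] := @pPrimePowerField r (totient m) pr; first by rewrite totient_gt0.
have [|z pz] := @fin_prim_root F m m_gt0; last by exists F, z.
rewrite cF -subn1; have := Euler_exp_totient cop => /eqP.
by rewrite eqn_mod_dvd // expn_gt0 prime_gt0.
Qed.

Lemma horner_intr_expr_pchar (F : fieldType) r (a : {poly int}) (x : F) :
  r \in [pchar F] -> (map_poly intr a).[x ^+ r] = (map_poly intr a).[x] ^+ r.
Proof.
move=> rF; rewrite -!(pFrobenius_autE rF) -(horner_map (pFrobenius_aut rF)) /=.
congr _.[_]; apply/polyP => i; rewrite !coef_map /=.
exact/esym/(rmorph_int (pFrobenius_aut rF)).
Qed.

(* A root t of [a] in an extension of F_r is accompanied by its conjugate
   t^r, which differs from t when r is not 1 modulo m. *)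
Lemma dvdz_cnorm_sqr m r (a : {poly int}) :
  prime r -> (0 < m)%N -> coprime r m -> ~~ (m %| r.-1)%N ->
  (r %| cnorm m a)%Z -> (r%:Z ^+ 2 %| cnorm m a)%Z.
Proof.
move=> pr m_gt0 cop mr.
have [F [z [rF pz]]] := pchar_prim_root_field pr m_gt0 cop.
have [t tinj tp] := prim_root_family m_gt0 pz.
rewrite (dvdz_pcharf rF) (cnorm_prod a m_gt0 tinj tp).
case/prodf_eq0 => i _ /eqP ati.
have ptr : m.-primitive_root (t i ^+ r) by rewrite (prim_root_exp_coprime _ (tp i)).
apply: (@pnorm_two_roots _ _ _ F r (t i) (t i ^+ r) rF).
- exact: Cyclotomic_monic.
- exact: size_Cyclotomic_pred.
- apply: contra mr => /eqP E; rewrite (prim_order_dvd (tp i)).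
  have ti0 : t i != 0 by rewrite (prim_root_eq0 (tp i)) -lt0n.
  by apply/eqP/(mulfI ti0); rewrite -exprS mulr1 prednK ?prime_gt0.
- exact: Cyclotomic_prim_root.
- exact: Cyclotomic_prim_root.
- exact/rootP.
- by apply/rootP; rewrite horner_intr_expr_pchar // ati expr0n eqn0Ngt prime_gt0.
Qed.

(** In x^r - 1 = (x - 1)(1 + x + ... + x^(r-1)) every term of the second factor is 1 modulo r, so
    their sum is divisible by r. *)
Lemma dvdz_subr1_expr (r : nat) (c x : int) :
  (r %| x - 1)%Z -> (c %| x - 1)%Z -> (c * r%:Z %| x ^+ r - 1)%Z.
Proof.
move=> rx cx; rewrite -[1 in X in (_ %| X)%Z](expr1n _ r) subrXX.
apply: dvdz_mul => //.
rewrite (_ : \sum_(i < r) _ = \sum_(i < r) (x ^+ (r.-1 - i) - 1) + r%:Z); last first.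
  have -> : r%:Z = \sum_(i < r) 1 by rewrite sumr_const card_ord natz.
  rewrite -big_split /=.
  by apply: eq_bigr => i _; rewrite expr1n mulr1 subrK.
rewrite rpredD ?dvdzz //; apply: rpred_sum => i _.
by rewrite subrX1 dvdz_mulr.
Qed.

Section PrimeRoots.

Variables (m r : nat).
Hypotheses (m_gt0 : (0 < m)%N) (pr : prime r) (mr : (m %| r.-1)%N).

Let rF : r \in [pchar 'F_r]. Proof. exact: pchar_Fp. Qed.

Let m_ltr : (m < r)%N.
Proof.
have r1 := prime_gt1 pr; rewrite -(prednK (prime_gt0 pr)) ltnS.
by apply: dvdn_leq mr; rewrite -subn1 subn_gt0.
Qed.

Let intr_Fr_expr (x : int) : (x ^+ r)%:~R = x%:~R :> 'F_r.
Proof. by rewrite rmorphXn /= -(pFrobenius_autE rF) (rmorph_int (pFrobenius_aut rF)). Qed.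

(** An explicit Hensel lift: x^r equals x modulo r, and its m-th power is 1 modulo r^2. The other
    cyclotomic factors of X^m - 1 are prime to r there, so Phi_m carries all of r^2. *)
Lemma Cyclotomic_root_lift (x : int) :
  (r %| ('Phi_m).[x])%Z -> (r%:Z ^+ 2 %| ('Phi_m).[x ^+ r])%Z.
Proof.
move=> rx; have := prod_Cyclotomic m_gt0.
rewrite (bigD1_seq m) ?divisors_uniq -?dvdn_divisors //=.
set Q := \prod_(_ <- _ | _) _ => E.
have Ex y : y ^+ m - 1 = ('Phi_m).[y] * Q.[y] by rewrite -hornerM E !hornerE.
have xm : (r %| x ^+ m - 1)%Z by rewrite Ex dvdz_mulr.
have : (r%:Z ^+ 2 %| (x ^+ r) ^+ m - 1)%Z by rewrite exprAC expr2 dvdz_subr1_expr.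
rewrite Ex Gauss_dvdzl // coprimezXl // coprimezE prime_coprime //.
rewrite -[(_ %| _)%N]/(r %| Q.[x ^+ r])%Z (dvdz_pcharf rF) -horner_map_intr intr_Fr_expr.
apply/negP => /eqP Qx.
move: rx; rewrite (dvdz_pcharf rF) -horner_map_intr => /eqP Px.
have := congr1 (map_poly (intr : int -> 'F_r)) E.
rewrite rmorphM rmorphB rmorph1 /= map_polyXn.
(* A common root of Phi_m and the cofactor [Q] would be a zero of the derivative m X^(m-1); but 0 <
   m < r, and x is not 0 modulo r. *)
move/(congr1 (fun p => p^`().[x%:~R])).
rewrite derivM derivB derivXn !hornerE Px Qx !mul0r mulr0 addr0.
rewrite derivC horner0 subr0 hornerMn hornerXn => /esym/eqP.
rewrite -mulr_natl mulf_eq0 -(dvdn_pcharf rF) gtnNdvd //= expf_eq0.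
case/andP => _ x0; move: xm; rewrite (dvdz_pcharf rF) rmorphB rmorphXn /= (eqP x0).
by rewrite expr0n eqn0Ngt m_gt0 /= rmorph1 sub0r oppr_eq0 oner_eq0.
Qed.

(** Representatives of the primitive m-th roots of unity in F_r are raised to the power r: unchanged
    modulo r, they become roots modulo r^2. The last clause is the factorization of the norm over
    F_r. *)
Lemma Cyclotomic_prime_roots : exists u : 'I_(totient m).-1.+1 -> int,
  [/\ forall i, (r%:Z ^+ 2 %| ('Phi_m).[u i])%Z,
      forall i j, i != j -> ~~ (r %| u i - u j)%Z &
      forall a, (r %| cnorm m a)%Z -> exists i, (r %| a.[u i])%Z].
Proof.
have [|z pz] := @fin_prim_root 'F_r m m_gt0; first by rewrite card_Fp.
have [t tinj tp] := prim_root_family m_gt0 pz.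
pose u i : int := (t i : nat)%:Z ^+ r.
have ut i : (u i)%:~R = t i by rewrite intr_Fr_expr -pmulrn natr_Zp.
exists u; split => [i|i j ij|a].
- apply: Cyclotomic_root_lift; rewrite (dvdz_pcharf rF) -horner_map_intr.
  by rewrite -pmulrn natr_Zp (rootP (Cyclotomic_prim_root m_gt0 (tp i))).
- by rewrite (dvdz_pcharf rF) rmorphB /= !ut subr_eq0 (inj_eq tinj).
rewrite (dvdz_pcharf rF) (cnorm_prod a m_gt0 tinj tp) => /prodf_eq0[i _ ai].
by exists i; rewrite (dvdz_pcharf rF) -horner_map_intr ut.
Qed.

End PrimeRoots.

Lemma dvdz_prime_sqr_prod (I : finType) (r : nat) (x : I -> int) :
  prime r -> (r%:Z ^+ 2 %| \prod_i x i)%Z ->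
  exists p : I * I, if p.1 == p.2 then (r%:Z ^+ 2 %| x p.1)%Z
                    else (r %| x p.1)%Z && (r %| x p.2)%Z.
Proof.
move=> pr rx.
have cop y : ~~ (r %| y)%Z -> coprimez r y.
  by rewrite coprimezE prime_coprime.
have copr (P : pred I) : (forall i, P i -> ~~ (r %| x i)%Z) ->
    coprimez r (\prod_(i | P i) x i).
  move=> Px; elim/big_rec: _ => [|i y Pi yc]; first by rewrite coprimezE coprimen1.
  by rewrite coprimezMr yc cop ?Px.
have [i rxi] : exists i, (r %| x i)%Z.
  apply/existsP; apply: contraT; rewrite negb_exists => /forallP H.
  have := copr predT (fun i _ => H i).
  have : (r %| \prod_i x i)%Z by apply: dvdz_trans rx; rewrite expr2 dvdz_mulr.
  rewrite coprimezE prime_coprime // => rd; by rewrite -[(_ %| _)%N]/(r %| _)%Z rd.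
have [/existsP[j /andP[ji rxj]]|] := boolP [exists j, (j != i) && (r %| x j)%Z].
  by exists (i, j) => /=; rewrite eq_sym (negPf ji) rxi rxj.
rewrite negb_exists => /forallP H; exists (i, i); rewrite eqxx /=.
move: rx; rewrite (bigD1 i) //= Gauss_dvdzl //; apply: coprimezXl.
by apply: copr => j ji; move: (H j); rewrite ji.
Qed.

Lemma intr_Zp_sqr_unit r (x : int) : prime r -> ~~ (r %| x)%Z ->
  (x%:~R : 'Z_(r ^ 2)) \is a GRing.unit.
Proof.
move=> pr; have r1 : (1 < r ^ 2)%N.
  by rewrite (@leq_trans r) ?prime_gt1 // -{1}(expn1 r) leq_exp2l ?prime_gt1.
have E n : ~~ (r %| n)%N -> (n%:R : 'Z_(r ^ 2)) \is a GRing.unit.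
  by move=> rn; rewrite unitZpE // coprimeXl // prime_coprime.
by case: x => n; rewrite ?NegzE ?rmorphN /= ?unitrN => rn; apply: E.
Qed.

(* The divisibility of the norm by r^2 is covered by boundedly many additive
   conditions on [a], each of which forces r^2 to divide the norm. *)
Lemma cnorm_sqr_cover m r : (0 < m)%N -> prime r -> coprime r m ->
  let d := (totient m).-1.+1 in
  exists E : 'I_d * 'I_d -> pred {poly int},
    (forall a, (r%:Z ^+ 2 %| cnorm m a)%Z -> exists p, E p a) /\
    (forall p a b, E p a -> E p b -> (r%:Z ^+ 2 %| cnorm m (a - b))%Z).
Proof.
move=> m_gt0 pr cop /=.
have fmon := Cyclotomic_monic m; have fs := size_Cyclotomic_pred m_gt0.
have [mr|mr] := boolP (m %| r.-1)%N; last first.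
  have [F [z [rF pz]]] := pchar_prim_root_field pr m_gt0 cop.
  have [t tinj tp] := prim_root_family m_gt0 pz.
  (* Here r is not 1 modulo m, so a root of [a] brings along its Frobenius conjugate, and vanishing
     at one root is a sufficient covering condition. *)
  exists (fun p a => (map_poly intr a).[t p.1] == 0); split => [a ra|p a b /eqP a0 /eqP b0].
    have : (r %| cnorm m a)%Z by apply: dvdz_trans ra; rewrite expr2 dvdz_mulr.
    rewrite (dvdz_pcharf rF) (cnorm_prod a m_gt0 tinj tp).
    by case/prodf_eq0 => i _ ati; exists (i, i).
  apply: dvdz_cnorm_sqr => //.
  rewrite (dvdz_pcharf rF) (cnorm_prod _ m_gt0 tinj tp).
  apply/prodf_eq0; exists p.1 => //.
  by rewrite rmorphB /= hornerD hornerN a0 b0 subrr.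
have [u [u1 u2 _]] := Cyclotomic_prime_roots m_gt0 pr mr.
have r1 : (1 < r ^ 2)%N.
  by rewrite (@leq_trans r) ?prime_gt1 // -{1}(expn1 r) leq_exp2l ?prime_gt1.
have r2E : (r ^ 2)%N%:Z = r%:Z ^+ 2 by rewrite -!natz natrX.
(* For r = 1 modulo m the norm is, modulo r^2, the product of the values at the lifted roots: either
   one value is divisible by r^2 or two are divisible by r. *)
exists (fun p a => if p.1 == p.2 then (r%:Z ^+ 2 %| a.[u p.1])%Z
          else (r %| a.[u p.1])%Z && (r %| a.[u p.2])%Z); split => [a ra|[i j] a b /=].
  apply: (@dvdz_prime_sqr_prod _ r (fun i => a.[u i])) => //.
  rewrite -r2E -(intr_Zp_eq0 _ r1) rmorph_prod.
  move: ra; rewrite -r2E -(intr_Zp_eq0 _ r1).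
  rewrite -[_%:~R in X in X -> _]/((intr : {rmorphism int -> 'Z_(r ^ 2)}) _) map_pnorm.
  rewrite (@pnorm_roots _ _ _ _ (fun i => (u i)%:~R)) => [|||i|i j ij].
  - by under eq_bigr do rewrite horner_map_intr.
  - exact: monic_map.
  - by rewrite size_map_poly_id0 ?fs // (monicP fmon) oner_neq0.
  - by rewrite rootE horner_map_intr (intr_Zp_eq0 _ r1) r2E.
  - by rewrite -rmorphB; apply: intr_Zp_sqr_unit => //; apply: u2.
have dB k x : (k %| a.[x])%Z -> (k %| b.[x])%Z -> (k %| (a - b).[x])%Z.
  by move=> ka kb; rewrite hornerD hornerN rpredB.
case: (eqVneq i j) => [_ ai bi|ij /andP[ai aj] /andP[bi bj]].
  by rewrite -r2E; apply: dvdz_pnorm (u i) _ _ _ _ _; rewrite ?r2E ?dB // expn_gt0 prime_gt0.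
have rF := pchar_Fp pr.
have toF (p : {poly int}) x : (r %| p.[x])%Z -> root (map_poly intr p) (x%:~R : 'F_r).
  by rewrite (dvdz_pcharf rF) -horner_map_intr.
have ru i' : (r %| ('Phi_m).[u i'])%Z by apply: dvdz_trans (u1 i'); rewrite expr2 dvdz_mulr.
apply: (@pnorm_two_roots _ _ _ _ r (u i)%:~R (u j)%:~R rF) => //; try exact: toF;
  try by apply: toF; apply: dB.
by rewrite -subr_eq0 -rmorphB /= -(dvdz_pcharf rF) u2.
Qed.

Lemma cnorm_prime_cover m r : (0 < m)%N -> prime r -> (m %| r.-1)%N ->
  exists E : 'I_(totient m).-1.+1 -> pred {poly int},
    (forall a, (r %| cnorm m a)%Z -> exists i, E i a) /\
    (forall i a b, E i a -> E i b -> (r %| cnorm m (a - b))%Z).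
Proof.
move=> m_gt0 pr mr; have [u [u1 _ u3]] := Cyclotomic_prime_roots m_gt0 pr mr.
exists (fun i a => (r %| a.[u i])%Z); split => [//|i a b ai bi].
apply: dvdz_pnorm (u i) _ _ _ _ _; rewrite ?prime_gt0 //.
- exact: Cyclotomic_monic.
- exact: size_Cyclotomic_pred.
- by apply: dvdz_trans (u1 i); rewrite expr2 dvdz_mulr.
- by rewrite hornerD hornerN rpredB.
Qed.

Lemma norm_prim_root m (z : algC) : (0 < m)%N -> m.-primitive_root z -> `|z| = 1.
Proof.
move=> m_gt0 pz; apply/eqP; rewrite -(@pexpr_eq1 _ `|z| m) //.
by rewrite -normrX prim_expr_order // normr1.
Qed.

(** Phi_m is the minimal polynomial of z over the rationals, and its degree is [totient m]. *)
Lemma Cyclotomic_small_root m (z : algC) (a : {poly int}) :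
  m.-primitive_root z -> (size a <= totient m)%N -> root (map_poly intr a) z ->
  a = 0.
Proof.
move=> pz sa ra; have [p [Ep pmon pP]] := minCpolyP z.
pose q : {poly rat} := map_poly intr a.
have sp : size p = (totient m).+1.
  have := congr1 (fun p : {poly algC} => size p) Ep.
  by rewrite size_map_poly (minCpoly_cyclotomic pz) size_cyclotomic.
have : root (map_poly ratr q) z.
  rewrite -map_poly_comp (eq_map_poly (g := intr)) // => x /=; exact: ratr_int.
rewrite pP => pq; have sq : size q = size a by rewrite size_map_inj_poly //; apply: intr_inj.
have [q0|q0] := eqVneq q 0.
  by apply/eqP; rewrite -size_poly_eq0 -sq q0 size_poly0.
by have := dvdp_leq q0 pq; rewrite sp sq leqNgt ltnS sa.
Qed.

Lemma Cyclotomic_dvd m (z : algC) (a : {poly int}) :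
  m.-primitive_root z -> root (map_poly intr a) z -> exists q, a = q * 'Phi_m.
Proof.
move=> pz ra; have fmon := Cyclotomic_monic m.
have E := Pdiv.RingMonic.rdivp_eq fmon a.
exists (Pdiv.Ring.rdivp a 'Phi_m); rewrite {1}E (_ : Pdiv.Ring.rmodp _ _ = 0) ?addr0 //.
apply: (Cyclotomic_small_root pz).
  by rewrite -ltnS -size_Cyclotomic Pdiv.Ring.ltn_rmodp monic_neq0.
move: ra; rewrite {1}E rmorphD rmorphM /= !rootE hornerD hornerM.
have m_gt0 := prim_order_gt0 pz.
by rewrite (rootP (Cyclotomic_prim_root m_gt0 pz)) mulr0 add0r.
Qed.

Lemma cnorm_algC m (a : {poly int}) : (0 < m)%N ->
  exists2 t : 'I_(totient m).-1.+1 -> algC,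
    forall i, m.-primitive_root (t i) &
    (cnorm m a)%:~R = \prod_i (map_poly intr a).[t i].
Proof.
move=> m_gt0; have [z pz] := C_prim_root_exists m_gt0.
have [t tinj tp] := prim_root_family m_gt0 pz.
by exists t => //; apply: cnorm_prod.
Qed.

Lemma cnorm_neq0 m (a : {poly int}) :
  (0 < m)%N -> (size a <= totient m)%N -> a != 0 -> cnorm m a != 0.
Proof.
move=> m_gt0 sa a0; have [t tp E] := cnorm_algC a m_gt0.
rewrite -(intr_eq0 algC) E; apply/prodf_neq0 => i _.
by apply: contra a0 => ai; apply/eqP/(Cyclotomic_small_root (tp i) sa).
Qed.

Lemma norm_horner_prim_root m (z : algC) (a : {poly int}) (s : nat) d :
  (0 < m)%N -> m.-primitive_root z ->
  (size a <= d)%N -> (forall i, `|a`_i| <= s%:Z) ->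
  `|(map_poly intr a).[z]| <= (d * s)%:R.
Proof.
move=> m_gt0 pz sa sb; rewrite (@horner_coef_wide _ d); last first.
  exact: leq_trans (size_poly _ _) sa.
apply: le_trans (ler_norm_sum _ _ _) _; rewrite natrM.
have -> : d%:R * s%:R = \sum_(i < d) s%:R :> algC.
  by rewrite sumr_const card_ord mulr_natl.
apply: ler_sum => i _; rewrite normrM normrX (norm_prim_root m_gt0 pz) expr1n mulr1.
by rewrite coef_map /= -intr_norm -[s%:R]/(s%:~R) ler_int.
Qed.

Lemma natr_absz_norm (x : int) : `|x|%N%:R = `|x%:~R| :> algC.
Proof. by rewrite natr_absz intr_norm. Qed.

Lemma cnorm_le m (a : {poly int}) (s : nat) :
  (0 < m)%N -> (size a <= totient m)%N -> (forall i, `|a`_i| <= s%:Z) ->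
  (`|cnorm m a| <= (totient m * s) ^ totient m)%N.
Proof.
move=> m_gt0 sa sb; have [t tp E] := cnorm_algC a m_gt0.
rewrite -(ler_nat algC) natr_absz_norm E normr_prod natrX.
have -> : ((totient m * s)%:R ^+ totient m : algC) =
    \prod_(i < (totient m).-1.+1) (totient m * s)%:R.
  by rewrite prodr_const card_ord totient_pred.
apply: ler_prod => i _; rewrite normr_ge0.
exact: norm_horner_prim_root (tp i) _ _.
Qed.

(** With d = [totient m], each conjugate of [a] is at most d H in absolute value, so after the shift
    by (d + 1) H every factor of the norm lies between H and (2d + 1) H. *)
Lemma cnorm_shift m (a : {poly int}) (H : nat) :
  (0 < m)%N -> (size a <= totient m)%N -> (forall i, `|a`_i| <= H%:Z) ->
  let A := `|cnorm m (((totient m).+1 * H)%:Z%:P + a)|%N in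
  (H ^ totient m <= A <= ((totient m).*2.+1 * H) ^ totient m)%N.
Proof.
move=> m_gt0 sa sb; set d := totient m; set b := _ + a => /=.
have [t tp E] := cnorm_algC b m_gt0.
rewrite -!(ler_nat algC) natr_absz_norm E normr_prod !natrX.
have prc (x : algC) : x ^+ d = \prod_(i < (totient m).-1.+1) x.
  by rewrite prodr_const card_ord totient_pred.
rewrite !prc.
have Eb i : (map_poly intr b).[t i] = (d.+1 * H)%:R + (map_poly intr a).[t i].
  by rewrite rmorphD /= map_polyC hornerD hornerC.
have ab i := norm_horner_prim_root m_gt0 (tp i) sa sb.
apply/andP; split; apply: ler_prod => i _; rewrite ?normr_ge0 ?ler0n /= Eb.
  apply: le_trans (lerB_normD _ _); rewrite normr_nat lerBrDr.
  by apply: le_trans (lerD (lexx _) (ab i)) _; rewrite -natrD ler_nat mulSn.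
apply: le_trans (ler_normD _ _) _; rewrite normr_nat.
apply: le_trans (lerD (lexx _) (ab i)) _.
by rewrite -natrD ler_nat -mulnDl leq_mul2r -addnn addSn leqnn orbT.
Qed.

(** * The norm of Z[zeta_m, g^(1/l)] *)

Lemma pnorm_Xn (R : comNzRingType) n (b : {poly R}) :
  pnorm n 'X^(n.+1) b = b`_0 ^+ n.+1.
Proof.
rewrite /pnorm; set C := comp_mx n 'X^(n.+1).
have CE i j : C i j = (i.+1 == j :> nat)%:R.
  rewrite mxE coefXn; case: eqP => // ->.
  by rewrite ltn_eqF ?oppr0 // gtn_eqF.
have [H1 H2] : (forall i j : 'I_n.+1, (j < i)%N -> horner_mx C b i j = 0) /\
    (forall i, horner_mx C b i i = b`_0).
  elim/poly_ind: b => [|b c [IH1 IH2]].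
    by split=> [i j ij|i]; rewrite rmorph0 !mxE ?coef0.
  have E (i j : 'I_n.+1) : (j <= i)%N -> horner_mx C (b * 'X + c%:P) i j = c *+ (i == j).
    move=> ij; rewrite rmorphD rmorphM /= horner_mx_X horner_mx_C !mxE.
    rewrite big1 ?add0r // => k _; rewrite CE.
    have [ki|ki] := ltnP k i; first by rewrite IH1 // mul0r.
    by rewrite gtn_eqF ?mulr0 // ltnS (leq_trans ij).
  split=> [i j ij|i]; rewrite E ?(ltnW ij) //.
    by rewrite -val_eqE gtn_eqF.
  by rewrite eqxx coefD coefMX coefC /= add0r.
rewrite -det_tr det_trig.
  under eq_bigr => i _ do rewrite mxE H2.
  by rewrite prodr_const card_ord.
by apply/is_trig_mxP => i j ij; rewrite mxE H1.
Qed.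

Lemma separable_dvdp_exp (F : fieldType) (p a : {poly F}) k :
  separable_poly p -> p %| a ^+ k -> p %| a.
Proof.
move=> sp pa; set h := gcdp p a.
have hp : h %| p := dvdp_gcdl p a.
have Ep := divpK hp; set q := p %/ h in Ep.
have qa : coprimep q a.
  have : separable_poly (q * h) by rewrite Ep.
  rewrite separable_mul => /and3P[_ _ qh].
  apply/coprimepP => e eq ea; have eh : e %| h by rewrite dvdp_gcd ea -Ep dvdp_mulr.
  by move/coprimepP: qh; apply.
have : q %| 1 * a ^+ k by rewrite mul1r; apply: dvdp_trans pa; rewrite -[X in _ %| X]Ep dvdp_mulr.
rewrite Gauss_dvdpl ?coprimep_expr // => q1.
by rewrite -Ep (dvdp_trans (dvdp_mul q1 (dvdpp h))) // mul1r dvdp_gcdr.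
Qed.

(* Z[zeta_m, g^(1/l)] is modelled by polynomials in y over Z[x]; [relpoly] is
   y^l - g, [relnorm] the relative norm down to Z[x], [topnorm] the norm to Z. *)
Definition relpoly l (g : nat) : {poly {poly int}} := 'X^l - (g%:Z)%:P%:P.

Definition relnorm l g (b : {poly {poly int}}) : {poly int} :=
  pnorm l.-1 (relpoly l g) b.

Definition topnorm m l g (b : {poly {poly int}}) : int := cnorm m (relnorm l g b).

(** The inner variable, standing for zeta_m, takes the value x, and the outer one, standing for
    g^(1/l), the value y. If x and y satisfy the defining equations modulo n, this is a ring
    homomorphism from the order to Z/n. *)
Definition eval2 (b : {poly {poly int}}) (x y : int) : int :=
  (map_poly (horner_eval x) b).[y].

Lemma eval2B b c x y : eval2 (b - c) x y = eval2 b x y - eval2 c x y.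
Proof. by rewrite /eval2 rmorphB /= hornerD hornerN. Qed.

Section TopNorm.

Variables (m l g : nat).
Hypotheses (m_gt0 : (0 < m)%N) (l_gt1 : (1 < l)%N).

Let lE : l.-1.+1 = l. Proof. by rewrite prednK // ltnW. Qed.

Section Map.

Variables (R : comNzRingType) (h : {rmorphism {poly int} -> R}).

Lemma map_relpoly : map_poly h (relpoly l g) = 'X^l - (g%:R)%:P.
Proof.
rewrite /relpoly rmorphB /= map_polyXn map_polyC /=; congr (_ - _%:P).
by rewrite -natz polyC_natr rmorph_nat.
Qed.

Lemma map_relpoly_monic : ('X^l - (g%:R)%:P : {poly R}) \is monic.
Proof. by apply: monicXnsubC; apply: ltnW. Qed.

Lemma size_map_relpoly : size ('X^l - (g%:R)%:P : {poly R}) = l.-1.+2.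
Proof. by rewrite size_XnsubC ?lE // ltnW. Qed.

Lemma map_relnorm b :
  h (relnorm l g b) = pnorm l.-1 ('X^l - (g%:R)%:P) (map_poly h b).
Proof. by rewrite map_pnorm map_relpoly. Qed.

Lemma map_relnorm_root0 b (u : R) :
  u ^+ l = g%:R -> root (map_poly h b) u -> h (relnorm l g b) = 0.
Proof.
move=> ug bu; rewrite map_relnorm; apply: pnorm_root0 bu.
- exact: map_relpoly_monic.
- exact: size_map_relpoly.
- by rewrite rootE !hornerE ug subrr.
Qed.

End Map.

Lemma horner_relnorm b (x : int) : (relnorm l g b).[x] =
  pnorm l.-1 ('X^l - (g%:R)%:P) (map_poly (horner_eval x) b).
Proof. exact: (map_relnorm (horner_eval x)). Qed.

Lemma dvdz_horner_relnorm b (k : nat) (x y : int) : (0 < k)%N ->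
  (k %| y ^+ l - g%:Z)%Z -> (k %| eval2 b x y)%Z -> (k %| (relnorm l g b).[x])%Z.
Proof.
move=> k0 yg bxy; rewrite horner_relnorm; apply: (dvdz_pnorm (t := y)) => //.
- exact: map_relpoly_monic.
- exact: size_map_relpoly.
- by rewrite !hornerE natz.
Qed.

Lemma dvdz_topnorm b (k : nat) (x y : int) : (0 < k)%N ->
  (k %| ('Phi_m).[x])%Z -> (k %| y ^+ l - g%:Z)%Z -> (k %| eval2 b x y)%Z ->
  (k %| topnorm m l g b)%Z.
Proof.
move=> k0 fx yg bxy; apply: (dvdz_pnorm (t := x)) => //.
- exact: Cyclotomic_monic.
- exact: size_Cyclotomic_pred.
- exact: (dvdz_horner_relnorm k0 yg bxy).
Qed.

(** If x and x' differ modulo r, the relative norm has two roots in common with Phi_m. If they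
    agree, y and y' differ, so the relative norm evaluated at the lift x^r is itself divisible by
    r^2, as is Phi_m there. *)
Lemma dvdz_sqr_topnorm b (r : nat) (x y x' y' : int) :
  prime r -> (m %| r.-1)%N ->
  (r %| ('Phi_m).[x])%Z -> (r %| y ^+ l - g%:Z)%Z -> (r %| eval2 b x y)%Z ->
  (r %| ('Phi_m).[x'])%Z -> (r %| y' ^+ l - g%:Z)%Z -> (r %| eval2 b x' y')%Z ->
  ~~ ((r %| x - x')%Z && (r %| y - y')%Z) ->
  (r%:Z ^+ 2 %| topnorm m l g b)%Z.
Proof.
move=> pr mr fx yg bxy fx' yg' bxy'; have rF := pchar_Fp pr.
have toF (p : {poly int}) z : (r %| p.[z])%Z -> root (map_poly intr p) (z%:~R : 'F_r).
  by rewrite (dvdz_pcharf rF) -horner_map_intr.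
have eqF z z' : (r %| z - z')%Z = (z%:~R == z'%:~R :> 'F_r).
  by rewrite (dvdz_pcharf rF) rmorphB subr_eq0.
have r0 := prime_gt0 pr.
have fmon := Cyclotomic_monic m; have fs := size_Cyclotomic_pred m_gt0.
have [xx /= yy|xx _] := boolP (r %| x - x')%Z; last first.
  apply: (@pnorm_two_roots _ _ _ _ r x%:~R x'%:~R rF) => //; try exact: toF.
  - by rewrite -eqF.
  - by apply: toF; apply: (dvdz_horner_relnorm r0 yg bxy).
  - by apply: toF; apply: (dvdz_horner_relnorm r0 yg' bxy').
have r2E : (r ^ 2)%N%:Z = r%:Z ^+ 2 by rewrite -!natz natrX.
pose X := x ^+ r.
have XF : X%:~R = x%:~R :> 'F_r.
  by rewrite rmorphXn /= -(pFrobenius_autE rF) (rmorph_int (pFrobenius_aut rF)).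
have E2 z w : z%:~R = x%:~R :> 'F_r -> (r %| eval2 b z w)%Z ->
    (r %| (map_poly (horner_eval X) b).[w])%Z.
  move=> zx; rewrite !(dvdz_pcharf rF) /eval2.
  suff -> : ((map_poly (horner_eval X) b).[w])%:~R =
      ((map_poly (horner_eval z) b).[w])%:~R :> 'F_r by [].
  rewrite -!horner_map_intr; congr _.[_]; apply/polyP => i.
  by rewrite !coef_map /= /horner_eval -!horner_map_intr XF zx.
rewrite -r2E; apply: (dvdz_pnorm (t := X)) => //; rewrite ?expn_gt0 ?r0 // r2E.
  exact: Cyclotomic_root_lift.
rewrite horner_relnorm.
have toG z : (r %| z ^+ l - g%:Z)%Z -> root (map_poly intr ('X^l - (g%:R)%:P)) (z%:~R : 'F_r).
  by move=> zg; apply: toF; rewrite !hornerE natz.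
apply: (@pnorm_two_roots _ _ _ _ r y%:~R y'%:~R rF).
- exact: map_relpoly_monic.
- exact: size_map_relpoly.
- by rewrite -eqF.
- exact: toG.
- exact: toG.
- by apply: toF; apply: E2 bxy.
- by apply: toF; apply: E2 bxy'; apply/esym/eqP; rewrite -eqF.
Qed.

End TopNorm.

Definition evalC (t : algC) : {poly int} -> algC :=
  horner_eval t \o map_poly (intr : int -> algC).

HB.instance Definition _ (t : algC) := GRing.RMorphism.on (evalC t).

Lemma separable_Cyclotomic_Fp m g : (0 < m)%N -> prime g -> coprime g m ->
  separable_poly (map_poly intr 'Phi_m : {poly 'F_g}).
Proof.
move=> m_gt0 pg cop; apply: (@dvdp_separable _ ('X^m - 1)); last first.
  apply: separable_Xn_sub_1; rewrite -(dvdn_pcharf (pchar_Fp pg)).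
  by rewrite -prime_coprime.
have := congr1 (map_poly (intr : int -> 'F_g)) (prod_Cyclotomic m_gt0).
rewrite rmorphB rmorph1 /= map_polyXn => <-.
rewrite (bigD1_seq m) ?divisors_uniq -?dvdn_divisors //=.
by rewrite rmorphM dvdp_mulr.
Qed.

Section TopIndependence.

Variables (m l g : nat) (t u : algC).
Hypotheses (m_gt0 : (0 < m)%N) (l_gt1 : (1 < l)%N) (pg : prime g).
Hypotheses (cop : coprime g m) (pt : m.-primitive_root t) (ug : u ^+ l = g%:R).

(* The polynomials in reduced form, i.e., the coordinate vectors of
   Z[zeta_m, g^(1/l)]. *)
Definition fits (b : {poly {poly int}}) :=
  (size b <= l)%N && [forall i : 'I_l, (size (b`_i)%R <= totient m)%N].

Lemma fitsP (b : {poly {poly int}}) : reflect ((size b <= l)%N /\ forall i, (size (b`_i)%R <= totient m)%N) (fits b).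
Proof.
apply: (iffP andP) => [[sb /forallP fb]|[sb fb]]; split=> //.
  move=> i; have [il|li] := ltnP i l; first exact: (fb (Ordinal il)).
  by rewrite nth_default ?size_poly0 // (leq_trans sb).
by apply/forallP.
Qed.

(* Modulo g the relative norm is the l-th power of the constant coefficient,
   and Phi_m is squarefree. *)
Lemma evalC_root_coef0 b : fits b -> (map_poly (evalC t) b).[u] = 0 ->
  forall i, (g %| b`_0`_i)%Z.
Proof.
case/fitsP => sb fb b0.
have : evalC t (relnorm l g b) = 0 by apply: map_relnorm_root0 ug _ => //; apply/rootP.
case/rootP/(Cyclotomic_dvd pt) => q Eq.
pose h : {rmorphism {poly int} -> {poly 'F_g}} := map_poly intr.
have gF : g%:R = 0 :> {poly 'F_g} by rewrite -polyC_natr (pcharf0 (pchar_Fp pg)).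
have := @map_relnorm l g _ h b.
rewrite gF subr0 Eq rmorphM -{2}(@prednK l) 1?ltnW // pnorm_Xn coef_map => E.
have : map_poly intr 'Phi_m %| (h b`_0) ^+ l.-1.+1 by rewrite -E dvdp_mull.
move/(separable_dvdp_exp (separable_Cyclotomic_Fp m_gt0 pg cop)) => D.
have h0 : h b`_0 = 0.
  apply/eqP; apply: contraTT D => hn0; apply/negP => /(dvdp_leq hn0).
  have -> : size (map_poly intr 'Phi_m : {poly 'F_g}) = (totient m).+1.
    by rewrite size_map_poly_id0 ?(monicP (Cyclotomic_monic m)) ?oner_neq0 ?size_Cyclotomic.
  by rewrite leqNgt ltnS (leq_trans (size_poly _ _)) // fb.
move=> i; rewrite (dvdz_pcharf (pchar_Fp pg)).
by have := congr1 (fun p : {poly 'F_g} => p`_i) h0; rewrite coef_map coef0 => /= ->.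
Qed.

(* Descent: once g divides the constant coefficient, [b] is y times another
   element of the order because y^l = g. *)
Lemma evalC_root_expn k j b : fits b -> (map_poly (evalC t) b).[u] = 0 ->
  forall i, (g%:Z ^+ k %| b`_j`_i)%Z.
Proof.
move: k j b; have g0 : g%:Z != 0 by rewrite eqz_nat -lt0n prime_gt0.
have u0 : u != 0.
  apply: contra_eq_neq ug => ->; rewrite expr0n eqn0Ngt (ltnW l_gt1) /= eq_sym.
  by rewrite pnatr_eq0 -lt0n prime_gt0.
have key b' : fits b' -> (map_poly (evalC t) b').[u] = 0 ->
  exists b2, [/\ fits b2, (map_poly (evalC t) b2).[u] = 0,
    forall j, (j.+1 < l)%N -> b2`_j = b'`_j.+1 &
    forall i, b'`_0`_i = g%:Z * b2`_l.-1`_i].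
  move=> fb b0; have g_dv := evalC_root_coef0 fb b0.
  have [sb fb'] := fitsP _ fb.
  pose c : {poly int} := \poly_(i < totient m) (b'`_0`_i %/ g)%Z.
  have Ec : b'`_0 = g%:Z *: c.
    apply/polyP => i; rewrite coefZ coef_poly; case: ifP => [_|].
      by rewrite mulrC divzK.
    move/negbT; rewrite -leqNgt => mi; rewrite mulr0 nth_default //.
    by apply: leq_trans mi.
  (* Division by y: the constant term g c equals y^l c and becomes c y^(l-1). *)
  pose b2 := drop_poly 1 b' + c%:P * 'X^(l.-1).
  have Cb2 j : b2`_j = b'`_j.+1 + c *+ (j == l.-1).
    by rewrite coefD coef_drop_poly addn1 coefCM coefXn mulr_natr.
  have b'l : b'`_l = 0 by rewrite nth_default.
  have b2l : b2`_l.-1 = c by rewrite Cb2 prednK ?b'l ?add0r ?eqxx // ltnW.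
  exists b2; split.
  - apply/fitsP; split.
      apply/leq_sizeP => j lj; rewrite Cb2 gtn_eqF ?addr0 ?prednK ?(ltnW l_gt1) //.
      by rewrite nth_default // (leq_trans sb) // ltnW.
    move=> j; rewrite Cb2; case: eqP => [->|_]; last by rewrite addr0.
    rewrite prednK ?(ltnW l_gt1) // b'l add0r; exact: size_poly.
  - apply: (mulfI u0); rewrite mulr0 mulrC -[RHS]b0.
    have Eb : b' = b2 * 'X - c%:P * ('X^l - (g%:R)%:P).
      rewrite /b2 mulrDl -mulrA -exprSr prednK ?(ltnW l_gt1) //.
      rewrite (_ : _ - _ = drop_poly 1 b' * 'X + c%:P * (g%:R)%:P); last by ring.
      rewrite -[LHS](poly_take_drop 1) expr1 addrC; congr (_ + _).
      apply/polyP => i; rewrite coef_take_poly -polyCM coefC.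
      by case: i => [|i] //=; rewrite Ec mulr_natr -natz scaler_nat.
    rewrite [in RHS]Eb rmorphB !rmorphM rmorphB /= map_polyX map_polyXn !map_polyC /=.
    by rewrite !hornerE rmorph_nat ug subrr mulr0 subr0.
  - move=> j jl; rewrite Cb2 ltn_eqF ?addr0 //.
    by rewrite -ltnS prednK // ltnW.
  - by move=> i; rewrite b2l Ec coefZ.
(* Each division by y lowers the index of a coefficient by one; at index 0 it splits off a factor g
   and passes to index l - 1, which is paid for by lowering k. *)
elim=> [|k IHk] j b fb b0; first by move=> i; rewrite expr0 dvd1z.
elim: j b fb b0 => [|j IHj] b fb b0 i.
  have [b2 [fb2 b20 _ ->]] := key b fb b0.
  by rewrite exprS dvdz_mul // IHk.
have [jl|lj] := ltnP j.+1 l.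
  have [b2 [fb2 b20 E _]] := key b fb b0.
  by rewrite -E // IHj.
have [sb _] := fitsP _ fb.
by rewrite (nth_default _ (leq_trans sb lj)) coef0 dvdz0.
Qed.

(** A nonzero coefficient x would be divisible by g^|x| > |x|. This is the linear independence of
    the products t^i u^j, that is, irreducibility of y^l - g over Q(zeta_m). *)
Lemma evalC_root_eq0 b : fits b -> (map_poly (evalC t) b).[u] = 0 -> b = 0.
Proof.
move=> fb b0; apply/polyP => j; apply/polyP => i; rewrite !coef0.
set x := b`_j`_i; apply/eqP; apply: contraT => x0.
have : (g%:Z ^+ `|x|%N %| x)%Z by apply: evalC_root_expn.
rewrite -natz -natrX natz => /(dvdn_leq _).
rewrite /= absz_gt0 x0 => /(_ isT); rewrite leqNgt.
by rewrite ltn_expl // prime_gt1.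
Qed.

End TopIndependence.

Lemma norm_exp_le_nat (u : algC) (g l j : nat) :
  (0 < g)%N -> u ^+ l = g%:R -> (j < l)%N -> `|u| ^+ j <= g%:R.
Proof.
move=> g0 ug jl; have ul : `|u| ^+ l = g%:R by rewrite -normrX ug normr_nat.
have [u1|u1] := real_leP (normr_real u) (real1 _).
  by apply: (@le_trans _ _ 1); rewrite ?ler1n // exprn_ile1.
by rewrite -ul; apply: ler_weXn2l; [apply: ltW | apply: ltnW].
Qed.

Lemma topnorm_algC m l g b : (0 < m)%N -> (1 < l)%N -> (0 < g)%N ->
  exists (t : 'I_(totient m).-1.+1 -> algC) (u : 'I_l.-1.+1 -> algC),
    [/\ forall i, m.-primitive_root (t i), forall j, u j ^+ l = g%:R &
    (topnorm m l g b)%:~R = \prod_i \prod_j (map_poly (evalC (t i)) b).[u j]].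
Proof.
move=> m_gt0 l_gt1 g_gt0.
have [t tp E] := cnorm_algC (relnorm l g b) m_gt0.
have [w pw] := C_prim_root_exists (ltnW l_gt1).
pose u0 : algC := l.-root g%:R.
have u0l : u0 ^+ l = g%:R by rewrite rootCK // ltnW.
have u00 : u0 != 0.
  apply: contra_eq_neq u0l => ->; rewrite expr0n eqn0Ngt (ltnW l_gt1) /= eq_sym.
  by rewrite pnatr_eq0 -lt0n.
pose u (j : 'I_l.-1.+1) := w ^+ j * u0.
have ul j : u j ^+ l = g%:R by rewrite exprMn u0l -exprM mulnC exprM (prim_expr_order pw) expr1n mul1r.
exists t, u; split => //; rewrite /topnorm E; apply: eq_bigr => i _.
rewrite -[LHS]/(evalC (t i) (relnorm l g b)) map_relnorm //.
apply: pnorm_roots => [|||j k jk].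
- exact: map_relpoly_monic.
- exact: size_map_relpoly.
- by move=> j; rewrite rootE !hornerE ul subrr.
- rewrite unitfE subr_eq0 (inj_eq (mulIf u00)) (eq_prim_root_expr pw).
  have lE : l.-1.+1 = l by rewrite prednK // ltnW.
  have kl (i' : 'I_l.-1.+1) : (i' < l)%N by rewrite -[X in (_ < X)%N]lE.
  by rewrite !modn_small.
Qed.

Lemma topnorm_neq0 m l g b : (0 < m)%N -> (1 < l)%N -> prime g -> coprime g m ->
  fits m l b -> b != 0 -> topnorm m l g b != 0.
Proof.
move=> m_gt0 l_gt1 pg cop fb b0.
have [t [u [tp ul E]]] := topnorm_algC b m_gt0 l_gt1 (prime_gt0 pg).
rewrite -(intr_eq0 algC) E; apply/prodf_neq0 => i _; apply/prodf_neq0 => j _.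
by apply: contra b0 => /eqP/(evalC_root_eq0 m_gt0 l_gt1 pg cop (tp i) (ul j) fb)->.
Qed.

Lemma topnorm_le m l g b (s : nat) : (0 < m)%N -> (1 < l)%N -> (0 < g)%N ->
  fits m l b -> (forall j i, `|b`_j`_i| <= s%:Z) ->
  (`|topnorm m l g b| <= (l * (totient m * s) * g) ^ (l * totient m))%N.
Proof.
move=> m_gt0 l_gt1 g_gt0 /fitsP[sb fb] bs.
have [t [u [tp ul E]]] := topnorm_algC b m_gt0 l_gt1 g_gt0.
rewrite -(ler_nat algC) natr_absz_norm E normr_prod expnM natrX natrX.
set K : algC := (l * (totient m * s) * g)%:R.
have -> : (K ^+ l) ^+ totient m = \prod_(i < (totient m).-1.+1) K ^+ l.
  by rewrite prodr_const card_ord totient_pred.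
apply: ler_prod => i _; rewrite normr_ge0 normr_prod /=.
have -> : K ^+ l = \prod_(j < l.-1.+1) K by rewrite prodr_const card_ord prednK // ltnW.
apply: ler_prod => j _; rewrite normr_ge0 /=.
rewrite (@horner_coef_wide _ l); last exact: leq_trans (size_poly _ _) sb.
apply: le_trans (ler_norm_sum _ _ _) _.
have -> : K = \sum_(k < l) (totient m * s)%:R * g%:R.
  by rewrite sumr_const card_ord /K -natrM -mulrnA -mulnA mulnC.
apply: ler_sum => k _; rewrite normrM normrX; apply: ler_pM => //.
  by rewrite coef_map; exact: (norm_horner_prim_root m_gt0 (tp i) (fb k) (bs k)).
exact: norm_exp_le_nat (ul j) _.
Qed.

(** * Density *)

Definition psum (S : pred nat) (a b : nat) : rat :=
  \sum_(a <= r < b | prime r && S r) r%:R^-1.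

Definition thin (S : pred nat) := exists B : nat, forall N, psum S 0 N <= B%:R.

Definition cnt (P : pred nat) (x : nat) : nat := (\sum_(1 <= n < x.+1) P n)%N.

(* Natural density zero. *)
Definition rare (P : pred nat) :=
  forall k, exists x0, forall x, (x0 <= x)%N -> (k * cnt P x <= x)%N.

Lemma psum_cat S a b c : (a <= b)%N -> (b <= c)%N ->
  psum S a c = psum S a b + psum S b c.
Proof. by move=> ab bc; rewrite /psum (big_cat_nat ab bc). Qed.

Lemma psum_ge0 S a b : 0 <= psum S a b.
Proof. by apply: sumr_ge0 => r _; rewrite invr_ge0 ler0n. Qed.

Lemma thin_tail S k : thin S -> exists y, forall N, k%:R * psum S y N <= 1.
Proof.
case=> B SB; apply: contrapT => /forallNP H.
have {}H y : exists2 N, (y <= N)%N & 1 < k%:R * psum S y N.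
  have /existsNP[N /negP] := H y; rewrite -ltNge => lt1; exists N => //.
  rewrite leqNgt; apply/negP => Ny; move: lt1.
  by rewrite /psum big_geq ?mulr0 ?ltr10 // ltnW.
have grow j : exists N, j%:R <= k%:R * psum S 0 N.
  elim: j => [|j [N IH]]; first by exists 0%N; rewrite mulr_ge0 ?psum_ge0 ?ler0n.
  have [M NM lt1] := H N; exists M; rewrite (@psum_cat S 0 N M) // mulrDr -natr1.
  by rewrite lerD // ltW.
have [N] := grow (k * B).+1; rewrite leNgt; case/negP.
apply: le_lt_trans (ler_wpM2l _ (SB N)) _; first by rewrite ler0n.
by rewrite -natrM ltr_nat.
Qed.

(** A prime r <= X counts for at most X / r, so the primes beyond y contribute at most X / (2k); the
    y smaller integers contribute no more once X >= 2 k y. *)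
Lemma thin_count S k : thin S -> exists X0, forall X, (X0 <= X)%N ->
  (k * \sum_(0 <= r < X.+1) (prime r && S r) <= X)%N.
Proof.
move=> tS; have [y Hy] := thin_tail (k * 2) tS; exists (2 * k * y)%N => X yX.
pose F r : nat := prime r && S r.
have yE : (\sum_(0 <= r < X.+1) F r <= y + \sum_(y <= r < X.+1) F r)%N.
  have [yX1|Xy] := leqP y X.+1; last first.
    apply: leq_trans (leq_addr _ _); apply: (@leq_trans X.+1); last exact: ltnW.
    rewrite -[X in (_ <= X)%N](subn0 X.+1) -[X in (_ <= X)%N]muln1 -sum_nat_const_nat.
    by apply: leq_sum => r _; rewrite /F; case: (_ && _).
  rewrite (@big_cat_nat _ _ _ y) //= leq_add2r.
  rewrite -[X in (_ <= X)%N](subn0 y) -[X in (_ <= X)%N]muln1 -sum_nat_const_nat.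
  by apply: leq_sum => r _; rewrite /F; case: (_ && _).
have tail : (k * 2 * \sum_(y <= r < X.+1) F r <= X)%N.
  rewrite -(ler_nat rat) natrM natr_sum.
  apply: (@le_trans _ _ ((k * 2)%:R * (X%:R * psum S y X.+1))); last first.
    by rewrite mulrCA -[leRHS]mulr1 ler_wpM2l.
  rewrite ler_wpM2l // /psum mulr_sumr [leRHS]big_mkcond /= !big_nat.
  apply: ler_sum => r /andP[_ rX]; rewrite /F; case: ifP => //= /andP[pr _].
  by rewrite ler_pdivlMr ?mul1r ?ler_nat // ltr0n prime_gt0.
rewrite -[X in (k * X <= _)%N]/(\sum_(0 <= r < X.+1) F r)%N.
move: yE tail; set A := (\sum_(0 <= r < _) _)%N; set C := (\sum_(y <= r < _) _)%N.
move=> AC; have := leq_mul (leqnn k) AC; rewrite mulnDr; lia.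
Qed.

Lemma cnt_dvd d x : cnt (fun n => d %| n)%N x = (x %/ d)%N.
Proof. by rewrite divn_count_dvd. Qed.

Lemma natr_div_le (x d : nat) : (0 < d)%N -> (x %/ d)%:R <= x%:R / d%:R :> rat.
Proof. by move=> d0; rewrite ler_pdivlMr ?ltr0n // -natrM ler_nat leq_divM. Qed.

Lemma natr_div_ge (x d : nat) : (0 < d)%N -> x%:R / d%:R - 1 <= (x %/ d)%:R :> rat.
Proof.
move=> d0; rewrite lerBlDr natr1 ler_pdivrMr ?ltr0n // -natrM ler_nat ltnW //.
exact: ltn_ceil.
Qed.

Lemma sum_dvd_le_count (S : pred nat) N n : (0 < n)%N ->
  (\sum_(0 <= r < N | prime r && S r) (r %| n) <= count S (primes n))%N.
Proof.
move=> n0; rewrite -big_mkcondr /= sum1_count.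
rewrite -size_filter -(size_filter S); apply: uniq_leq_size.
  by rewrite filter_uniq // /index_iota iota_uniq.
move=> r; rewrite !mem_filter mem_primes n0 /= => /andP[/andP[/andP[-> ->] ->]].
by [].
Qed.

(** Expand the square. Distinct primes r and s both divide at most x / (r s) of the n, equal ones at
    most x / r, which bounds the second moment; rounding costs at most N in the first moment, whence
    the term 2 mu N. *)
Lemma turan (S : pred nat) N x :
  let mu := psum S 0 N in
  \sum_(1 <= n < x.+1)
    ((\sum_(0 <= r < N | prime r && S r) (r %| n)%:R) - mu) ^+ 2
  <= x%:R * mu + 2%:R * mu * N%:R.
Proof.
set mu := psum S 0 N => /=.
pose w n : rat := \sum_(0 <= r < N | prime r && S r) (r %| n)%:R.
have mu0 : 0 <= mu := psum_ge0 _ _ _.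
have cntR d : (\sum_(1 <= n < x.+1) (d %| n)%:R : rat) = (x %/ d)%:R.
  by rewrite -natr_sum -cnt_dvd.
have S1 : x%:R * mu - N%:R <= \sum_(1 <= n < x.+1) w n.
  rewrite /w exchange_big /= /mu /psum mulr_sumr.
  apply: (@le_trans _ _ (\sum_(0 <= r < N | prime r && S r) (x%:R / r%:R - 1))).
    rewrite sumrB lerD2l lerN2.
    rewrite -[X in X <= _](natr_sum _ _ _ (fun _ => 1%N)) ler_nat.
    rewrite big_mkcond -[X in (_ <= X)%N](subn0 N) -[X in (_ <= X)%N]muln1.
    by rewrite -sum_nat_const_nat; apply: leq_sum => r _; case: ifP.
  apply: ler_sum => r /andP[pr _]; rewrite cntR.
  by apply: natr_div_ge; rewrite prime_gt0.
have S2 : \sum_(1 <= n < x.+1) w n ^+ 2 <= x%:R * mu ^+ 2 + x%:R * mu.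
  have -> : \sum_(1 <= n < x.+1) w n ^+ 2 =
     \sum_(0 <= r < N | prime r && S r) \sum_(0 <= s < N | prime s && S s)
       \sum_(1 <= n < x.+1) ((r %| n) && (s %| n))%N%:R.
    under eq_bigr do rewrite expr2 /w mulr_suml.
    rewrite exchange_big /=; apply: eq_bigr => r _.
    under eq_bigr do rewrite mulr_sumr.
    rewrite exchange_big /=; apply: eq_bigr => s _.
    by apply: eq_bigr => n _; rewrite -natrM mulnb.
  have -> : x%:R * mu ^+ 2 + x%:R * mu =
     \sum_(0 <= r < N | prime r && S r) (\sum_(0 <= s < N | prime s && S s)
       x%:R / (r%:R * s%:R) + x%:R / r%:R).
    rewrite big_split /= -mulr_sumr; congr (_ + _).
    rewrite expr2 {1}/mu /psum mulr_suml mulr_sumr; apply: eq_bigr => r _.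
    rewrite /mu /psum mulrA mulr_sumr.
    apply: eq_bigr => s _; by rewrite invfM; ring.
  apply: ler_sum => r /andP[pr Sr]; have r0 := prime_gt0 pr.
  apply: (@le_trans _ _ (\sum_(0 <= s < N | prime s && S s)
      (x%:R / (r%:R * s%:R) + (s == r)%:R * (x%:R / r%:R)))).
    apply: ler_sum => s /andP[ps Ss]; have s0 := prime_gt0 ps.
    have [->|sr] := eqVneq s r.
      under eq_bigr do rewrite andbb.
      rewrite mul1r cntR; apply: ler_wpDl (natr_div_le x r0).
      by rewrite divr_ge0 ?mulr_ge0 ?ler0n.
    rewrite mul0r addr0 -natrM; apply: le_trans (natr_div_le x _); last first.
      by rewrite muln_gt0 r0.
    have E n : ((r %| n) && (s %| n) = (r * s %| n))%N.
      by rewrite Gauss_dvd // prime_coprime // dvdn_prime2 // eq_sym.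
    by rewrite -cntR; under eq_bigr do rewrite E.
  rewrite big_split lerD2l /= -mulr_suml ler_piMl ?divr_ge0 ?ler0n //.
  rewrite -natr_sum lern1 -big_mkcondr sum1_count /=.
  apply: leq_trans (sub_count (a2 := pred1 r) _ _) _; first by move=> s /andP[].
  by rewrite count_uniq_mem ?leq_b1 // /index_iota iota_uniq.
under eq_bigr do rewrite -/(w _) sqrrB.
rewrite big_split sumrB /= sumr_const_nat subn1 /= -mulrnAr.
under [X in _ - X]eq_bigr do rewrite -mulr_natr -mulrA.
rewrite -mulr_suml -mulr_natl; nra.
Qed.

Lemma not_thin_large S B : ~ thin S -> exists N, B%:R < psum S 0 N.
Proof.
move=> nS; apply: contrapT => /forallNP H; apply: nS; exists B => N.
by rewrite leNgt; apply/negP/H.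
Qed.

Lemma rare_few_primes S V : ~ thin S ->
  rare (fun n => count S (primes n) < V)%N.
Proof.
(* From mu >= 2V an n with fewer than V such primes deviates from mu by at least mu / 2, so the
   variance bound gives C mu <= 8x for their number C; mu >= 8k then yields k C <= x. *)
move=> nS k; have [N] := not_thin_large (8 * k + 2 * V + 1) nS.
set mu := psum S 0 N => muB; exists (2 * N)%N => x xN.
have := turan S N x; rewrite -/mu /=; set T := \sum_(_ <= _ < _) _ => HT.
have muV : V%:R <= mu / 2%:R.
  rewrite ler_pdivlMr // ltW // (le_lt_trans _ muB) // -natrM ler_nat; lia.
have mu0 : 0 < mu by apply: lt_trans muB; rewrite ltr0n addn1.
pose C := cnt (fun n => count S (primes n) < V)%N x.
have TC : C%:R * (mu / 2%:R) ^+ 2 <= T.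
  rewrite /C /cnt natr_sum mulr_suml /T !big_nat; apply: ler_sum => n /andP[n0 _].
  case: ltnP => [lV|_]; last by rewrite mul0r sqr_ge0.
  rewrite mul1r -[leRHS]sqrrN; apply: lerXn2r; rewrite ?nnegrE //.
  - by rewrite divr_ge0 // ltW.
  - rewrite opprB subr_ge0 -natr_sum (le_trans _ (le_trans muV _)) //; last first.
      by rewrite ler_piMr ?ltW // invf_lt1 // ltr1n.
    by rewrite ler_nat (leq_trans (sum_dvd_le_count S N n0)) // ltnW.
  rewrite opprB -natr_sum lerBrDr (le_trans (lerD (lexx _) (_ : _ <= mu / 2%:R))) //.
    by rewrite (le_trans _ muV) // ler_nat (leq_trans (sum_dvd_le_count S N n0)) // ltnW.
  by rewrite le_eqVlt; apply/orP; left; apply/eqP; field.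
have kmu : 8%:R * k%:R <= mu.
  by rewrite ltW // (le_lt_trans _ muB) // -natrM ler_nat; lia.
rewrite -(ler_nat rat) natrM -/C.
have H1 : C%:R * mu <= 4%:R * (x%:R + 2%:R * N%:R).
  rewrite -(ler_pM2r mu0); move: (le_trans TC HT); rewrite expr2; nra.
have H2 : 2%:R * N%:R <= x%:R :> rat by rewrite -natrM ler_nat.
have C0 : 0 <= C%:R :> rat by rewrite ler0n.
nra.
Qed.

Lemma rareU P Q : rare P -> rare Q -> rare (fun n => P n || Q n).
Proof.
move=> rP rQ k; have [a Ha] := rP (2 * k)%N; have [b Hb] := rQ (2 * k)%N.
exists (maxn a b) => x; rewrite geq_max => /andP[/Ha h1 /Hb h2].
have : (cnt (fun n => P n || Q n) x <= cnt P x + cnt Q x)%N.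
  by rewrite /cnt -big_split /=; apply: leq_sum => n _; case: (P n) (Q n) => [] [].
nia.
Qed.

Lemma cnt_sub (P Q : pred nat) x :
  (forall n, (0 < n)%N -> P n -> Q n) -> (cnt P x <= cnt Q x)%N.
Proof.
move=> PQ; rewrite /cnt !big_nat; apply: leq_sum => n /andP[n0 _].
by case: (boolP (P n)) => // /(PQ n n0) ->.
Qed.

Lemma rare_sub (P Q : pred nat) :
  (forall n, (0 < n)%N -> P n -> Q n) -> rare Q -> rare P.
Proof.
move=> PQ rQ k; have [a Ha] := rQ k; exists a => x /Ha; apply: leq_trans.
by rewrite leq_mul2l cnt_sub ?orbT.
Qed.

Lemma rare_has (P : nat -> pred nat) s :
  (forall i, i \in s -> rare (P i)) -> rare (fun n => has (fun i => P i n) s).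
Proof.
elim: s => [|i s IH] Hs.
  by move=> k; exists 0%N => x _; rewrite /cnt /= big1 ?muln0.
apply: rareU; first by apply: Hs; rewrite inE eqxx.
by apply: IH => j js; apply: Hs; rewrite inE js orbT.
Qed.

(** Since r is prime to W, the j in question lie in one class modulo r and are told apart by their
    quotients j / r. *)
Lemma cnt_progression W r x : coprime r W -> (0 < r)%N ->
  (cnt (fun j => r %| 1 + W * j) x <= (x %/ r).+1)%N.
Proof.
move=> cop r0; rewrite /cnt big_add1 /= big_mkord.
pose A := [pred j : 'I_x | (r %| 1 + W * j.+1)%N].
rewrite (_ : \sum_(i < x) _ = #|A|)%N; last first.
  by rewrite -sum1_card [RHS]big_mkcond; apply: eq_bigr => i _; rewrite inE; case: (_ %| _)%N.
rewrite -[X in (_ <= X)%N](card_ord (x %/ r).+1).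
apply: (@leq_card_in _ _ (fun j : 'I_x => inord (j %/ r))).
move=> i j; rewrite !inE => Ai Aj /(congr1 val) /=.
rewrite !inordK ?ltnS ?leq_div2r ?(ltnW (ltn_ord _)) // => E.
apply/val_inj; rewrite /= (divn_eq i r) (divn_eq j r) E; congr (_ + _)%N.
wlog ij : i j Ai Aj E / (i <= j)%N.
  by move=> H; case/orP: (leq_total i j) => h; [|symmetry]; apply: H.
have : (r %| W * (j - i))%N.
  by have := dvdn_sub Aj Ai; rewrite subnDl -mulnBr subSS.
rewrite Gauss_dvdr // -eqn_mod_dvd // => /eqP ->.
by [].
Qed.

Lemma prime_coprime_fact r k : prime r -> (k < r)%N -> coprime r k`!.
Proof.
move=> pr; elim: k => [|k IH] kr; first by rewrite coprimen1.
by rewrite factS coprimeMr IH ?(ltnW kr) // prime_coprime // gtnNdvd.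
Qed.

(* If the tail of the sum over primes >= y were small, almost all 1 + Wj with
   W = (y-1)! would have no prime factor at all. *)
Lemma primes_not_thin : ~ thin predT.
Proof.
move=> tS; have [y Hy] := thin_tail 4 tS.
pose W := (y.-1)`!; have W0 : (0 < W)%N := fact_gt0 _.
(* The numbers 1 + W j are at most X = W x + 1 <= (W + 1) x, so this factor leaves at most x / 4
   primes up to X, each costing one rounding error. The tail sum gives another x / 4, less than x in
   all. *)
have [X0 HX] := thin_count (4 * (W + 1))%N tS.
pose x := (X0 + 1)%N; pose X := (W * x + 1)%N.
have xX : (X0 <= X)%N by rewrite /X /x; nia.
have := HX X xX; set c := (\sum_(0 <= r < X.+1) _)%N => Hc.
have lty r : (y <= r)%N -> prime r -> (y.-1 < r)%N.
  by case: (y) => [|y'] //= _ /prime_gt0.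
have E : (x <= \sum_(y <= r < X.+1 | prime r) cnt (fun j => r %| 1 + W * j) x)%N.
  rewrite /cnt exchange_big /=.
  rewrite -{1}[x](addKn 1%N) add1n -[X in (X <= _)%N]muln1 -sum_nat_const_nat.
  rewrite !big_nat; apply: leq_sum => j /andP[j0 jx].
  pose r := pdiv (1 + W * j).
  have Wj : (1 < 1 + W * j)%N by rewrite -[X in (X < _)%N]addn0 ltn_add2l muln_gt0 W0.
  have pr : prime r by apply: pdiv_prime.
  have ry : (y <= r)%N.
    rewrite leqNgt; apply/negP => ry.
    have rW : (r %| W)%N.
      by apply: dvdn_fact; rewrite prime_gt0 //= -ltnS prednK // (leq_trans _ ry).
    have := pdiv_dvd (1 + W * j); rewrite -/r dvdn_addl ?dvdn_mulr // dvdn1.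
    by move/eqP => r1; rewrite r1 in pr.
  rewrite big_mkcond (bigD1_seq r) /= ?iota_uniq ?pr //; first by rewrite pdiv_dvd.
  rewrite mem_index_iota ry ltnS (leq_trans (pdiv_leq _)) // /X addnC leq_add2r.
  by rewrite leq_mul2l -ltnS jx orbT.
have H1 : x%:R <= x%:R * psum predT y X.+1 + c%:R.
  apply: (@le_trans _ _ (\sum_(y <= r < X.+1 | prime r) (x %/ r).+1)%:R).
    rewrite ler_nat; apply: (leq_trans E).
    rewrite big_nat_cond [leqRHS]big_nat_cond; apply: leq_sum => r.
    case/andP => /andP[ry _] pr; apply: cnt_progression; last exact: prime_gt0.
    by apply: prime_coprime_fact => //; apply: lty.
  rewrite natr_sum; under eq_bigr do rewrite -natr1.
  rewrite big_split /= lerD //.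
    rewrite /psum mulr_sumr; under [leRHS]eq_bigl do rewrite andbT.
    by apply: ler_sum => r pr; rewrite natr_div_le ?prime_gt0.
  rewrite -[X in X <= _](natr_sum _ _ _ (fun _ => 1%N)) ler_nat big_mkcond /c.
  have [yX|Xy] := leqP y X.+1; last by rewrite big_geq // ltnW.
  rewrite [X in (_ <= X)%N](@big_cat_nat _ _ _ y) //=.
  apply: leq_trans (leq_addl _ _); apply: leq_sum => r _; by rewrite andbT; case: prime.
have H2 := Hy X.+1.
have H3 : 4%:R * (W%:R + 1) * c%:R <= W%:R * x%:R + 1 :> rat.
  by rewrite natr1 -!natrM natr1 ler_nat; move: Hc; rewrite /X !addn1.
have W1 : 1 <= W%:R :> rat by rewrite ler1n.
have x1 : 1 <= x%:R :> rat by rewrite ler1n /x addn1.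
have c0 : 0 <= c%:R :> rat by rewrite ler0n.
have xp : 4%:R * (x%:R * psum predT y X.+1) <= x%:R.
  by rewrite mulrCA -[leRHS]mulr1 ler_wpM2l.
have : 4%:R * c%:R <= x%:R :> rat.
  have W2 : 0 < W%:R + 1 :> rat by lra.
  rewrite -(ler_pM2l W2) mulrA (mulrC (W%:R + 1)) (le_trans H3) // mulrDl mul1r.
  by rewrite lerD2l.
lra.
Qed.

(** * Lattice points *)

(* Cut the box into cubes of side t.+1: each contains at most one point. *)
Lemma packing d N t (Y : pred {ffun 'I_d -> 'I_N}) :
  (forall b b', Y b -> Y b' ->
     (forall i, (b i <= b' i + t)%N && (b' i <= b i + t)%N) -> b = b') ->
  (#|Y| <= (N %/ t.+1).+1 ^ d)%N.
Proof.
move=> HY; rewrite -[X in (_ <= _ ^ X)%N](card_ord d).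
rewrite -[X in (_ <= X ^ _)%N](card_ord (N %/ t.+1).+1) -card_ffun.
apply: (@leq_card_in _ _ (fun b : {ffun 'I_d -> 'I_N} =>
  [ffun i => inord (b i %/ t.+1) : 'I_(N %/ t.+1).+1])).
move=> b b' Yb Yb' E; apply: HY => // i.
have := congr1 (fun f : {ffun 'I_d -> 'I_(N %/ t.+1).+1} => val (f i)) E.
rewrite !ffunE /= !inordK ?ltnS ?leq_div2r ?(ltnW (ltn_ord _)) // => Ei.
have := divn_eq (b i) t.+1; have := divn_eq (b' i) t.+1; rewrite Ei.
have := ltn_pmod (b i) (ltn0Sn t); have := ltn_pmod (b' i) (ltn0Sn t).
rewrite !ltnS; lia.
Qed.

Definition boxpoly d N (b : {ffun 'I_d -> 'I_N}) : {poly int} :=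
  rVpoly (\row_i (b i : nat)%:Z).

Lemma boxpoly_inj d N : injective (@boxpoly d N).
Proof.
move=> b b' /(can_inj rVpolyK) /rowP E; apply/ffunP => i.
by apply/val_inj; have := E i; rewrite !mxE => -[].
Qed.

Lemma size_boxpoly d N (b : {ffun 'I_d -> 'I_N}) : (size (boxpoly b) <= d)%N.
Proof. exact: size_poly. Qed.

Lemma coef_boxpoly d N (b : {ffun 'I_d -> 'I_N}) k :
  exists2 c : nat, (boxpoly b)`_k = c%:Z & (0 < c)%N -> (c < N)%N.
Proof.
rewrite /boxpoly coef_rVpoly; case: insubP => [i _ _|_]; last by exists 0%N.
by rewrite mxE; exists (b i) => // _; apply: ltn_ord.
Qed.

(** Take the largest t with (d t)^d < M, where d = [totient m]. A nonzero difference with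
    coordinates at most t has norm below M, yet M divides it; so a cube of side t + 1 holds one
    point. If t + 1 <= N there are at most (2N / (t + 1))^d cubes and M <= (d (t + 1))^d; otherwise
    one cube covers the box, which accounts for the summand M. *)
Lemma cnorm_packing m N M (Y : pred {ffun 'I_(totient m) -> 'I_N}) :
  (0 < m)%N -> (0 < M)%N ->
  (forall b b', Y b -> Y b' -> (M %| cnorm m (boxpoly b - boxpoly b'))%Z) ->
  (M * #|Y| <= (2 * totient m) ^ totient m * N ^ totient m + M)%N.
Proof.
move=> m_gt0 M0 HY.
have d0 : (0 < totient m)%N by rewrite totient_gt0.
have exP : exists t, ((totient m * t) ^ totient m < M)%N by exists 0%N; rewrite muln0 exp0n.
have ubP t : ((totient m * t) ^ totient m < M)%N -> (t <= M)%N.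
  move=> H; apply: ltnW; apply: leq_ltn_trans H.
  case: t => // t; apply: (@leq_trans (totient m * t.+1)); first by rewrite leq_pmull.
  by rewrite -{1}[(_ * _)%N]expn1 leq_pexp2l // muln_gt0 d0.
have [t tM tmax] := ex_maxnP exP ubP.
have tM1 : (M <= (totient m * t.+1) ^ totient m)%N.
  by rewrite leqNgt; apply/negP => /tmax; rewrite ltnn.
have PY : (#|Y| <= (N %/ t.+1).+1 ^ totient m)%N.
  apply: packing => b b' Yb Yb' bb; apply: boxpoly_inj.
  apply/eqP; rewrite -subr_eq0; apply: contraLR (HY b b' Yb Yb') => n0.
  have sB : (size (boxpoly b - boxpoly b')%R <= totient m)%N.
    by rewrite (leq_trans (size_polyD _ _)) // size_polyN geq_max !size_boxpoly.
  have n1 := cnorm_neq0 m_gt0 sB n0.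
  apply/negP => /(dvdn_leq _); rewrite absz_gt0 n1 => /(_ isT) /=.
  rewrite leqNgt (leq_ltn_trans _ tM) //; apply: cnorm_le => // k.
  rewrite coefB /boxpoly !coef_rVpoly; case: insubP => [i _ _|_]; last by rewrite subrr.
  rewrite !mxE; have := bb i; lia.
have [tN|Nt] := leqP t.+1 N.
  apply: leq_trans (leq_addr _ _); rewrite expnMn mulnAC -expnMn.
  apply: leq_trans (leq_mul tM1 (leqnn _)) _; rewrite expnMn -mulnA [leqRHS]mulnC.
  rewrite leq_mul2l; apply/orP; right.
  apply: leq_trans (leq_mul (leqnn _) PY) _; rewrite -expnMn leq_exp2r //.
  have := leq_divM N t.+1; nia.
apply: leq_trans (leq_addl _ _); rewrite -[leqRHS]muln1 leq_mul2l.
by apply/orP; right; apply: leq_trans PY _; rewrite divn_small // exp1n.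
Qed.

Lemma leq_card_fibre (T T' : finType) (f : T -> T') (A : pred T) F :
  (forall z, (#|[pred x | A x & f x == z]| <= F)%N) -> (#|A| <= F * #|T'|)%N.
Proof.
move=> HF; rewrite -sum1_card (partition_big f predT) //= mulnC -sum_nat_const.
by apply: leq_sum => z _; rewrite (leq_trans _ (HF z)) // -sum1_card.
Qed.

Lemma leq_card_cover_pred (T I : finType) (A : pred T) (E : I -> pred T) :
  (forall x, A x -> exists i, E i x) -> (#|A| <= \sum_i #|E i|)%N.
Proof.
move=> HA; rewrite -sum1_card.
have cE i : #|E i| = (\sum_x E i x)%N.
  by rewrite -sum1_card big_mkcond; apply: eq_bigr => x _; rewrite unfold_in; case: (E i x).
rewrite (eq_bigr _ (fun i _ => cE i)).
rewrite exchange_big /= big_mkcond; apply: leq_sum => x _.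
by case: ifP => // /HA[i Ei]; rewrite (bigD1 i) //= Ei.
Qed.

Lemma dvdn_sqfree n z : (0 < n)%N -> (forall r, prime r -> ~~ (r ^ 2 %| n)%N) ->
  (forall r, prime r -> (r %| n)%N -> (r %| z)%N) -> (n %| z)%N.
Proof.
move=> n0 sf nz; apply/(dvdn_partP _ n0) => r rn.
have pr : prime r by apply: pi_pdiv_prime rn || (move: rn; rewrite mem_primes => /andP[]).
have rdn : (r %| n)%N by move: rn; rewrite mem_primes => /and3P[].
rewrite p_part; apply: (@dvdn_trans (r ^ 1)); last by rewrite expn1 nz.
apply: dvdn_exp2l; rewrite leqNgt -pfactor_dvdn //; exact: sf.
Qed.

Definition mkpoly l d (M : 'M[int]_(l, d)) : {poly {poly int}} :=
  \sum_(j < l) (rVpoly (row j M))%:P * 'X^j.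

Lemma mkpolyB l d (M M' : 'M[int]_(l, d)) : mkpoly (M - M') = mkpoly M - mkpoly M'.
Proof.
rewrite /mkpoly -sumrB; apply: eq_bigr => j _.
by rewrite !linearB /= polyCB mulrBl.
Qed.

Lemma coef_mkpoly l d (M : 'M[int]_(l, d)) (k : nat) :
  (mkpoly M)`_k = if insub k is Some j then rVpoly (row j M) else 0.
Proof.
rewrite /mkpoly coef_sum; case: insubP => [j _ jk|kl].
  rewrite (bigD1 j) //= coefCM coefXn jk eqxx mulr1 big1 ?addr0 // => i ij.
  rewrite coefCM coefXn; case: eqP => [E|_]; last by rewrite mulr0.
  by case/eqP: ij; apply: val_inj; rewrite /= -E jk.
rewrite big1 // => i _; rewrite coefCM coefXn; case: eqP => [E|_]; last by rewrite mulr0.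
by rewrite E ltn_ord in kl.
Qed.

Lemma mkpoly_eq0 l d (M : 'M[int]_(l, d)) : mkpoly M = 0 -> M = 0.
Proof.
move=> M0; apply/row_matrixP => j; rewrite row0.
have := coef_mkpoly M j; rewrite M0 coef0; case: insubP => [i _ ij|]; last by rewrite ltn_ord.
by rewrite (val_inj ij) => /esym E; apply: (can_inj rVpolyK); rewrite E linear0.
Qed.

Lemma fits_mkpoly m l (M : 'M[int]_(l, totient m)) : fits m l (mkpoly M).
Proof.
apply/fitsP; split.
  apply/leq_sizeP => k lk; rewrite coef_mkpoly; case: insubP => // i.
  by rewrite ltnNge lk.
by move=> k; rewrite coef_mkpoly; case: insubP => [j _ _|_]; rewrite ?size_poly0 ?size_poly.
Qed.

Lemma coef_mkpoly_le l d (M : 'M[int]_(l, d)) (s : nat) :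
  (forall i j, `|M i j| <= s%:Z) -> forall j i, `|(mkpoly M)`_j`_i| <= s%:Z.
Proof.
move=> Ms j i; rewrite coef_mkpoly; case: insubP => [j' _ _|_]; last by rewrite coef0.
by rewrite coef_rVpoly; case: insubP => [i' _ _|_] //; rewrite !mxE.
Qed.

Lemma dvdz_sub_inord n (a b : int) :
  inord `|(a %% n.+1)%Z| = inord `|(b %% n.+1)%Z| :> 'I_n.+1 -> (n.+1 %| a - b)%Z.
Proof.
have lt (z : int) : (`|(z %% n.+1)%Z| < n.+1)%N.
  by rewrite -ltz_nat gez0_abs ?modz_ge0 // ltz_pmod.
move/(congr1 val); rewrite /= !inordK // => E; rewrite -eqz_mod_dvd; apply/eqP.
by rewrite -[LHS]gez0_abs ?modz_ge0 // E gez0_abs ?modz_ge0.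
Qed.

(** Thue's argument: the (s + 1)^(l d) arrays with entries from 0 to s outnumber the residues modulo
    n, and evaluation is additive, so a difference of two of them evaluates to 0. *)
Lemma eval2_pigeonhole l d (s n : nat) (x y : int) :
  (0 < n)%N -> (n < s.+1 ^ (l * d))%N ->
  exists M : 'M[int]_(l, d), [/\ M != 0, forall i j, `|M i j| <= s%:Z &
    (n %| eval2 (mkpoly M) x y)%Z].
Proof.
case: n => // n _ nT; pose T := {ffun 'I_l * 'I_d -> 'I_s.+1}.
pose mk (c : T) : 'M[int]_(l, d) := \matrix_(i, j) (c (i, j) : nat)%:Z.
pose f (c : T) : 'I_n.+1 := inord `|(eval2 (mkpoly (mk c)) x y %% n.+1)%Z|.
have /injectivePn[c [c' cc fc]] : ~~ injectiveb f.
  apply/negP => /injectiveP/leq_card; rewrite card_ord card_ffun card_prod !card_ord.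
  by rewrite leqNgt nT.
exists (mk c - mk c'); split.
- rewrite subr_eq0; apply: contra cc => /eqP/matrixP E; apply/eqP/ffunP => -[i j].
  by apply/val_inj; have := E i j; rewrite !mxE => -[].
- move=> i j; rewrite !mxE; have := ltn_ord (c (i, j)); have := ltn_ord (c' (i, j)).
  by move: (nat_of_ord (c (i, j))) (nat_of_ord (c' (i, j))) => a b; lia.
by rewrite mkpolyB eval2B; apply: dvdz_sub_inord fc.
Qed.

Lemma int_crt (ps : seq nat) (f : nat -> int) : all prime ps -> uniq ps ->
  exists x : int, forall r, r \in ps -> (r %| x - f r)%Z.
Proof.
elim: ps => [|p ps IH] /=; first by exists 0.
move=> /andP[pp aps] /andP[pps ups]; have [x Hx] := IH aps ups.
pose P := (\prod_(r <- ps) r)%N.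
have cop : coprimez p P.
  rewrite coprimezE /= /P; elim: (ps) aps pps => [|r s IHs] /=.
    by rewrite big_nil coprimen1.
  move=> /andP[pr as_]; rewrite inE negb_or => /andP[prs ps'].
  by rewrite big_cons coprimeMr IHs // andbT prime_coprime // dvdn_prime2.
exists (zchinese p P (f p) x) => r; rewrite inE => /orP[/eqP->|rps].
  by rewrite -eqz_mod_dvd; apply/eqP/zchinese_modl.
have rP : (r %| P%:Z)%Z.
  by rewrite -[(_ %| _)%Z]/(r %| P)%N /P (bigD1_seq r) //= dvdn_mulr.
rewrite -(subrK x (zchinese _ _ _ _)) -addrA rpredD ?Hx //.
apply: dvdz_trans rP _; rewrite -eqz_mod_dvd; apply/eqP/zchinese_modr.
exact: cop.
Qed.

(** * Sieving cyclotomic norms *)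

(** Telescoping: 1 / r^2 is at most 1 / (r - 1) - 1 / r. *)
Lemma sum_inv_sqr (y n : nat) : (0 < y)%N ->
  \sum_(y.+1 <= r < n) (r%:R ^+ 2)^-1 <= y%:R^-1 :> rat.
Proof.
move=> y0; have [ny|yn] := leqP n y.+1.
  by rewrite big_geq // invr_ge0 ler0n.
suff H k : \sum_(y.+1 <= r < y.+1 + k) (r%:R ^+ 2)^-1 <= y%:R^-1 - (y + k)%:R^-1 :> rat.
  rewrite -(subnKC (ltnW yn)); apply: le_trans (H _) _.
  by rewrite gerBl invr_ge0 ler0n.
elim: k => [|k IH]; first by rewrite addn0 big_geq // addn0 subrr.
rewrite addnS big_nat_recr /=; last by rewrite leq_addr.
apply: le_trans (lerD IH (lexx _)) _.
rewrite -addrA lerD2l addrC -lerBrDr opprK addrC addSn addnS.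
have n0 : 0 < (y + k)%:R :> rat by rewrite ltr0n addn_gt0 y0.
rewrite -natr1 -subr_ge0; set z := (y + k)%:R in n0 *.
have -> : z^-1 - (z + 1)^-1 - ((z + 1) ^+ 2)^-1 = (z * (z + 1) ^+ 2)^-1 :> rat.
  by field; rewrite ?gt_eqF //; lra.
by rewrite invr_ge0 mulr_ge0 ?sqr_ge0 // ltW.
Qed.

Section Sieve.

Variables (m W N : nat).
Hypotheses (m_gt0 : (0 < m)%N) (W_gt0 : (0 < W)%N) (N_gt0 : (0 < N)%N).

Local Notation d := (totient m).
Local Notation box := {ffun 'I_(totient m) -> 'I_N}.

(* The shift by (d + 1) W N keeps all conjugates of [avec b] of size W N, and
   [avec b] is 1 modulo W, so that its norm has no prime factor dividing W. *)
Definition avec (b : box) : {poly int} :=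
  ((d.+1 * (W * N))%:Z)%:P + (1 + W%:Z%:P * boxpoly b).

Definition normn (b : box) : nat := `|cnorm m (avec b)|%N.

Let d_gt0 : (0 < d)%N. Proof. by rewrite totient_gt0. Qed.

Lemma normn_bounds b :
  ((W * N) ^ d <= normn b <= (d.*2.+1 * (W * N)) ^ d)%N.
Proof.
apply: cnorm_shift => //.
  rewrite (leq_trans (size_polyD _ _)) // geq_max size_poly1 d_gt0 /=.
  by rewrite mul_polyC (leq_trans (size_scale_leq _ _)) ?size_boxpoly.
move=> k; rewrite coefD coefC coefCM.
have [c -> cN] := coef_boxpoly b k.
have c1 : (c.+1 <= N)%N by case: (c) cN => // c' /(_ isT).
by case: (k == 0%N); rewrite ?add0r -?natz; nia.
Qed.

Lemma normn_gt0 b : (0 < normn b)%N.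
Proof.
have /andP[h _] := normn_bounds b.
by apply: leq_trans h; rewrite expn_gt0 muln_gt0 W_gt0 N_gt0.
Qed.

Lemma prime_dvd_normn r b : prime r -> (r %| W)%N -> ~~ (r %| normn b)%N.
Proof.
move=> pr rW; rewrite -[(r %| _)%N]/(r %| cnorm m (avec b))%Z.
have rF := pchar_Fp pr; rewrite (dvdz_pcharf rF) /cnorm.
rewrite -[_%:~R]/((intr : {rmorphism int -> 'F_r}) _) map_pnorm.
have WF : W%:R = 0 :> 'F_r by apply/eqP; rewrite -(dvdn_pcharf rF).
have -> : avec b = 1 + W%:Z%:P * ((d.+1 * N)%:Z%:P + boxpoly b).
  by rewrite /avec mulnCA PoszM polyCM; ring.
rewrite rmorphD rmorph1 rmorphM /= map_polyC /= -pmulrn WF mul0r addr0.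
rewrite -polyC1 pnormC expr1n.
exact: oner_neq0.
Qed.

Lemma avec_packing M (Y : pred box) : (0 < M)%N -> coprime M W ->
  (forall b b', Y b -> Y b' -> (M %| cnorm m (avec b - avec b'))%Z) ->
  (M * #|Y| <= (2 * d) ^ d * N ^ d + M)%N.
Proof.
move=> M0 cop HY; apply: cnorm_packing => // b b' Yb Yb'.
have := HY b b' Yb Yb'.
have -> : avec b - avec b' = W%:Z%:P * (boxpoly b - boxpoly b').
  by rewrite /avec; ring.
rewrite /cnorm pnormM pnormC mulrC Gauss_dvdzl //.
by rewrite coprimezXr // coprimezE.
Qed.

(** The d^2 conditions of [cnorm_sqr_cover] each define a set to which packing with M = r^2 applies,
    however large r is compared with N. *)
Lemma card_sqr_dvd_normn r : prime r -> coprime r m -> coprime r W ->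
  (r ^ 2 * #|[pred b : box | r ^ 2 %| normn b]| <=
    d * d * ((2 * d) ^ d * N ^ d + r ^ 2))%N.
Proof.
move=> pr cm cW; have [E [E1 E2]] := cnorm_sqr_cover m_gt0 pr cm.
have r2E : (r ^ 2)%N%:Z = r%:Z ^+ 2 by rewrite -!natz natrX.
pose F p := [pred b : box | E p (avec b)].
have H : (#|[pred b : box | r ^ 2 %| normn b]| <= \sum_p #|F p|)%N.
  apply: leq_card_cover_pred => b /= rb; apply: E1; rewrite -r2E.
  exact: rb.
apply: leq_trans (leq_mul (leqnn _) H) _; rewrite big_distrr /=.
have -> : (d * d * ((2 * d) ^ d * N ^ d + r ^ 2) =
  \sum_(p : 'I_(d.-1.+1) * 'I_(d.-1.+1)) ((2 * d) ^ d * N ^ d + r ^ 2))%N.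
  by rewrite sum_nat_const card_prod !card_ord prednK.
apply: leq_sum => p _; apply: avec_packing; rewrite ?expn_gt0 ?prime_gt0 //.
  by rewrite coprimeXl.
by move=> b b' Eb Eb'; rewrite r2E; apply: E2 Eb Eb'.
Qed.

Lemma card_dvd_normn r : prime r -> (m %| r.-1)%N -> coprime r W ->
  (r * #|[pred b : box | r %| normn b]| <= d * ((2 * d) ^ d * N ^ d + r))%N.
Proof.
move=> pr cm cW; have [E [E1 E2]] := cnorm_prime_cover m_gt0 pr cm.
pose F p := [pred b : box | E p (avec b)].
have H : (#|[pred b : box | r %| normn b]| <= \sum_p #|F p|)%N.
  by apply: leq_card_cover_pred => b /= rb; apply: E1.
apply: leq_trans (leq_mul (leqnn _) H) _; rewrite big_distrr /=.
have -> : (d * ((2 * d) ^ d * N ^ d + r) =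
  \sum_(p : 'I_(d.-1.+1)) ((2 * d) ^ d * N ^ d + r))%N.
  by rewrite sum_nat_const card_ord prednK.
apply: leq_sum => p _; apply: avec_packing; rewrite ?prime_gt0 //.
by move=> b b' Eb Eb'; apply: E2 Eb Eb'.
Qed.

End Sieve.

(** [S] will consist of the primes 1 modulo m at which y^l = g lacks two roots. Small primes and
    primes outside the class 1 modulo m are absent by the shape of [avec] and by squarefreeness. *)
Definition good m W N (S : pred nat) : pred {ffun 'I_(totient m) -> 'I_N} :=
  fun b => `[< forall r, prime r ->
    ~~ (r ^ 2 %| normn W b)%N && (S r ==> ~~ (r %| normn W b)%N) >].

Lemma sieve_proportion (t u v : nat) :
  t = (u + v)%N -> (16 * v <= 5 * t)%N -> (11 * t <= 16 * u)%N.
Proof. lia. Qed.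

Section GoodCount.

Variables (m y N : nat) (S : pred nat).
Hypothesis m_gt0 : (0 < m)%N.

Local Notation d := (totient m).
Local Notation W := (y`!).
Local Notation box := {ffun 'I_(totient m) -> 'I_N}.

Let c2 := ((2 * d) ^ d)%N.
Let C0 := (d.*2.+1 ^ d)%N.
Let X := ((d.*2.+1 * (W * N)) ^ d)%N.
Let T := (N ^ d)%N.

Hypotheses (my : (m <= y)%N) (y_big : (16 * d ^ 2 * c2 <= y)%N).
Hypothesis Sm : forall r, prime r -> S r -> (m %| r.-1)%N.
Hypothesis Stail : forall n, (16 * d * c2)%:R * psum S y.+1 n <= 1.
Hypothesis Scount :
  (16 * d * (C0 * W ^ d) * \sum_(0 <= r < X.+1) (prime r && S r) <= X)%N.
Hypothesis T_big : (256 * d ^ 4 * (C0 * W ^ d) <= T)%N.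

Let d_gt0 : (0 < d)%N. Proof. by rewrite totient_gt0. Qed.
Let y_gt0 : (0 < y)%N. Proof. exact: leq_trans m_gt0 my. Qed.
Let W_gt0 : (0 < W)%N. Proof. exact: fact_gt0. Qed.
Let CW_gt0 : (0 < C0 * W ^ d)%N. Proof. by rewrite muln_gt0 !expn_gt0 W_gt0. Qed.
Let XE : X = (C0 * W ^ d * T)%N. Proof. by rewrite /X !expnMn mulnA. Qed.
Let N_gt0 : (0 < N)%N.
Proof.
have : (0 < T)%N by apply: leq_trans T_big; rewrite muln_gt0 CW_gt0 andbT muln_gt0 expn_gt0 d_gt0.
by rewrite /T expn_gt0 (eqn0Ngt d) d_gt0 orbF.
Qed.

Lemma prime_dvd_normn_gt r (b : box) : prime r -> (r %| normn W b)%N -> (y < r)%N.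
Proof.
move=> pr; apply: contraLR; rewrite -leqNgt => ry.
by apply: prime_dvd_normn => //; apply: dvdn_fact; rewrite prime_gt0.
Qed.

Let coprime_big r k : prime r -> (0 < k)%N -> (k <= y)%N -> (y < r)%N -> coprime r k.
Proof.
move=> pr k0 ky yr; rewrite prime_coprime //; apply/negP => /(dvdn_leq k0).
by rewrite leqNgt (leq_ltn_trans ky).
Qed.

(** Bounds the primes whose square divides a norm: r^2 <= X = C0 W^d T, and [T_big] gives (16 d^2
    r)^2 <= T^2. With so few r, the error d^2 for each of them adds up to at most 2T / 16. *)
Let Rm := (T %/ (16 * d ^ 2))%N.

Let E1 (r : nat) : pred box := fun b => [&& prime r, (y < r)%N & (r ^ 2 %| normn W b)%N].
Let E2 (r : nat) : pred box := fun b => [&& prime r && S r, (y < r)%N & (r %| normn W b)%N].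

Let card_E1 r : #|E1 r|%:R <= (y < r)%N%:R * ((d ^ 2 * c2 * T)%:R * (r%:R ^+ 2)^-1)
  + (d ^ 2)%:R :> rat.
Proof.
have [H|H] := boolP (prime r && (y < r)%N); last first.
  rewrite eq_card0; first by rewrite addr_ge0 // !mulr_ge0 // invr_ge0 sqr_ge0.
  by move=> b; rewrite unfold_in /E1 andbA (negPf H).
case/andP: H => pr yr.
have r0 : (0 < r)%N by rewrite prime_gt0.
have sub : (#|E1 r| <= #|[pred b : box | r ^ 2 %| normn W b]|)%N.
  by apply: subset_leq_card; apply/fintype.subsetP => b; rewrite !unfold_in /= => /and3P[].
have := card_sqr_dvd_normn N m_gt0 pr (coprime_big pr m_gt0 my yr)
  (prime_coprime_fact pr yr).
move/(leq_trans (leq_mul (leqnn _) sub)).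
rewrite yr mul1r -(ler_nat rat) -natrX => H.
rewrite -(ler_pM2l (_ : 0 < (r ^ 2)%:R)) ?ltr0n ?expn_gt0 ?r0 //.
rewrite -natrM (le_trans H) // mulrDr mulrCA divff ?mulr1 -?natrM -?natrD.
  by rewrite ler_nat /c2 /T; nia.
by rewrite pnatr_eq0 -lt0n expn_gt0 r0.
Qed.

Let card_E2 r : #|E2 r|%:R <= (prime r && S r && (y < r))%N%:R * ((d * c2 * T)%:R / r%:R)
  + d%:R * (prime r && S r)%N%:R :> rat.
Proof.
have [H|H] := boolP (prime r && S r && (y < r)%N); last first.
  rewrite eq_card0; first by rewrite mul0r add0r mulr_ge0 // ler0n.
  by move=> b; rewrite unfold_in /E2 andbA (negPf H).
case/andP: H => /andP[pr Sr] yr.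
have r0 : (0 < r)%N by rewrite prime_gt0.
have sub : (#|E2 r| <= #|[pred b : box | r %| normn W b]|)%N.
  by apply: subset_leq_card; apply/fintype.subsetP => b; rewrite !unfold_in /= => /and3P[].
have := card_dvd_normn N m_gt0 pr (Sm pr Sr) (prime_coprime_fact pr yr).
move/(leq_trans (leq_mul (leqnn _) sub)).
rewrite pr Sr mul1r mulr1 -(ler_nat rat) => H.
rewrite -(ler_pM2l (_ : 0 < r%:R)) ?ltr0n //.
rewrite -natrM (le_trans H) // mulrDr mulrCA divff ?mulr1 -?natrM -?natrD.
  by rewrite ler_nat /c2 /T; nia.
by rewrite pnatr_eq0 -lt0n.
Qed.

(** At most 5/16 of the box is bad. Squares cost 3/16: one from the tail of the sum of 1 / r^2
    beyond y, two from the errors up to [Rm]. Primes in [S] cost 2/16: one from [Stail], one from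
    the errors counted by [Scount]. *)
Lemma card_good : (11 * T <= 16 * #|(good W S : pred box)|)%N.
Proof.
have T0 : (0 < T)%N by rewrite expn_gt0 N_gt0.
pose bad : pred box := [predC good W S].
have cT : T = (#|(good W S : pred box)| + #|bad|)%N.
  by rewrite (cardC (good W S : pred box)) card_ffun !card_ord.
have B : (#|bad| <= \sum_(r < Rm.+1) #|E1 r| + \sum_(r < X.+1) #|E2 r|)%N.
  apply: (@leq_trans (#|[pred b | [exists r : 'I_Rm.+1, E1 r b]]| +
                      #|[pred b | [exists r : 'I_X.+1, E2 r b]]|)).
    rewrite -cardUI (leq_trans _ (leq_addr _ _)) //.
    apply: subset_leq_card; apply/fintype.subsetP => b; rewrite !inE /bad /= => nb.
    move/asboolPn: nb => /existsNP[r /not_implyP[pr]].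
    move=> /negP; rewrite negb_and !negbK negb_imply negbK => H.
    apply/orP; case/orP: H => [r2|/andP[Sr rb]].
      have yr : (y < r)%N.
        by apply: (prime_dvd_normn_gt pr (b := b)); apply: dvdn_trans r2; rewrite expnS dvdn_mulr.
      left; apply/existsP.
      have rR : (r < Rm.+1)%N.
        rewrite ltnS /Rm leq_divRL ?muln_gt0 ?expn_gt0 ?d_gt0 //.
        have := dvdn_leq (normn_gt0 m_gt0 W_gt0 N_gt0 b) r2.
        have /andP[_] := normn_bounds m_gt0 W_gt0 N_gt0 b.
        rewrite -/X XE => h1 h2; have {h1 h2}h3 := leq_trans h2 h1.
        rewrite -(@leq_exp2r _ _ 2) // expnMn.
        apply: leq_trans (leq_mul h3 (leqnn _)) _.
        rewrite mulnAC -[(T ^ 2)%N]/(T * T)%N leq_mul2r gtn_eqF //=.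
        apply: leq_trans T_big; rewrite mulnC expnMn -expnM.
        by rewrite [leqLHS]mulnC [leqRHS]mulnC.
      by exists (Ordinal rR); rewrite /E1 /= pr yr r2.
    right; apply/existsP.
    have yr := prime_dvd_normn_gt pr rb.
    have rX : (r < X.+1)%N.
      have := dvdn_leq (normn_gt0 m_gt0 W_gt0 N_gt0 b) rb.
      have /andP[_] := normn_bounds m_gt0 W_gt0 N_gt0 b.
      by move=> h1 h2; rewrite ltnS (leq_trans h2 h1).
    by exists (Ordinal rX); rewrite /E2 /= pr Sr yr rb.
  apply: leq_add; apply: leq_card_cover_pred => b /existsP[r Er]; by exists r.
have tailE n (P : pred nat) (F : nat -> rat) :
    \sum_(0 <= r < n) (P r && (y < r))%N%:R * F r <= \sum_(y.+1 <= r < n | P r) `|F r|.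
  rewrite (@big_nat_widenl _ _ _ y.+1 0) // big_mkcond.
  apply: ler_sum => r _; case: (P r) => /=; last by rewrite mul0r.
  by case: ltnP => _; rewrite ?mul1r ?mul0r // ler_norm.
have S1 : \sum_(r < Rm.+1) #|E1 r|%:R <= (3 * T)%:R / 16%:R :> rat.
  apply: (@le_trans _ _ (\sum_(r < Rm.+1) ((y < r)%N%:R * ((d ^ 2 * c2 * T)%:R *
      (r%:R ^+ 2)^-1) + (d ^ 2)%:R))); first by apply: ler_sum => r _; apply: card_E1.
  rewrite big_split /= sumr_const card_ord.
  have H1 := tailE Rm.+1 predT (fun r => (d ^ 2 * c2 * T)%:R * (r%:R ^+ 2)^-1).
  rewrite big_mkord /= in H1. apply: le_trans (lerD H1 (lexx _)) _.
  under eq_bigr => r _ do rewrite ger0_norm ?mulr_ge0 ?invr_ge0 ?sqr_ge0 //.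
  rewrite -mulr_sumr.
  have H2 := @sum_inv_sqr y Rm.+1 y_gt0.
  have yp : 0 < y%:R :> rat by rewrite ltr0n.
  have H3 : (d ^ 2 * c2 * T)%:R * (\sum_(y.+1 <= r < Rm.+1) (r%:R ^+ 2)^-1) <= T%:R / 16%:R :> rat.
    apply: le_trans (ler_wpM2l _ H2) _; first by rewrite ler0n.
    rewrite ler_pdivrMr // mulrAC ler_pdivlMr // -!natrM ler_nat.
    apply: (@leq_trans (T * (16 * d ^ 2 * c2))); last by rewrite leq_mul2l y_big orbT.
    by rewrite leq_eqVlt; apply/orP; left; apply/eqP; ring.
  have H4 : (d ^ 2)%:R *+ Rm.+1 <= T%:R / 16%:R + T%:R / 16%:R :> rat.
    rewrite -mulrnA mulnS natrD lerD // ler_pdivlMr // -natrM ler_nat.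
      apply: leq_trans T_big; rewrite -[(d ^ 2 * 16)%N]muln1; apply: leq_mul => //.
      by rewrite mulnC; apply: leq_mul => //; rewrite leq_pexp2l.
    rewrite mulnC mulnA mulnC; exact: leq_divM.
  apply: le_trans (lerD H3 H4) _; rewrite natrM; lra.
have S2 : \sum_(r < X.+1) #|E2 r|%:R <= (2 * T)%:R / 16%:R :> rat.
  apply: (@le_trans _ _ (\sum_(r < X.+1) ((prime r && S r && (y < r))%N%:R *
      ((d * c2 * T)%:R / r%:R) + d%:R * (prime r && S r)%N%:R))).
    by apply: ler_sum => r _; apply: card_E2.
  rewrite big_split /= -mulr_sumr.
  have H1 := tailE X.+1 (fun r => prime r && S r) (fun r => (d * c2 * T)%:R / r%:R).
  rewrite big_mkord /= in H1; apply: le_trans (lerD H1 (lexx _)) _.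
  under eq_bigr => r _ do rewrite ger0_norm ?mulr_ge0 ?invr_ge0 ?ler0n //.
  rewrite -mulr_sumr -/(psum S y.+1 X.+1).
  have H3 : (d * c2 * T)%:R * psum S y.+1 X.+1 <= T%:R / 16%:R :> rat.
    rewrite ler_pdivlMr // natrM mulrAC -[leRHS]mul1r.
    rewrite [leLHS](_ : _ = (16 * d * c2)%:R * psum S y.+1 X.+1 * T%:R).
      by rewrite ler_wpM2r ?ler0n.
    by rewrite !natrM; ring.
  have H4 : d%:R * (\sum_(r < X.+1) (prime r && S r)%N%:R) <= T%:R / 16%:R :> rat.
    rewrite ler_pdivlMr // -natr_sum -!natrM ler_nat.
    move: Scount; rewrite XE big_mkord; set sm := (\sum_(i < _) _)%N => H.
    rewrite -(leq_pmul2l CW_gt0); apply: leq_trans H.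
    by rewrite leq_eqVlt; apply/orP; left; apply/eqP; ring.
  apply: le_trans (lerD H3 H4) _; rewrite natrM; lra.
have {}B : (16 * #|bad| <= 5 * T)%N.
  rewrite -(ler_nat rat); move: B; rewrite -(ler_nat rat) natrD !natr_sum => B.
  have {}B := le_trans B (lerD S1 S2).
  rewrite (natrM _ 16); apply: le_trans (ler_wpM2l (ler0n _ 16) B) _.
  by rewrite -mulrDl mulrCA divff // mulr1 -natrD -mulnDl.
exact: sieve_proportion cT B.
Qed.

End GoodCount.

Lemma dvdz_horner_congr r (a : {poly int}) (x x' : int) : prime r ->
  (r %| x - x')%Z -> (r %| a.[x'])%Z -> (r %| a.[x])%Z.
Proof.
move=> pr; have rF := pchar_Fp pr; rewrite !(dvdz_pcharf rF) rmorphB subr_eq0.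
by rewrite -!horner_map_intr => /eqP ->.
Qed.

(** * Good elements whose norm has few prime factors *)

Section Fibres.

Variables (m y N : nat) (S : pred nat).
Hypotheses (m_gt0 : (0 < m)%N) (my : (m <= y)%N) (N_gt0 : (0 < N)%N).

Local Notation d := (totient m).
Local Notation W := (y`!).
Local Notation box := {ffun 'I_(totient m) -> 'I_N}.
Local Notation c2 := ((2 * totient m) ^ totient m)%N.
Local Notation X := (((totient m).*2.+1 * (y`! * N)) ^ totient m)%N.
Local Notation T := (N ^ totient m)%N.

Let W_gt0 : (0 < W)%N. Proof. exact: fact_gt0. Qed.

(** A prime factor exceeds y >= m, so it is prime to m; were it not 1 modulo m, it would divide the
    norm twice. *)
Lemma goodP r (b : box) : good W S b -> prime r -> (r %| normn W b)%N ->
  [/\ (y < r)%N, (m %| r.-1)%N, ~~ S r & ~~ (r ^ 2 %| normn W b)%N].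
Proof.
move=> /asboolP gb pr rb; have yr := prime_dvd_normn_gt pr rb.
have /andP[r2 Sr] := gb r pr; split=> //; last by apply: contraL Sr => ->; rewrite rb.
apply: contraNT r2 => mr.
have := dvdz_cnorm_sqr pr m_gt0 _ mr; rewrite prime_coprime //.
move/(_ (avec W b)); apply => //; apply/negP => /(dvdn_leq m_gt0).
by rewrite leqNgt (leq_ltn_trans my).
Qed.

Lemma normn_ge (b : box) : (T <= normn W b)%N.
Proof.
have /andP[h _] := normn_bounds m_gt0 W_gt0 N_gt0 b; apply: leq_trans h.
by rewrite leq_exp2r ?totient_gt0 // leq_pmull.
Qed.

(** As n is squarefree, it divides the norms of all differences. Packing with M = n gives n |Y| <=
    c2 T + n, and n >= T. *)
Lemma same_roots_card n (Y : pred box) :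
  (forall b, Y b -> good W S b /\ normn W b = n) ->
  (forall b b' r, Y b -> Y b' -> prime r -> (r %| n)%N ->
     (r %| cnorm m (avec W b - avec W b'))%Z) ->
  (#|Y| <= c2.+1)%N.
Proof.
move=> Yg Yr; have [->//|/card_gt0P[b0 Yb0]] := posnP #|Y|.
have [gb0 nb0] := Yg b0 Yb0.
have n0 : (0 < n)%N by rewrite -nb0 normn_gt0.
have nW : coprime n W.
  rewrite coprime_has_primes //; apply/hasPn => r; rewrite !mem_primes n0 W_gt0 /=.
  case/andP => pr rW; rewrite pr /= -nb0; exact: prime_dvd_normn.
have := avec_packing m_gt0 n0 nW (Y := Y).
have H b b' : Y b -> Y b' -> (n %| cnorm m (avec W b - avec W b'))%Z.
  move=> Yb Yb'; apply: dvdn_sqfree => // r pr; last exact: Yr.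
  apply/negP => r2; have rn : (r %| n)%N by apply: dvdn_trans r2; rewrite dvdn_exp.
  by have [] := goodP gb0 pr; rewrite nb0 // r2.
move/(_ H) => Hn; rewrite -(leq_pmul2l n0); apply: leq_trans Hn _.
rewrite mulnS addnC leq_add2l mulnC leq_mul2r; apply/orP; right.
by rewrite -nb0 normn_ge.
Qed.

(** For a fixed norm n, record which of the d conditions an element satisfies at each of the fewer
    than V primes of n. Equal records fall under [same_roots_card], so each n comes from at most d^V
    (c2 + 1) elements. *)
Lemma card_few V :
  (#|[pred b : box | good W S b && (size (primes (normn W b)) < V)%N]| <=
   d ^ V * c2.+1 * cnt (fun n => size (primes n) < V)%N X)%N.
Proof.
have /choice[E HE] r : exists E : 'I_(d.-1.+1) -> pred {poly int},
    prime r -> (m %| r.-1)%N ->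
    (forall a, (r %| cnorm m a)%Z -> exists i, E i a) /\
    (forall i a b, E i a -> E i b -> (r %| cnorm m (a - b))%Z).
  have [/andP[pr mr]|H] := boolP (prime r && (m %| r.-1)%N).
    by have [E HE] := cnorm_prime_cover m_gt0 pr mr; exists E.
  by exists (fun _ _ => false) => pr mr; rewrite pr mr in H.
(* The default [ord0] fills the positions beyond the last prime factor. *)
pose idx (b : box) : {ffun 'I_V -> 'I_(d.-1.+1)} :=
  [ffun j : 'I_V => odflt ord0 [pick i | E (nth 0%N (primes (normn W b)) j) i (avec W b)]].
have idxP (b : box) r : good W S b -> prime r -> (r %| normn W b)%N ->
    forall j : 'I_V, nth 0%N (primes (normn W b)) j = r -> E r (idx b j) (avec W b).
  move=> gb pr rb j jr; have [_ mr _ _] := goodP gb pr rb.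
  rewrite ffunE jr; case: pickP => [i //|] /= Ei.
  by have [/(_ _ rb)[i]] := HE r pr mr; rewrite Ei.
set A := [pred b | _].
have nX (b : box) : (normn W b < X.+1)%N.
  by rewrite ltnS; have /andP[_] := normn_bounds m_gt0 W_gt0 N_gt0 b.
rewrite -sum1_card (partition_big (fun b : box => inord (normn W b) : 'I_X.+1) predT) //=.
rewrite /cnt big_add1 big_distrr /=.
rewrite (eq_bigr (fun n : 'I_X.+1 =>
    \sum_(b | A b && (inord (normn W b) == inord n :> 'I_X.+1)) 1)%N); last first.
  by move=> n _; rewrite inord_val.
rewrite -(big_mkord predT (fun n => \sum_(b | A b && (inord (normn W b) == inord n :> 'I_X.+1)) 1)%N).
(* [cnt] starts at 1; the value 0 can be split off because norms are positive. *)
rewrite big_nat_recl //= big_pred0 ?add0n; last first.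
  move=> b; apply/negP => /andP[_ /eqP/(congr1 val)] /=.
  by rewrite !inordK // => b0; have := normn_gt0 m_gt0 W_gt0 N_gt0 b; rewrite b0.
rewrite !big_nat; apply: leq_sum => n /andP[_ nX'].
pose F := [pred b | A b && (inord (normn W b) == inord n.+1 :> 'I_X.+1)].
have FP b : F b -> A b /\ normn W b = n.+1.
  by case/andP => Ab /eqP/(congr1 val) /=; rewrite !inordK.
rewrite (_ : (\sum_(b | _) 1)%N = #|F|); last by rewrite -sum1_card.
case: (ltnP _ V) => [few|many]; last first.
  rewrite eq_card0 // => b; apply/negP => /FP[/andP[_ lt] nb].
  by move: lt; rewrite nb ltnNge many.
rewrite muln1 mulnC.
have -> : (c2.+1 * d ^ V = c2.+1 * #|{ffun 'I_V -> 'I_(d.-1.+1)}|)%N.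
  by rewrite card_ffun !card_ord prednK ?totient_gt0.
apply: (leq_card_fibre (f := idx)) => z; apply: (same_roots_card (n := n.+1)) => [b /andP[/FP[/andP[gb _] ->]] //|].
move=> b b' r /andP[/FP[/andP[gb _] nb] /eqP zb] /andP[/FP[/andP[gb' _] nb'] /eqP zb'] pr rn.
have [_ mr _ _] : [/\ (y < r)%N, (m %| r.-1)%N, ~~ S r & ~~ (r ^ 2 %| normn W b)%N].
  by apply: goodP => //; rewrite nb.
have [_ H2] := HE r pr mr.
have jr : (index r (primes n.+1) < V)%N.
  by apply: leq_ltn_trans few; rewrite ltnW // index_mem mem_primes pr rn.
have jE : nth 0%N (primes n.+1) (Ordinal jr) = r.
  by rewrite /= nth_index // mem_primes pr rn.
apply: (H2 (z (Ordinal jr))).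
  by rewrite -zb; apply: idxP; rewrite ?nb.
by rewrite -zb'; apply: idxP; rewrite ?nb'.
Qed.

End Fibres.

(** * Good elements whose norm has many prime factors *)

Definition two_roots (l g r : nat) : Prop := exists u v : int,
  [/\ (r %| u ^+ l - g%:Z)%Z, (r %| v ^+ l - g%:Z)%Z & ~~ (r %| u - v)%Z].

Lemma dvdn_sqfree_mul r n k : (r ^ 2 %| n * k)%N -> prime r -> (0 < n)%N ->
  ~~ (r ^ 2 %| n)%N -> (r %| k)%N.
Proof.
move=> r2 pr n0 sf; have [rn|nrn] := boolP (r %| n)%N; last first.
  have : (r %| n * k)%N by apply: dvdn_trans r2; rewrite dvdn_exp.
  by rewrite Euclid_dvdM // (negPf nrn).
have r0 := prime_gt0 pr; move: sf r2; case/dvdnP: rn => n' ->.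
rewrite -mulnn dvdn_pmul2r // => sf.
by rewrite mulnAC dvdn_pmul2r // Euclid_dvdM // (negPf sf).
Qed.

Lemma inord_absz_inj (s : nat) (a b : int) : `|a| <= s%:Z -> `|b| <= s%:Z ->
  inord (absz (a + s%:Z)) = inord (absz (b + s%:Z)) :> 'I_(2 * s).+1 -> a = b.
Proof. by move=> Ha Hb /(congr1 val); rewrite /= !inordK; lia. Qed.

Lemma inord_inj_le K a b : (a <= K)%N -> (b <= K)%N ->
  inord a = inord b :> 'I_K.+1 -> a = b.
Proof. by move=> aK bK /(congr1 val); rewrite /= !inordK. Qed.

Lemma dvdz_root_congr r l g (z w : int) :
  (r %| z - w)%Z -> (r %| w ^+ l - g)%Z -> (r %| z ^+ l - g)%Z.
Proof.
move=> zw wg; rewrite -(subrK (w ^+ l) (z ^+ l)) -addrA rpredD //.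
by rewrite subrXX dvdz_mulr.
Qed.

Lemma mem_primes_dvd r n : r \in primes n -> prime r /\ (r %| n)%N.
Proof. by rewrite mem_primes => /and3P[]. Qed.

Lemma dvdz_sub_congr r (z z' w w' : int) :
  (r %| z - z')%Z -> (r %| z - w)%Z -> (r %| z' - w')%Z -> (r %| w - w')%Z.
Proof.
have -> : w - w' = (z - z') + (z' - w') - (z - w) by ring.
by move=> h1 h2 h3; rewrite rpredB // rpredD.
Qed.

Lemma dvdz_hornerB r (a b : {poly int}) x :
  (r %| a.[x])%Z -> (r %| b.[x])%Z -> (r %| (a - b).[x])%Z.
Proof. by move=> ra rb; rewrite hornerD hornerN rpredB. Qed.

Lemma bool_root_inj (r : int) (Y : bool -> int) e e' :
  ~~ (r %| Y true - Y false)%Z -> (r %| Y e - Y e')%Z -> e = e'.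
Proof.
by case: e e' => [] [] // nr rY; move: nr; rewrite ?rY // -opprB rpredN rY.
Qed.

Section Many.

Variables (m y N : nat) (S : pred nat) (l g V s K : nat).
Hypotheses (m_gt0 : (0 < m)%N) (my : (m <= y)%N) (N_gt0 : (0 < N)%N).
Hypotheses (l_gt1 : (1 < l)%N) (pg : prime g) (cop : coprime g m).
Hypothesis tr : forall r, prime r -> (m %| r.-1)%N -> ~~ S r -> two_roots l g r.

Local Notation d := (totient m).
Local Notation W := (y`!).
Local Notation box := {ffun 'I_(totient m) -> 'I_N}.
Local Notation c2 := ((2 * totient m) ^ totient m)%N.
Local Notation X := (((totient m).*2.+1 * (y`! * N)) ^ totient m)%N.
Local Notation D := (l * totient m)%N.

(** [s] is the integer part of the D-th root of X, so the (s + 1)^D coefficient arrays outnumber n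
    <= X. [K] bounds the cofactor: the norm of a point is at most (l d g)^D s^D, and s^D <= X <= (2d
    + 1)^d n. As K <= y, no prime of n divides the cofactor. *)
Hypotheses (sX : (s ^ D <= X)%N) (Xs : (X < s.+1 ^ D)%N) (Ky : (K <= y)%N).
Hypothesis KE : K = ((l * d * g) ^ D * d.*2.+1 ^ d)%N.

Let W_gt0 : (0 < W)%N. Proof. exact: fact_gt0. Qed.

(* Each [b] and each choice of one of two l-th roots of g modulo the first V
   primes of its norm n yield a point of Z[zeta_m, g^(1/l)] whose norm is a
   bounded multiple of n; n being free of small primes, this point determines
   the choices and, up to bounded multiplicity, [b]. *)
Lemma card_many :
  (#|[pred b : box | good W S b && (V <= size (primes (normn W b)))%N]| * 2 ^ V
   <= c2.+1 * ((2 * s).+1 ^ D * K.+1))%N.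
Proof.
have /choice[Y HY] r : exists Y : bool -> int, prime r -> (m %| r.-1)%N -> ~~ S r ->
    (forall e, (r %| Y e ^+ l - g%:Z)%Z) /\ ~~ (r %| Y true - Y false)%Z.
  have [/and3P[pr mr Sr]|H] := boolP [&& prime r, (m %| r.-1)%N & ~~ S r].
    have [u [v [ru rv uv]]] := tr pr mr Sr.
    by exists (fun e : bool => if e then u else v); split => // -[].
  by exists (fun=> 0) => pr mr Sr; rewrite pr mr Sr in H.
pose B := [pred b : box | good W S b && (V <= size (primes (normn W b)))%N].
pose Q := (box * {ffun 'I_V -> bool})%type.
pose A : pred Q := fun p => B p.1.
have cA : (#|A| = #|B| * 2 ^ V)%N.
  have -> : (2 ^ V = #|[set: {ffun 'I_V -> bool}]%SET|)%N.
    by rewrite cardsT card_ffun card_bool card_ord.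
  rewrite -cardX; apply: eq_card => -[b e].
  by rewrite [RHS]inE /= finset.in_setT andbT.
(* Choices are made at the first V primes of n; every later prime gets the root [true]. *)
pose ne (e : {ffun 'I_V -> bool}) (j : nat) := if insub j is Some i then e i else true.
pose R (p : Q) (M : 'M[int]_(l, d)) (xy : int * int) :=
  [/\ forall r, prime r -> (r %| normn W p.1)%N ->
        [/\ (r %| ('Phi_m).[xy.1])%Z, (r %| (avec W p.1).[xy.1])%Z &
            (r %| xy.2 - Y r (ne p.2 (index r (primes (normn W p.1)))))%Z],
     M != 0, forall i j, `|M i j| <= s%:Z &
     (normn W p.1 %| eval2 (mkpoly M) xy.1 xy.2)%Z].
have /choice[f Hf] (p : Q) : exists Mxy : 'M[int]_(l, d) * (int * int),
    A p -> R p Mxy.1 Mxy.2.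
  have [Ap|nA] := boolP (A p); last by exists (0, (0, 0)).
  have gp : good W S p.1 by case/andP: Ap.
  have n0 := normn_gt0 m_gt0 W_gt0 N_gt0 p.1.
  have /choice[t Ht] r : exists t : int, prime r -> (r %| normn W p.1)%N ->
      (r %| ('Phi_m).[t])%Z /\ (r %| (avec W p.1).[t])%Z.
    have [/andP[pr rn]|H] := boolP (prime r && (r %| normn W p.1)%N); last first.
      by exists 0 => pr rn; rewrite pr rn in H.
    have [_ mr _ _] := goodP m_gt0 my gp pr rn.
    have [u [u1 _ u3]] := Cyclotomic_prime_roots m_gt0 pr mr.
    have [i ri] := u3 _ rn; exists (u i) => _ _; split => //.
    by apply: dvdz_trans (u1 i); rewrite expr2 dvdz_mulr.
  have apr : all prime (primes (normn W p.1)).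
    by apply/allP => r; rewrite mem_primes => /andP[].
  have [x Hx] := int_crt t apr (primes_uniq _).
  have [z Hz] := int_crt (fun r => Y r (ne p.2 (index r (primes (normn W p.1)))))
    apr (primes_uniq _).
  have nX : (normn W p.1 < s.+1 ^ D)%N.
    apply: leq_ltn_trans Xs.
    by have /andP[] := normn_bounds m_gt0 W_gt0 N_gt0 p.1.
  have [M [M0 Ms ME]] := eval2_pigeonhole x z n0 nX.
  exists (M, (x, z)) => _; split => //= r pr rn.
  have rp : r \in primes (normn W p.1) by rewrite mem_primes pr n0.
  have [t1 t2] := Ht r pr rn.
  by split; [apply: dvdz_horner_congr (Hx r rp) t1|apply: dvdz_horner_congr (Hx r rp) t2|exact: Hz].
pose tau (p : Q) := `|topnorm m l g (mkpoly (f p).1)|%N.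
have tauP p : A p -> (0 < tau p)%N /\ exists2 k, tau p = (normn W p.1 * k)%N & (k <= K)%N.
  move=> Ap; have [H1 M0 Ms ME] := Hf p Ap.
  have gp : good W S p.1 by case/andP: Ap.
  have n0 := normn_gt0 m_gt0 W_gt0 N_gt0 p.1.
  have t0 : (0 < tau p)%N.
    rewrite absz_gt0; apply: topnorm_neq0 => //; first exact: fits_mkpoly.
    by apply: contra M0 => /eqP/mkpoly_eq0 ->.
  split=> //.
  have nt : (normn W p.1 %| tau p)%N.
    have dv a : (forall r, prime r -> (r %| normn W p.1)%N -> (r %| a)%Z) ->
        (normn W p.1 %| a)%Z.
      move=> H; apply: (@dvdn_sqfree (normn W p.1) `|a|%N n0) => r pr; last exact: H r pr.
      apply/negP => r2; have rn : (r %| normn W p.1)%N by apply: dvdn_trans r2; rewrite dvdn_exp.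
      by have [_ _ _] := goodP m_gt0 my gp pr rn; rewrite r2.
    apply: (dvdz_topnorm m_gt0 l_gt1 n0 (x := (f p).2.1) (y := (f p).2.2)) ME => //.
      by apply: dv => r pr rn; have [] := H1 r pr rn.
    apply: dv => r pr rn; have [_ _ ry] := H1 r pr rn.
    have [_ mr Sr _] := goodP m_gt0 my gp pr rn.
    have [HYr _] := HY r pr mr Sr; exact: dvdz_root_congr ry (HYr _).
  exists (tau p %/ normn W p.1)%N; first by rewrite mulnC divnK.
  rewrite -(leq_pmul2r n0) divnK //.
  have := topnorm_le m_gt0 l_gt1 (prime_gt0 pg) (fits_mkpoly _) (coef_mkpoly_le Ms).
  move/leq_trans; apply.
  have -> : (l * (d * s) * g = l * d * g * s)%N by rewrite !mulnA mulnAC.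
  rewrite KE (expnMn (l * d * g)%N s) -(mulnA _ (d.*2.+1 ^ d)%N) leq_mul2l; apply/orP; right.
  apply: leq_trans sX _; rewrite (expnMn d.*2.+1) leq_mul2l; apply/orP; right.
  by have /andP[] := normn_bounds m_gt0 W_gt0 N_gt0 p.1.
pose enc (p : Q) : {ffun 'I_l * 'I_d -> 'I_(2 * s).+1} * 'I_K.+1 :=
  ([ffun ij => inord (absz ((f p).1 ij.1 ij.2 + s%:Z)%R)], inord (tau p %/ normn W p.1)).
have encP p p' : A p -> A p' -> enc p = enc p' ->
    (f p).1 = (f p').1 /\ normn W p.1 = normn W p'.1.
  move=> Ap Ap' E; have E1 := congr1 fst E; have E2 := congr1 snd E.
  have [_ _ Ms _] := Hf p Ap; have [_ _ Ms' _] := Hf p' Ap'.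
  have EM : (f p).1 = (f p').1.
    apply/matrixP => i j; apply: (inord_absz_inj (Ms i j) (Ms' i j)).
    have := congr1 (fun h : {ffun 'I_l * 'I_d -> 'I_(2 * s).+1} => h (i, j)) E1.
    by rewrite /enc [LHS]ffunE [RHS]ffunE.
  split; first exact: EM.
  have [t0 [k Ek kK]] := tauP p Ap; have [t0' [k' Ek' kK']] := tauP p' Ap'.
  have n0 := normn_gt0 m_gt0 W_gt0 N_gt0 p.1; have n0' := normn_gt0 m_gt0 W_gt0 N_gt0 p'.1.
  have kk : k = k'.
    apply: (inord_inj_le kK kK'); rewrite -(mulKn k n0) -(mulKn k' n0') -Ek -Ek'.
    exact: E2.
  have tt : tau p = tau p' by rewrite /tau EM.
  apply/eqP; rewrite -(@eqn_pmul2r k); last by move: t0; rewrite Ek muln_gt0 => /andP[].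
  by rewrite -Ek tt Ek' kk.
have fib p p' : A p -> A p' -> enc p = enc p' ->
    p.2 = p'.2 /\ forall r, prime r -> (r %| normn W p.1)%N ->
      (r %| cnorm m (avec W p.1 - avec W p'.1))%Z.
  move=> Ap Ap' E; have [EM En] := encP p p' Ap Ap' E.
  have [H1 _ _ ME] := Hf p Ap; have [H1' _ _ ME'] := Hf p' Ap'.
  have gp : good W S p.1 by case/andP: Ap.
  have n0 := normn_gt0 m_gt0 W_gt0 N_gt0 p.1.
  (* Both evaluation points kill the same lattice point. If they differed modulo r, then r^2 would
     divide its norm n k; n being squarefree, r would divide k, contradicting 0 < k <= K <= y <
     r. *)
  have key r : prime r -> (r %| normn W p.1)%N ->
      (r %| (f p).2.1 - (f p').2.1)%Z && (r %| (f p).2.2 - (f p').2.2)%Z.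
    move=> pr rn; apply: contraT => nxy.
    have [yr mr Sr r2] := goodP m_gt0 my gp pr rn.
    have [x1 x2 x3] := H1 r pr rn; have [|x1' x2' x3'] := H1' r pr; first by rewrite -En.
    have [HYr _] := HY r pr mr Sr.
    have rn' : (r %| normn W p'.1)%N by rewrite -En.
    have rME := @dvdz_trans _ r _ rn ME; have rME' := @dvdz_trans _ r _ rn' ME'.
    rewrite -EM in rME'.
    have := dvdz_sqr_topnorm m_gt0 l_gt1 pr mr x1 (dvdz_root_congr x3 (HYr _)) rME
      x1' (dvdz_root_congr x3' (HYr _)) rME' nxy.
    have r2E : (r ^ 2)%N%:Z = r%:Z ^+ 2 by rewrite -!natz natrX.
    rewrite -r2E -[(_ %| _)%Z]/(r ^ 2 %| tau p)%N.
    have [t0 [k Ek kK]] := tauP p Ap; rewrite Ek => /dvdn_sqfree_mul.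
    move=> /(_ pr n0 r2) /(dvdn_leq _).
    have -> : (0 < k)%N by move: t0; rewrite Ek muln_gt0 => /andP[].
    move/(_ isT) => rk; have := leq_ltn_trans (leq_trans (leq_trans rk kK) Ky) yr.
    by rewrite ltnn.
  split.
    apply/ffunP => j; have Vn : (V <= size (primes (normn W p.1)))%N by case/andP: Ap.
    have jn := leq_trans (ltn_ord j) Vn.
    have [r Er] : exists r, r = nth 0%N (primes (normn W p.1)) j by eexists.
    have rp : r \in primes (normn W p.1) by rewrite Er; exact: mem_nth jn.
    have ri : index r (primes (normn W p.1)) = j.
      rewrite Er; exact: index_uniq jn (primes_uniq _).
    have [pr rn] := mem_primes_dvd rp.
    have [_ mr Sr _] := goodP m_gt0 my gp pr rn.
    have [_ Yr] := HY r pr mr Sr.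
    have [_ _] := H1 r pr rn; have [|_ _] := H1' r pr; first by rewrite -En.
    have /andP[_ ryy] := key r pr rn.
    rewrite -En ri /ne; case: insubP => [i _ ij|]; last by rewrite ltn_ord.
    rewrite (val_inj ij) => z' z.
    exact: bool_root_inj Yr (dvdz_sub_congr ryy z z').
  move=> r pr rn; have /andP[rxx _] := key r pr rn.
  have [x1 x2 _] := H1 r pr rn; have [|x1' x2' _] := H1' r pr; first by rewrite -En.
  apply: (dvdz_pnorm (t := (f p).2.1)); last 2 first.
  - exact: x1.
  - exact: dvdz_hornerB x2 (dvdz_horner_congr pr rxx x2').
  - exact: Cyclotomic_monic.
  - exact: size_Cyclotomic_pred.
  - exact: prime_gt0.
rewrite -cA.
have -> : ((2 * s).+1 ^ D * K.+1 = #|{: {ffun 'I_l * 'I_d -> 'I_(2 * s).+1} * 'I_K.+1}|)%N.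
  by rewrite card_prod card_ffun card_prod !card_ord.
apply: (leq_card_fibre (f := enc)) => z.
set F := [pred p | _].
have FP p : F p -> A p /\ enc p = z by case/andP => Ap /eqP.
have [->//|/card_gt0P[p0 Fp0]] := posnP #|F|.
have [Ap0 ep0] := FP p0 Fp0.
pose Yb : pred box := fun b => [exists e, F (b, e)].
have YbP b : Yb b -> exists2 p, F p & p.1 = b by case/existsP => e Fe; exists (b, e).
(* Within a fibre of [enc] the choice of roots is constant, so the fibre injects into the set of its
   box elements. *)
apply: (@leq_trans #|Yb|).
  rewrite -(card_in_image (f := fst) (A := F)); last first.
    move=> [b e] [b' e'] Fp Fp' /= bb; have [Ap ep] := FP _ Fp; have [Ap' ep'] := FP _ Fp'.
    by have [/= -> _] := fib _ _ Ap Ap' (etrans ep (esym ep')); rewrite bb.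
  apply: subset_leq_card; apply/fintype.subsetP => b /mapP[[b' e]].
  by rewrite mem_enum => Fp ->; rewrite unfold_in; apply/existsP; exists e.
apply: (same_roots_card m_gt0 my N_gt0 (n := normn W p0.1) (S := S)) => [b /YbP[p Fp <-]|].
  have [Ap ep] := FP _ Fp; split; first by case/andP: Ap.
  by have [_ ->] := encP _ _ Ap Ap0 (etrans ep (esym ep0)).
move=> b b' r /YbP[p Fp <-] /YbP[p' Fp' <-] pr rn.
have [Ap ep] := FP _ Fp; have [Ap' ep'] := FP _ Fp'.
have [_ H] := fib _ _ Ap Ap' (etrans ep (esym ep')); apply: H => //.
by have [_ ->] := encP _ _ Ap Ap0 (etrans ep (esym ep0)).
Qed.

End Many.

Lemma psum_tail_le S a a' b : (a <= a')%N -> psum S a' b <= psum S a b.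
Proof.
move=> aa; have [a'b|ba'] := leqP a' b.
  by rewrite (psum_cat S aa a'b) lerDr psum_ge0.
by rewrite {1}/psum big_geq ?psum_ge0 // ltnW.
Qed.

Lemma sieve_conclusion (G F A T q : nat) : (0 < T)%N ->
  (11 * T <= 16 * (F + G))%N -> (16 * F <= T)%N -> (G * A <= q * T)%N ->
  (A <= 2 * q)%N.
Proof.
move=> T0 h1 h2 h3; have h4 : (10 * T <= 16 * G)%N by lia.
rewrite -(leq_pmul2l T0); have := leq_mul h4 (leqnn A); lia.
Qed.

Lemma ex_nat_root D X : (0 < D)%N -> (0 < X)%N ->
  exists s, [/\ (0 < s)%N, (s ^ D <= X)%N & (X < s.+1 ^ D)%N].
Proof.
move=> D0 X0; have exP : exists s, (s ^ D <= X)%N by exists 0%N; rewrite exp0n.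
have ubP s : (s ^ D <= X)%N -> (s <= X)%N.
  apply: leq_trans; case: s => // s.
  by rewrite -{1}[s.+1]expn1 leq_pexp2l.
have [s sX smax] := ex_maxnP exP ubP; exists s; split=> //.
  by apply: smax; rewrite exp1n.
by rewrite ltnNge; apply/negP => /smax; rewrite ltnn.
Qed.

Lemma leq_add4 (a b c e : nat) : [/\ a <= a + b + c + e, b <= a + b + c + e,
  c <= a + b + c + e & e <= a + b + c + e]%N.
Proof. by split; lia. Qed.

Lemma ltn_3mul s : (0 < s)%N -> ((2 * s).+1 <= 3 * s)%N.
Proof. lia. Qed.

(** Good elements fill 11/16 of the box and those with fewer than V primes at most 1/16; each of the
    remaining 10/16 yields 2^V points, too many for V large. The constants are fixed in the order y,
    V, N, so that the bound on the points depends on y but not on V. *)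
Theorem not_thin_two_roots m l g :
  (0 < m)%N -> (1 < l)%N -> prime g -> coprime g m ->
  ~ thin (fun r => (m %| r.-1)%N && ~~ `[< two_roots l g r >]).
Proof.
set S := (X in thin X); move=> m_gt0 l_gt1 pg cop tS.
pose d := totient m; have d_gt0 : (0 < d)%N by rewrite totient_gt0.
pose c2 := ((2 * d) ^ d)%N; pose D := (l * d)%N; pose C0 := (d.*2.+1 ^ d)%N.
have D_gt0 : (0 < D)%N by rewrite muln_gt0 d_gt0 ltnW.
have [K KE] : exists K, K = ((l * d * g) ^ D * C0)%N by eexists.
have [y0 Hy0] := thin_tail (16 * d * c2)%N tS.
have [y Ey] : exists y, y = (y0 + m + 16 * d ^ 2 * c2 + K)%N by eexists.
have [CW ECW] : exists CW, CW = (C0 * y`! ^ d)%N by eexists.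
have CW_gt0 : (0 < CW)%N by rewrite ECW muln_gt0 !expn_gt0 fact_gt0.
(* Twice the constant of the point count, so that the outcome 2^V <= V is absurd. *)
have [V EV] : exists V, V = (2 * (c2.+1 * (3 ^ D * CW * K.+1)))%N by eexists.
have [Xa Ha] := thin_count (16 * d * CW)%N tS.
(* Norms up to X with few primes must stay rare after multiplication by d^V (c2 + 1) elements per
   norm and by the ratio X / T = [CW]. *)
have [Xb Hb] := rare_few_primes V primes_not_thin (16 * (d ^ V * c2.+1) * CW)%N.
have [N EN] : exists N, N = (Xa + Xb + 256 * d ^ 4 * CW + 1)%N by eexists.
have N_gt0 : (0 < N)%N by rewrite EN addn1.
have [XaN XbN DN _] := leq_add4 Xa Xb (256 * d ^ 4 * CW) 1; rewrite -EN in XaN XbN DN.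
have [y0y my y_big Ky] := leq_add4 y0 m (16 * d ^ 2 * c2) K.
rewrite -Ey in y0y my y_big Ky.
have [T ET] : exists T, T = (N ^ d)%N by eexists.
have NT : (N <= T)%N by rewrite ET -{1}[N]expn1 leq_pexp2l.
have [X EX] : exists X, X = ((d.*2.+1 * (y`! * N)) ^ d)%N by eexists.
have XCW : X = (CW * T)%N by rewrite EX ECW ET !expnMn mulnA.
have NX : (N <= X)%N by rewrite XCW (leq_trans NT) // leq_pmull.
have {}Ha : (16 * d * CW * \sum_(0 <= r < X.+1) (prime r && S r) <= X)%N.
  apply: Ha; exact: leq_trans XaN NX.
have {}Hb : (16 * (d ^ V * c2.+1 * cnt (fun n => size (primes n) < V)%N X) <= T)%N.
  rewrite -(leq_pmul2l CW_gt0) -XCW; apply: leq_trans (Hb X _).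
    rewrite leq_eqVlt; apply/orP; left; apply/eqP.
    rewrite (_ : cnt (fun n => count _ _ < V)%N X = cnt (fun n => size (primes n) < V)%N X).
      by set c := cnt _ _; ring.
    by apply: eq_bigr => n _; rewrite count_predT.
  exact: leq_trans XbN NX.
have T_big : (256 * d ^ 4 * CW <= T)%N := leq_trans DN NT.
have X_gt0 : (0 < X)%N by apply: leq_trans NX.
have [s [s_gt0 sX Xs]] := ex_nat_root D_gt0 X_gt0.
have Sm r : prime r -> S r -> (m %| r.-1)%N by move=> _ /andP[].
have Stail n : (16 * d * c2)%:R * psum S y.+1 n <= 1.
  apply: le_trans (Hy0 n); apply: ler_wpM2l; first exact: ler0n.
  exact: psum_tail_le (leqW y0y).
rewrite ECW EX in Ha; rewrite ECW ET in T_big; rewrite EX ET in Hb.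
have H1 := card_good m_gt0 my y_big Sm Stail Ha T_big.
have H2 := card_few S m_gt0 my N_gt0 V.
have tr r : prime r -> (m %| r.-1)%N -> ~~ S r -> two_roots l g r.
  by move=> pr mr; rewrite /S mr /= negbK => /asboolP.
rewrite EX in sX Xs.
have H3 := card_many V m_gt0 my N_gt0 l_gt1 pg cop tr sX Xs Ky KE.
move: H1 H2 H3.
set G := #|(_ : pred _)|; set F := #|_|; set B := #|_| => H1 H2 H3.
have GE : G = (F + B)%N.
  rewrite /G /F /B -!sum1_card (bigID (fun b => size (primes (normn y`! b)) < V)%N) /=.
  by congr (_ + _)%N; apply: eq_bigl => b; rewrite !unfold_in /= -?leqNgt.
have T_gt0 : (0 < N ^ d)%N by rewrite expn_gt0 N_gt0.
have B2 : (B * 2 ^ V <= (c2.+1 * (3 ^ D * CW * K.+1)) * N ^ d)%N.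
  apply: leq_trans H3 _; rewrite -mulnA leq_mul2l; apply/orP; right.
  rewrite mulnAC leq_mul2r; apply/orP; right.
  apply: (@leq_trans (3 ^ D * s ^ D)).
    by rewrite -expnMn leq_exp2r // ltn_3mul.
  by rewrite -mulnA leq_mul2l -ET -XCW EX sX orbT.
have F16 : (16 * F <= N ^ d)%N by apply: leq_trans Hb; rewrite leq_mul2l H2 orbT.
rewrite GE in H1.
have := sieve_conclusion T_gt0 H1 F16 B2; rewrite -EV leqNgt.
by rewrite ltn_expl.
Qed.

(** * Orders of q modulo primes *)

Lemma thin_sub (S S' : pred nat) :
  (forall r, prime r -> S r -> S' r) -> thin S' -> thin S.
Proof.
move=> SS [B HB]; exists B => N; apply: le_trans (HB N).
rewrite /psum big_mkcond [leRHS]big_mkcond; apply: ler_sum => r _.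
case: (boolP (prime r)) => //= pr; case: (boolP (S r)) => [/(SS r pr) ->|_] //.
by case: ifP => // _; rewrite invr_ge0 ler0n.
Qed.

(* For r coprime to q: the order of q modulo r is a multiple of a. *)
Definition forces_dvd (q a r : nat) : bool :=
  `[< forall i, (q ^ i = 1 %[mod r])%N -> (a %| i)%N >].

(** Write p = w^a with w a primitive root modulo r. If l | a, then w^(a / l) and its product with
    the l-th root of unity w^((r-1) / l) are two roots. Otherwise r - 1 | a e i, and removing the
    part prime to l and the factor l^s of e leaves l^k | i. *)
Lemma two_roots_or_dvd (p e e' l k s r i : nat) : prime p -> prime l -> prime r ->
  e = (e' * l ^ s)%N -> coprime l e' -> (l ^ (k + s) %| r.-1)%N -> (0 < k + s)%N ->
  ((p ^ e) ^ i = 1 %[mod r])%N -> two_roots l p r \/ (l ^ k %| i)%N.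
Proof.
move=> pp pl pr Ee cle lr ks qi; have rF := pchar_Fp pr.
have r1 := prime_gt1 pr; have r10 : (0 < r.-1)%N by rewrite -subn1 subn_gt0.
have natF (x y : nat) : (x = y %[mod r])%N -> x%:R = y%:R :> 'F_r.
  by move=> xy; rewrite -[LHS]Fp_nat_mod // xy Fp_nat_mod.
have [i0|i0] := posnP i; first by right; rewrite i0 dvdn0.
have p0 : p%:R != 0 :> 'F_r.
  apply/eqP => p0; have := natF _ _ qi; rewrite -expnM natrX p0 expr0n.
  suff -> : (e * i == 0)%N = false by move/eqP; rewrite eq_sym oner_eq0.
  rewrite muln_eq0 (gtn_eqF i0) orbF Ee muln_eq0 expn_eq0 (gtn_eqF (prime_gt0 pl)) orbF.
  apply: contraTF cle => /eqP ->; rewrite /coprime gcdn0; apply: contraTneq pl => ->.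
  by [].
have [|w pw] := @fin_prim_root 'F_r r.-1 r10; first by rewrite card_Fp.
have [a Ea] : exists a, p%:R = w ^+ a.
  have pe : p%:R ^+ r.-1 = 1 :> 'F_r.
    apply: (mulfI p0); rewrite mulr1 -exprS prednK ?prime_gt0 //.
    by rewrite -(pFrobenius_autE rF) (rmorph_nat (pFrobenius_aut rF)).
  by have [a Ea] := prim_rootP pw pe; exists a.
have ra : (r.-1 %| a * (e * i))%N.
  by rewrite (prim_order_dvd pw) exprM -Ea exprM -!natrX (natF _ _ qi).
have [/dvdnP[a' Ea']|la] := boolP (l %| a)%N; last first.
  right; have : (l ^ (k + s) %| a * (e * i))%N by apply: dvdn_trans ra.
  rewrite Gauss_dvdr; last by rewrite coprimeXl // prime_coprime.
  rewrite Ee mulnAC expnD dvdn_pmul2r ?expn_gt0 ?prime_gt0 //.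
  by rewrite Gauss_dvdr // coprimeXl.
left; pose h := (r.-1 %/ l)%N.
have lr1 : (l %| r.-1)%N.
  by apply: dvdn_trans lr; rewrite -{1}(expn1 l) dvdn_exp2l.
have hE : (h * l = r.-1)%N by rewrite divnK.
have toZ (z z' : 'F_r) : (r %| (z : nat)%:Z - (z' : nat)%:Z)%Z = (z == z').
  by rewrite (dvdz_pcharf rF) rmorphB /= -!pmulrn !natr_Zp subr_eq0.
have root (z : 'F_r) : z ^+ l = p%:R -> (r %| (z : nat)%:Z ^+ l - p%:Z)%Z.
  by move=> zp; rewrite (dvdz_pcharf rF) rmorphB rmorphXn /= -!pmulrn natr_Zp zp subrr.
exists ((w ^+ a' : 'F_r) : nat)%:Z, ((w ^+ (a' + h) : 'F_r) : nat)%:Z; split.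
- by apply: root; rewrite -exprM -Ea' -Ea.
- by apply: root; rewrite -exprM mulnDl hE exprD -Ea' (prim_expr_order pw) mulr1 -Ea.
rewrite toZ exprD eq_sym -subr_eq0 -{2}[w ^+ a']mulr1 -mulrBr mulf_eq0.
rewrite expf_eq0 (prim_root_eq0 pw) (gtn_eqF r10) andbF /= subr_eq0.
rewrite -(prim_order_dvd pw); apply/negP => /dvdn_leq.
have l1 := prime_gt1 pl; have h0 : (0 < h)%N by rewrite divn_gt0 ?prime_gt0 // dvdn_leq.
by move/(_ h0); rewrite -hE leqNgt ltn_Pmulr.
Qed.

Lemma not_thin_forces_dvd p e l k : prime p -> (0 < e)%N -> prime l -> l != p ->
  ~ thin (forces_dvd (p ^ e) (l ^ k)).
Proof.
move=> pp e0 pl lp; have [e' cle Ee] := pfactor_coprime pl e0.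
set s := logn l e in Ee.
(* Passing from p to q = p^e may cost the factor l^s in the order, so l^(k+s) is needed in r - 1;
   one more power keeps the exponent positive when k = s = 0. *)
have cop : coprime p (l ^ (k + s).+1).
  by rewrite coprimeXr // prime_coprime // dvdn_prime2 // eq_sym.
have l0 : (0 < l ^ (k + s).+1)%N by rewrite expn_gt0 prime_gt0.
move=> tS; apply: (not_thin_two_roots l0 (prime_gt1 pl) pp cop).
apply: thin_sub tS => r pr /andP[lr /asboolPn nr]; apply/asboolP => i qi.
have lr' : (l ^ (k.+1 + s) %| r.-1)%N by [].
have [//|] := @two_roots_or_dvd p e e' l k.+1 s r i pp pl pr Ee cle lr' isT qi.
by apply: dvdn_trans; rewrite dvdn_exp2l.
Qed.

(** For odd p this is the preceding lemma with l = 2. For p = 2 the modulus m has to be prime to g =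
    2, and m = 1 works: r - 1 is even for every odd r, and an odd e loses no power of 2. *)
Lemma not_thin_forces_even p e : prime p -> odd e ->
  ~ thin (forces_dvd (p ^ e) 2).
Proof.
move=> pp oe; have [p2|p2] := eqVneq p 2; last first.
  by rewrite -[2%N]expn1; apply: not_thin_forces_dvd; rewrite ?odd_gt0 // eq_sym.
move=> tS; apply: (@not_thin_two_roots 1 2 2) => //.
apply: thin_sub tS => r pr /andP[_ /asboolPn nr]; apply/asboolP => i qi.
(* Modulo 2, the power 2^(e i) is 1 only for i = 0. *)
have [r2|r2] := eqVneq r 2.
  move: qi; rewrite p2 r2 -expnM; case: i => [//|i].
  by rewrite mulnS expnD -(prednK (odd_gt0 oe)) expnS -!mulnA modnMr.
have r1 : (2 ^ (1 + 0) %| r.-1)%N.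
  have := even_prime pr; case=> [E|]; first by rewrite E in r2.
  by rewrite dvdn2 -{1}(prednK (prime_gt0 pr)) /= => ->.
have [] := @two_roots_or_dvd p e e 2 1 0 r i pp isT pr _ _ r1 isT qi => //.
- by rewrite muln1.
- by rewrite coprime2n.
- by rewrite p2.
Qed.

(** * Carlitz's theorem over prime fields *)

(** Substituting w u for u, with w a generator, multiplies the sum by w^t, which is not 1. *)
Lemma sum_expr_finField_eq0 (F : finFieldType) t :
  ~~ (#|F|.-1 %| t)%N -> \sum_(u : F) u ^+ t = 0.
Proof.
move=> nt; have F1 := finRing_gt1 F.
have F0 : (0 < #|F|.-1)%N by rewrite -subn1 subn_gt0.
have [|w pw] := @fin_prim_root F #|F|.-1 F0; first exact: dvdnn.
have w0 : w != 0 by rewrite (prim_root_eq0 pw) gtn_eqF.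
set s := \sum_u _; apply/eqP; apply: contraNT nt => s0.
rewrite (prim_order_dvd pw); apply/eqP/(mulIf s0); rewrite mul1r.
rewrite /s mulr_sumr [RHS](reindex_inj (mulfI w0)).
by apply: eq_bigr => u _; rewrite exprMn.
Qed.

Section Carlitz.

Variables (p e : nat) (h : 'F_p -> 'F_p).
Hypotheses (pp : prime p) (pe : p = (2 * e).+1).
Hypothesis hE : forall z w, (h z - h w) ^+ e = (z - w) ^+ e.

Let e_gt0 : (0 < e)%N.
Proof. by rewrite lt0n; apply: contraTneq pp => e0; rewrite pe e0. Qed.

Let hinj : injective h.
Proof.
move=> z w zw; apply/eqP; rewrite -subr_eq0; have := hE z w.
rewrite zw subrr expr0n gtn_eqF // => /esym/eqP; rewrite expf_eq0.
by case/andP.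
Qed.

Let cardF : #|'F_p|.-1 = (2 * e)%N. Proof. by rewrite card_Fp // {1}pe. Qed.

Let sum_sqr : \sum_(u : 'F_p) u ^+ (2 * e) = -1.
Proof.
rewrite (bigD1 0) //= expr0n muln_eq0 (gtn_eqF e_gt0) add0r.
rewrite (eq_bigr (fun=> 1)) => [|u u0]; last first.
  by apply: (mulfI u0); rewrite -exprS -pe mulr1 -{2}(expf_card u) card_Fp.
rewrite sumr_const (cardC1 (0 : 'F_p)) cardF.
apply/eqP; rewrite -subr_eq0 opprK natr1 -pe.
by rewrite -(dvdn_pcharf (pchar_Fp pp)).
Qed.

(* The power sum of u^(e+i) (X-u)^e over F_p is a nonzero multiple of X^i;
   substitute u = h w. *)
Lemma carlitz_power i : (i <= e)%N ->
  exists2 P : {poly 'F_p}, (size P <= e.+1)%N & forall z, P.[z] = h z ^+ i.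
Proof.
move=> ie; pose c : 'F_p := (-1) ^+ (e - i) * 'C(e, e - i)%:R * -1.
have c0 : c != 0.
  rewrite !mulf_neq0 ?signr_eq0 ?oppr_eq0 ?oner_eq0 //.
  rewrite -(dvdn_pcharf (pchar_Fp pp)); apply/negP => pC.
  have : coprime p e`! by apply: prime_coprime_fact; rewrite // pe ltnS leq_pmull.
  by rewrite prime_coprime // -(bin_fact (leq_subr i e)) dvdn_mulr.
have key x : \sum_(u : 'F_p) u ^+ (e + i) * (x - u) ^+ e = c * x ^+ i.
  under eq_bigr => u _ do rewrite exprBn mulr_sumr.
  have termE (u : 'F_p) (k : 'I_e.+1) : u ^+ (e + i) *
      ((-1) ^+ k * x ^+ (e - k) * u ^+ k *+ 'C(e, k)) =
      (-1) ^+ k * 'C(e, k)%:R * x ^+ (e - k) * u ^+ (e + i + k).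
    rewrite -mulr_natr (exprD u (e + i)); set a := u ^+ (e + i); set b := u ^+ k.
    by set f := x ^+ _; set g := (-1) ^+ k; ring.
  under eq_bigr => u _ do under eq_bigr => k _ do rewrite termE.
  rewrite exchange_big /=; under eq_bigr do rewrite -mulr_sumr.
  have ke : (e - i < e.+1)%N by rewrite ltnS leq_subr.
  (* The exponents e + i + k lie between e and 3e, so 2e divides one of them only for k = e - i,
     where the sum of u^(2e) is -1. *)
  rewrite (bigD1 (Ordinal ke)) //= [X in _ + X]big1 ?addr0 => [|k kn].
    by rewrite subKn // -addnA subnKC // addnn -mul2n sum_sqr /c; ring.
  rewrite sum_expr_finField_eq0 ?mulr0 // cardF; apply/negP => /dvdnP[t Et].
  have kE : (k : nat) <> (e - i)%N by move=> E; case/eqP: kn; apply: val_inj.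
  have ke' := ltn_ord k; case: t Et => [|[|t]] Et; [lia|lia|].
  have : (4 * e <= e + i + k)%N by rewrite Et; nia.
  by lia.
(* For x = h z and u = h w the hypothesis turns (h z - h w)^e into (z - w)^e, a polynomial of degree
   e in z. *)
exists (c^-1 *: \sum_(w : 'F_p) h w ^+ (e + i) *: ('X - w%:P) ^+ e).
  apply: leq_trans (size_scale_leq _ _) _; apply: (leq_trans (size_sum _ _ _)).
  apply/bigmax_leqP => w _; apply: leq_trans (size_scale_leq _ _) _.
  by rewrite size_exp_XsubC.
move=> z; rewrite hornerZ horner_sum; apply: (mulfI c0).
rewrite mulrA divff // mul1r -key [RHS](reindex_inj hinj) /=.
by apply: eq_bigr => w _; rewrite hornerZ horner_exp hornerXsubC hE.
Qed.

(* If P interpolates h with degree k >= 2, some power i <= e has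
   e < i k <= 2 e < p, and P^i would be the reduced polynomial of h^i. *)
Lemma carlitz : h 0 = 0 -> h 1 = 1 -> forall z, h z = z.
Proof.
move=> h0 h1; have [P sP PE] := carlitz_power e_gt0.
have [sP2|sP2] := leqP (size P) 2.
  have hz z : h z = P`_0 + P`_1 * z.
    rewrite -[LHS]expr1 -PE (horner_coef_wide z sP2) !big_ord_recl big_ord0.
    by rewrite addr0 expr0 expr1 mulr1.
  have P0 : P`_0 = 0 by have := hz 0; rewrite h0 mulr0 addr0.
  have P1 : P`_1 = 1 by have := hz 1; rewrite h1 P0 add0r mulr1.
  by move=> z; rewrite hz P0 P1 add0r mul1r.
exfalso; pose k := (size P).-1.
have kP : size P = k.+1 by rewrite /k prednK // (ltn_trans _ sP2).
have k2 : (2 <= k)%N by rewrite -ltnS -kP.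
have ke : (k <= e)%N by rewrite -ltnS -kP.
pose i := (e %/ k).+1.
have ike : (e < i * k)%N by rewrite ltn_ceil // ltnW.
have ik2 : (i * k <= 2 * e)%N.
  by rewrite /i mulSn mul2n -addnn leq_add // leq_divM.
have ie : (i <= e)%N by rewrite /i ltn_divLR; nia.
have [Q sQ QE] := carlitz_power ie.
have P0 : P != 0 by rewrite -size_poly_gt0 kP.
have sPi : size (P ^+ i) = (i * k).+1.
  rewrite -(prednK (_ : 0 < size (P ^+ i))%N) ?size_poly_gt0 ?expf_neq0 //.
  by rewrite size_exp kP mulnC.
have sR : size (P ^+ i - Q) = (i * k).+1.
  by rewrite size_polyDl ?sPi // size_polyN (leq_ltn_trans sQ).
have R0 : P ^+ i - Q != 0 by rewrite -size_poly_gt0 sR.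
have pik : (i * k < p)%N by rewrite [X in (_ < X)%N]pe ltnS.
have roots : all (root (P ^+ i - Q)) (enum 'F_p).
  by apply/allP => z _; rewrite rootE hornerD hornerN horner_exp PE QE expr1 subrr.
have := max_poly_roots R0 roots (enum_uniq _); rewrite sR -cardE card_Fp // ltnS.
by rewrite leqNgt pik.
Qed.

End Carlitz.

(** * Rigidity of color automorphisms *)

Lemma dvdz_expr_prime_power (p a : nat) (x : int) : (p %| x - 1)%Z ->
  (p%:Z ^+ a.+1 %| x ^+ (p ^ a) - 1)%Z.
Proof.
move=> px; elim: a => [|a IH]; first by rewrite expn0 !expr1.
rewrite expnSr exprM exprSr; apply: dvdz_subr1_expr => //.
by apply: dvdz_trans IH; rewrite exprS dvdz_mulr.
Qed.

Lemma expr_card_Fp p (z : 'F_p) : prime p -> z != 0 -> z ^+ p.-1 = 1.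
Proof.
move=> pp z0; apply: (mulfI z0); rewrite mulr1 -exprS prednK ?prime_gt0 //.
by rewrite -{2}(expf_card z) card_Fp.
Qed.

Section LocalRigidity.

(** [G] is a normalized color automorphism read on the integers, for the modulus n = p^a m; over the
    integers one congruence can be reduced modulo p, p^a and m alike. *)
Variables (q p a m : nat) (G : int -> int).
Hypotheses (pp : prime p) (a_gt0 : (0 < a)%N) (cPm : coprime (p ^ a) m).
Hypothesis cpq : coprime p q.
Hypothesis (G0 : G 0 = 0) (G1 : ((p ^ a * m)%N %| G 1 - 1)%Z).
Hypothesis Gq : forall x y, exists i, ((p ^ a * m)%N %| G y - G x - q%:Z ^+ i * (y - x))%Z.
Hypothesis Hpow : forall i, (m %| q%:Z ^+ i - 1)%Z -> (p ^ a.-1 %| i)%N.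
Hypothesis Hsqr : odd p -> forall i, (m %| q%:Z ^+ i - 1)%Z ->
  exists u, q%:R ^+ i = u ^+ 2 :> 'F_p.

Let pF : p \in [pchar 'F_p]. Proof. exact: pchar_Fp. Qed.

Let eqF (x y : int) : (p %| x - y)%Z = (x%:~R == y%:~R :> 'F_p).
Proof. by rewrite (dvdz_pcharf pF) rmorphB subr_eq0. Qed.

Let dP x : ((p ^ a * m)%N %| x)%Z -> ((p ^ a)%N %| x)%Z.
Proof. by apply: dvdz_trans; rewrite PoszM dvdz_mulr. Qed.

Let dm x : ((p ^ a * m)%N %| x)%Z -> (m %| x)%Z.
Proof. by apply: dvdz_trans; rewrite PoszM dvdz_mull. Qed.

Let dp x : ((p ^ a)%N %| x)%Z -> (p %| x)%Z.
Proof. by apply: dvdz_trans; rewrite -[(_ %| _)%Z]/(p %| p ^ a)%N dvdn_exp. Qed.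

Lemma dvdz_map_sub (k : int) x y : (k %| (p ^ a * m)%N%:Z)%Z ->
  (k %| x - y)%Z -> (k %| G x - G y)%Z.
Proof.
move=> kn kxy; have [i Hi] := Gq y x.
rewrite -[_ - _](subrK (q%:Z ^+ i * (x - y))) rpredD //; first exact: dvdz_trans Hi.
exact: dvdz_mull.
Qed.

(** By the Chinese remainder theorem, replace x and x' by z and z' with the same residues modulo p^a
    but equal to 1 and 0 modulo m. Since G fixes 0 and 1 modulo m, the factor q^i belonging to this
    pair is 1 modulo m. *)
Lemma local_ratio x x' : exists i,
  (m %| q%:Z ^+ i - 1)%Z /\ ((p ^ a)%N %| G x - G x' - q%:Z ^+ i * (x - x'))%Z.
Proof.
have cop : coprimez (p ^ a)%N m by [].
pose z := zchinese (p ^ a)%N m x 1; pose z' := zchinese (p ^ a)%N m x' 0.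
have zx : ((p ^ a)%N %| x - z)%Z.
  by rewrite -eqz_mod_dvd; apply/eqP/esym/zchinese_modl.
have z1 : (m %| z - 1)%Z by rewrite -eqz_mod_dvd; apply/eqP/zchinese_modr.
have zx' : ((p ^ a)%N %| x' - z')%Z.
  by rewrite -eqz_mod_dvd; apply/eqP/esym/zchinese_modl.
have z0 : (m %| z' - 0)%Z by rewrite -eqz_mod_dvd; apply/eqP/zchinese_modr.
have kP : ((p ^ a)%N %| (p ^ a * m)%N%:Z)%Z by rewrite PoszM dvdz_mulr.
have km : (m %| (p ^ a * m)%N%:Z)%Z by rewrite PoszM dvdz_mull.
have [i Hi] := Gq z' z; exists i; split.
  have h1 := dvdz_map_sub km z1; have h0 := dvdz_map_sub km z0.
  have -> : q%:Z ^+ i - 1 = - (G z - G z' - q%:Z ^+ i * (z - z'))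
     + (G z - G 1) - G z' + (G 1 - 1) - q%:Z ^+ i * ((z - 1) - (z' - 0)) by ring.
  rewrite G0 subr0 in h0; apply: rpredB; last by apply: dvdz_mull; apply: rpredB.
  apply: rpredD; last exact: dm.
  by apply: rpredB => //; apply: rpredD => //; rewrite rpredN; apply: dm.
have h1 := dvdz_map_sub kP zx; have h2 := dvdz_map_sub kP zx'.
have -> : G x - G x' - q%:Z ^+ i * (x - x') = (G z - G z' - q%:Z ^+ i * (z - z'))
  + (G x - G z) - (G x' - G z') - q%:Z ^+ i * ((x - z) - (x' - z')) by ring.
apply: rpredB; last by apply: dvdz_mull; apply: rpredB.
by apply: rpredB => //; apply: rpredD => //; apply: dP.
Qed.

(** For odd p the ratios q^i are nonzero squares modulo p, so they disappear on raising to the power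
    (p - 1) / 2, which is the hypothesis of [carlitz]. For p = 2 the residues 0 and 1 are all there
    is. *)
Lemma map_mod_prime x : (p %| G x - x)%Z.
Proof.
have pn : (p %| (p ^ a * m)%N%:Z)%Z by apply: dp; rewrite PoszM dvdz_mulr.
have G1p : (p %| G 1 - 1)%Z := dp (dP G1).
have [p2|op] := even_prime pp.
  have : (p %| x - 0)%Z \/ (p %| x - 1)%Z.
    rewrite p2; lia.
  case=> px.
    have -> : G x - x = (G x - G 0) - (x - 0) by rewrite G0 !subr0.
    by rewrite rpredB // dvdz_map_sub.
  have -> : G x - x = (G x - G 1) + (G 1 - 1) - (x - 1) by ring.
  by rewrite rpredB // rpredD // dvdz_map_sub.
pose e := (p./2)%N.
have pe : p = (2 * e).+1 by rewrite -(odd_double_half p) op add1n mul2n.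
pose h (z : 'F_p) : 'F_p := (G (z : nat)%:Z)%:~R.
have natF (z : 'F_p) : ((z : nat)%:Z)%:~R = z by rewrite -pmulrn natr_Zp.
have hE z w : (h z - h w) ^+ e = (z - w) ^+ e.
  have [i [im /dp Hi]] := local_ratio (z : nat)%:Z (w : nat)%:Z.
  have [u Hu] := Hsqr op im.
  move: Hi; rewrite eqF rmorphM rmorphXn !rmorphB /= !natF -/(h z) -/(h w) => /eqP ->.
  rewrite -pmulrn Hu exprMn -exprM -[X in _ = X]mul1r; congr (_ * _).
  have -> : (2 * e)%N = p.-1 by rewrite [in RHS]pe.
  apply: expr_card_Fp => //; apply: contraTneq cpq => u0.
  move: Hu; rewrite u0 expr0n => /eqP; rewrite expf_eq0 -(dvdn_pcharf pF) => /andP[_].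
  by rewrite prime_coprime // => ->.
have h0 : h 0 = 0 by rewrite /h G0.
have h1 : h 1 = 1.
  rewrite /h; have -> : (1 : 'F_p) = 1%N :> nat by rewrite /= Fp_cast // modn_small ?prime_gt1.
  by apply/eqP; rewrite -[1]/(1%:~R) -eqF.
have hz := carlitz pp pe hE h0 h1.
have xF : ((((x%:~R : 'F_p) : nat)%:Z))%:~R = x%:~R :> 'F_p := natF _.
have px : (p %| x - ((x%:~R : 'F_p) : nat)%:Z)%Z by rewrite eqF xF.
have := dvdz_map_sub pn px; rewrite eqF => /eqP Gx.
by rewrite eqF Gx -/(h _) hz.
Qed.

(** If p does not divide x - x', identity modulo p makes the ratio q^i equal to 1 modulo p. By
    [Hpow], i = i' p^(a-1); Frobenius gives q^i' = 1 modulo p, hence q^i = 1 modulo p^a. Take x' =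
    0, or x' = 1 when p | x. *)
Lemma map_mod_prime_power x : ((p ^ a)%N %| G x - x)%Z.
Proof.
have lift i : (m %| q%:Z ^+ i - 1)%Z -> (p %| q%:Z ^+ i - 1)%Z ->
    ((p ^ a)%N %| q%:Z ^+ i - 1)%Z.
  move=> im ip; have /dvdnP[i' Ei] := Hpow im.
  have ip' : (p %| q%:Z ^+ i' - 1)%Z.
    have frob (w : 'F_p) k : w ^+ (p ^ k) = w.
      elim: k => [|k IH]; first by rewrite expn0 expr1.
      by rewrite expnSr exprM IH -{2}(expf_card w) card_Fp.
    by move: ip; rewrite !eqF Ei exprM [((_ ^+ _) ^+ _)%:~R]rmorphXn /= frob.
  have := dvdz_expr_prime_power a.-1 ip'; rewrite prednK // -exprM -Ei.
  by have -> : (p ^ a)%N%:Z = p%:Z ^+ a by rewrite -!natz natrX.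
have G1P := dP G1.
have main x' : ~~ (p %| x - x')%Z -> ((p ^ a)%N %| G x - G x' - (x - x'))%Z.
  move=> nx; have [i [im Hi]] := local_ratio x x'.
  have ip : (p %| q%:Z ^+ i - 1)%Z.
    have : (p %| (q%:Z ^+ i - 1) * (x - x'))%Z.
      have -> : (q%:Z ^+ i - 1) * (x - x') = (G x - x) - (G x' - x')
         - (G x - G x' - q%:Z ^+ i * (x - x')) by ring.
      by apply: rpredB; [apply: rpredB; apply: map_mod_prime | apply: dp].
    by rewrite Gauss_dvdzl // coprimezE prime_coprime.
  have -> : G x - G x' - (x - x') = (G x - G x' - q%:Z ^+ i * (x - x'))
    + (q%:Z ^+ i - 1) * (x - x') by ring.
  by rewrite rpredD // dvdz_mulr // lift.
have [px|nx] := boolP (p %| x - 0)%Z; last by have := main 0 nx; rewrite G0 !subr0.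
have nx1 : ~~ (p %| x - 1)%Z.
  apply/negP => px1; have : (p %| 1)%Z.
    by have := rpredB px px1; have -> : (x - 0) - (x - 1) = 1 by ring.
  by rewrite dvdz1 /= => /eqP p1; have := prime_gt1 pp; rewrite p1.
have -> : G x - x = (G x - G 1 - (x - 1)) + (G 1 - 1) by ring.
by rewrite rpredD // main.
Qed.

End LocalRigidity.

(** * From color automorphisms to affine maps *)

Lemma dvdz_modn_sub (n a : nat) : (n %| (a %% n)%N%:Z - a%:Z)%Z.
Proof. by rewrite -eqz_mod_dvd -modz_nat modz_mod. Qed.

Lemma dvdz_expr_sub1 (r q i : nat) : (r %| q%:Z ^+ i - 1)%Z = (q ^ i == 1 %[mod r])%N.
Proof.
have -> : q%:Z ^+ i = (q ^ i)%N%:Z by rewrite -!natz natrX.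
by rewrite -[1]/(1%N%:Z) -eqz_mod_dvd !modz_nat eqz_nat.
Qed.

Section Affine.

Variables (q k : nat).
Local Notation n := (k.+1).
Hypothesis cnq : coprime n q.

Lemma dvdz_Zp_sub (u v : 'I_n) :
  (n %| (Zp_add u (Zp_opp v) : nat)%:Z - ((u : nat)%:Z - (v : nat)%:Z))%Z.
Proof.
rewrite /=.
have -> : ((u + (n - v) %% n) %% n)%N%:Z - (u%:Z - v%:Z) =
   (((u + (n - v) %% n) %% n)%N%:Z - (u + (n - v) %% n)%N%:Z) +
   (((n - v) %% n)%N%:Z - (n - v)%N%:Z) + n%:Z.
  by rewrite PoszD -(subzn (ltnW (ltn_ord v))); ring.
by rewrite rpredD ?dvdzz // rpredD // dvdz_modn_sub.
Qed.

Lemma dvdz_Zp_mul (u v : 'I_n) :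
  (n %| (Zp_mul u v : nat)%:Z - (u : nat)%:Z * (v : nat)%:Z)%Z.
Proof. by rewrite -PoszM dvdz_modn_sub. Qed.

Lemma dvdz_ord_inj (u v : 'I_n) : (n %| (u : nat)%:Z - (v : nat)%:Z)%Z -> u = v.
Proof.
rewrite -eqz_mod_dvd !modz_nat eqz_nat !modn_small // => /eqP; exact: val_inj.
Qed.

Lemma Aut_q_ratio (s : {perm 'I_n}) : s \in Aut_q q n -> forall x y, exists i,
  (n %| (s y : nat)%:Z - (s x : nat)%:Z - q%:Z ^+ i * ((y : nat)%:Z - (x : nat)%:Z))%Z.
Proof.
rewrite inE => /forallP H x y; have /forallP/(_ y)/eqP E := H x.
have : Zp_add (s y) (Zp_opp (s x)) \in cyc_color q (s x) (s y).
  apply/imsetP; exists (inZp 1).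
    by rewrite inE; apply/asboolP; exists 0%N; rewrite /= modn_mod expn0.
  by apply: val_inj; rewrite /= modnMmr muln1 modn_mod.
rewrite E => /imsetP[a]; rewrite inE => /asboolP[i ai] Ea; exists i.
have h1 := dvdz_Zp_sub (s y) (s x); have h2 := dvdz_Zp_sub y x.
have h3 := dvdz_Zp_mul (Zp_add y (Zp_opp x)) a; rewrite -Ea in h3.
have h4 : (n %| (a : nat)%:Z - q%:Z ^+ i)%Z.
  have -> : q%:Z ^+ i = (q ^ i)%N%:Z by rewrite -!natz natrX.
  by rewrite -eqz_mod_dvd !modz_nat eqz_nat ai.
move: h1 h2 h3 h4.
move: (nat_of_ord (Zp_add (s y) _))%:Z (nat_of_ord (Zp_add y _))%:Z (nat_of_ord a)%:Z => A B c.
move: (nat_of_ord (s y))%:Z (nat_of_ord (s x))%:Z (nat_of_ord x)%:Z (nat_of_ord y)%:Z (q%:Z ^+ i).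
move=> sy sx x' y' Q h1 h2 h3 h4.
have -> : sy - sx - Q * (y' - x') = (A - B * c) - (A - (sy - sx))
  + B * (c - Q) + Q * (B - (y' - x')) by ring.
apply: rpredD; last exact: dvdz_mull.
by apply: rpredD; [apply: rpredB | apply: dvdz_mull].
Qed.

Hypothesis Hpow : forall p, prime p -> (p %| n)%N -> (1 < logn p n)%N ->
  exists r, [/\ prime r, (r %| n)%N & forces_dvd q (p ^ (logn p n).-1) r].
Hypothesis Hsqr : (exists u, q = u ^ 2)%N \/ forall p, prime p -> (p %| n)%N ->
  exists r, [/\ prime r, (r %| n)%N, r != p & forces_dvd q 2 r].

Lemma normalized_map_id (G : int -> int) : G 0 = 0 -> (n %| G 1 - 1)%Z ->
  (forall x y, exists i, (n %| G y - G x - q%:Z ^+ i * (y - x))%Z) ->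
  forall x, (n %| G x - x)%Z.
Proof.
move=> G0 G1 Gq x; rewrite -[(_ %| _)%Z]/(n %| `|G x - x|)%N.
apply/dvdn_partP => // p; rewrite mem_primes => /and3P[pp _ pn].
rewrite p_part; set a := logn p n.
have [m cm nE] := pfactor_coprime pp (ltn0Sn k); rewrite -/a mulnC in nE.
have a_gt0 : (0 < a)%N by rewrite logn_gt0 mem_primes pp pn.
have cPm : coprime (p ^ a) m by rewrite coprimeXl.
have cpq : coprime p q by apply: coprime_dvdl cnq.
rewrite nE in G1 Gq.
have fm r b : prime r -> (r %| n)%N -> r != p -> forces_dvd q b r ->
    forall i, (m %| q%:Z ^+ i - 1)%Z -> (b %| i)%N.
  move=> pr rn rp /asboolP Hr i im; apply: Hr; apply/eqP; rewrite -dvdz_expr_sub1.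
  have rm : (r %| m%:Z)%Z.
    move: rn; rewrite nE Euclid_dvdM // Euclid_dvdX // dvdn_prime2 // (negPf rp).
    by [].
  exact: dvdz_trans im.
apply: (map_mod_prime_power pp a_gt0 cPm cpq G0 G1 Gq) => [i im|op i im].
  have [a1|a1] := leqP a 1; first by rewrite (_ : a = 1%N) ?expn0 ?dvd1n //; apply/eqP; rewrite eqn_leq a1.
  have [r [pr rn Hr]] := Hpow pp pn a1.
  (* The case r = p cannot occur: q^(p-1) = 1 modulo p would force p^(a-1) | p - 1. For the divisor
     2 no such argument exists, so [Hsqr] demands r != p. *)
  apply: (fm r _ pr rn _ Hr i im); apply/eqP => rp.
  move/asboolP: Hr => /(_ p.-1); rewrite rp.
  have -> : (q ^ p.-1 = 1 %[mod p])%N.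
    by rewrite -{1}(totient_prime pp); apply: Euler_exp_totient; rewrite coprime_sym.
  move/(_ erefl)/dvdn_leq; rewrite -subn1 subn_gt0 prime_gt1 // => /(_ isT).
  rewrite leqNgt -/a; case/negP; rewrite subn1 prednK ?prime_gt0 //.
  have a2 : (0 < a.-1)%N by rewrite -subn1 subn_gt0.
  by rewrite -{1}(expn1 p); apply: leq_pexp2l a2; apply: prime_gt0.
case: Hsqr => [[u qu]|H]; first by exists (u%:R ^+ i); rewrite qu natrX exprAC.
have [r [pr rn rp Hr]] := H p pp pn.
have /dvdnP[j ->] := fm r 2 pr rn rp Hr i im.
by exists (q%:R ^+ j); rewrite exprM.
Qed.

Lemma Aut_q_sub_Aff_q : Aut_q q n \subset Aff_q q n.
Proof.
apply/fintype.subsetP => s sA.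
pose o (x : int) : 'I_n := inord `|(x %% n)%Z|.
have oE x : ((o x : nat)%:Z - x \in dvdz n).
  have lt : (`|(x %% n)%Z| < n)%N.
    by rewrite -ltz_nat gez0_abs ?modz_ge0 // ltz_pmod.
  by rewrite inordK // gez0_abs ?modz_ge0 // -eqz_mod_dvd modz_mod.
pose F x : int := (s (o x) : nat)%:Z.
have Fq x y : exists i, (n %| F y - F x - q%:Z ^+ i * (y - x))%Z.
  have [i Hi] := Aut_q_ratio sA (o x) (o y); exists i.
  rewrite -/(F y) -/(F x) in Hi.
  have -> : F y - F x - q%:Z ^+ i * (y - x) =
    (F y - F x - q%:Z ^+ i * ((o y : nat)%:Z - (o x : nat)%:Z)) +
    q%:Z ^+ i * (((o y : nat)%:Z - y) - ((o x : nat)%:Z - x)) by ring.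
  by apply: rpredD => //; apply: dvdz_mull; apply: rpredB; apply: oE.
have [i0 Hi0] := Fq 0 1; rewrite subr0 mulr1 in Hi0.
(* By Euler, Q = q^j0 inverts q^i0 modulo n, so Q (F - F 0) fixes 0, and fixes 1 modulo n. *)
pose j0 := (i0 * (totient n).-1)%N; set Q := q%:Z ^+ j0; set Qi := q%:Z ^+ i0 in Hi0.
have QQ : (n %| Q * Qi - 1)%Z.
  rewrite -exprD dvdz_expr_sub1 /j0 addnC -mulnS prednK ?totient_gt0 // mulnC expnM.
  apply/eqP; rewrite -modnXm Euler_exp_totient 1?coprime_sym //.
  by rewrite modnXm exp1n.
pose G x := Q * (F x - F 0).
have GE : forall x, (n %| G x - x)%Z.
  apply: normalized_map_id; first by rewrite /G subrr mulr0.
    have -> : G 1 - 1 = Q * (F 1 - F 0 - Qi) + (Q * Qi - 1) by rewrite /G; ring.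
    by rewrite rpredD // dvdz_mull.
  move=> x y; have [i Hi] := Fq x y; exists (j0 + i)%N.
  have -> : G y - G x - q%:Z ^+ (j0 + i) * (y - x) = Q * (F y - F x - q%:Z ^+ i * (y - x)).
    by rewrite /G exprD -/Q; ring.
  exact: dvdz_mull.
rewrite inE; apply/existsP; exists (inZp (q ^ i0)); apply/andP; split.
  by rewrite inE; apply/asboolP; exists i0; rewrite /= modn_mod.
apply/existsP; exists (s (o 0)); apply/forallP => x; apply/eqP/dvdz_ord_inj.
have ox : o (x : nat)%:Z = x.
  by apply: dvdz_ord_inj; exact: oE.
have Fx : F (x : nat)%:Z = (s x : nat)%:Z by rewrite /F ox.
have Qx := GE (x : nat)%:Z; rewrite /G Fx in Qx.
pose kx : 'I_n := Zp_mul (inZp (q ^ i0)) x.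
have h1 : (n %| (Zp_add kx (s (o 0)) : nat)%:Z - ((kx : nat)%:Z + F 0))%Z.
  by rewrite -PoszD dvdz_modn_sub.
have h2 := dvdz_Zp_mul (inZp (q ^ i0)) x; rewrite -/kx in h2.
have h3 : (n %| (inZp (q ^ i0) : 'I_n)%:Z - Qi)%Z.
  have -> : Qi = (q ^ i0)%N%:Z by rewrite /Qi -!natz natrX.
  exact: dvdz_modn_sub.
rewrite -/kx; move: Qx h1 h2 h3 QQ.
move: (nat_of_ord (Zp_add kx _))%:Z (nat_of_ord kx)%:Z (nat_of_ord (inZp _))%:Z (nat_of_ord x)%:Z.
move: (nat_of_ord (s x))%:Z (F 0) => A B C D E x' Qx h1 h2 h3 QQ.
have -> : A - C = Qi * (Q * (A - B) - x') - (A - B) * (Q * Qi - 1)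
   - (C - (D + B)) - (D - E * x') - x' * (E - Qi) by ring.
apply: rpredB; last exact: dvdz_mull.
apply: rpredB => //; apply: rpredB => //.
by apply: rpredB; apply: dvdz_mull.
Qed.

End Affine.

Lemma Aut_q_eq_Aff_q q n : (0 < n)%N -> coprime n q ->
  (forall p, prime p -> (p %| n)%N -> (1 < logn p n)%N ->
    exists r, [/\ prime r, (r %| n)%N & forces_dvd q (p ^ (logn p n).-1) r]) ->
  ((exists u, q = u ^ 2)%N \/ forall p, prime p -> (p %| n)%N ->
    exists r, [/\ prime r, (r %| n)%N, r != p & forces_dvd q 2 r]) ->
  Aut_q q n = Aff_q q n.
Proof.
case: n => // k _ cnq Hpow Hsqr; apply/eqP; rewrite finset.eqEsubset.
by rewrite Aut_q_sub_Aff_q // Aff_q_sub_Aut_q.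
Qed.

(** * The exceptional set has density zero *)

Definition big_square (Y n : nat) : bool :=
  has (fun d => (Y < d)%N && (d ^ 2 %| n)%N) (iota 0 n.+1).

Lemma cnt_big_square Y x : (0 < Y)%N -> (Y * cnt (big_square Y) x <= x)%N.
Proof.
move=> Y0.
have H : (cnt (big_square Y) x <= \sum_(Y.+1 <= d < x.+1) x %/ d ^ 2)%N.
  under eq_bigr => d _ do rewrite -cnt_dvd.
  rewrite /cnt exchange_big /= !big_nat; apply: leq_sum => n /andP[n0 nx].
  case: (boolP (big_square Y n)) => // /hasP[d]; rewrite mem_iota => /andP[_ dn].
  case/andP => Yd d2; rewrite (bigD1_seq d) ?iota_uniq //= ?d2 //.
  by rewrite mem_index_iota Yd (leq_trans dn).
have Yr : 0 < Y%:R :> rat by rewrite ltr0n.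
rewrite -(ler_nat rat) natrM mulrC -ler_pdivlMr //.
have : (cnt (big_square Y) x)%:R <= \sum_(Y.+1 <= d < x.+1) x%:R * (d%:R ^+ 2)^-1 :> rat.
  apply: (@le_trans _ _ (\sum_(Y.+1 <= d < x.+1) (x %/ d ^ 2))%N%:R); first by rewrite ler_nat.
  rewrite natr_sum !big_nat; apply: ler_sum => d /andP[Yd _].
  by rewrite -natrX natr_div_le // expn_gt0 (leq_ltn_trans _ Yd).
move/le_trans; apply; rewrite -mulr_sumr ler_wpM2l ?ler0n //.
exact: sum_inv_sqr.
Qed.

Lemma forces_dvd_trans q a b r : (a %| b)%N -> forces_dvd q b r -> forces_dvd q a r.
Proof. by move=> ab /asboolP H; apply/asboolP => i /H; apply: dvdn_trans. Qed.

(** Without large square factors, l^2 | n implies l <= Y; with h half the exponent rounded down, h <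
    l^h <= Y bounds the exponent by 2Y + 1, so one fixed power for each l suffices. Two primes of
    even order ensure that one of them differs from the given prime factor. *)
Lemma uncovered_eq p e n Y : prime p -> (0 < e)%N -> (0 < n)%N ->
  coprime n (p ^ e) -> ~~ big_square Y n ->
  (forall l, prime l -> (l <= Y)%N -> l != p ->
     (0 < count (forces_dvd (p ^ e) (l ^ (2 * Y).+1)) (primes n))%N) ->
  (odd e -> (1 < count (forces_dvd (p ^ e) 2) (primes n))%N) ->
  Aut_q (p ^ e) n = Aff_q (p ^ e) n.
Proof.
move=> pp e0 n0 cnq nsq Hl H2; apply: Aut_q_eq_Aff_q => // [l pl ln l2|].
  have sqY d : (d ^ 2 %| n)%N -> (d <= Y)%N.
    move=> d2; rewrite leqNgt; apply/negP => Yd; case/negP: nsq; apply/hasP; exists d.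
      rewrite mem_iota add0n ltnS /=; apply: leq_trans (dvdn_leq n0 d2).
      by rewrite -{1}(expn1 d) leq_pexp2l // (leq_ltn_trans _ Yd).
    by rewrite Yd d2.
  have lY : (l <= Y)%N.
    by apply: sqY; rewrite pfactor_dvdn.
  have aY : ((logn l n).-1 <= (2 * Y).+1)%N.
    have hY : (l ^ (logn l n)./2 <= Y)%N.
      apply: sqY; rewrite -expnM pfactor_dvdn // muln2.
      by rewrite -{2}(odd_double_half (logn l n)) leq_addl.
    have := ltn_expl (logn l n)./2 (prime_gt1 pl).
    have := odd_double_half (logn l n); case: odd; lia.
  have lp : l != p.
    apply: contraTneq ln => ->.
    by rewrite -prime_coprime // coprime_sym -(coprime_pexpr _ _ e0).
  have := Hl l pl lY lp; rewrite -has_count => /hasP[r]; rewrite mem_primes.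
  case/and3P => pr _ rn Hr; exists r; split=> //.
  exact: forces_dvd_trans (dvdn_exp2l _ aY) Hr.
have [oe|ee] := boolP (odd e); last first.
  left; exists (p ^ e./2)%N; rewrite -expnM muln2; congr (_ ^ _)%N.
  by rewrite -{1}(odd_double_half e) (negPf ee).
right=> l pl ln; have := H2 oe; rewrite -size_filter => s2.
have us : uniq [seq r <- primes n | forces_dvd (p ^ e) 2 r] by rewrite filter_uniq ?primes_uniq.
have [/hasP[r]|] := boolP (has (predC1 l) [seq r <- primes n | forces_dvd (p ^ e) 2 r]).
  rewrite mem_filter mem_primes => /andP[Hr /and3P[pr _ rn]] rl.
  by exists r; split.
rewrite -all_predC => /allP H.
have : (size [seq r <- primes n | forces_dvd (p ^ e) 2 r] <= size [:: l])%N.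
  apply: uniq_leq_size => // r /H; by rewrite /= negbK inE.
by rewrite /= leqNgt s2.
Qed.

Lemma half_densities k a b c x : ((2 * k).+1 * b <= x)%N -> (2 * k * c <= x)%N ->
  (a <= b + c)%N -> (k * a <= x)%N.
Proof. nia. Qed.

Lemma rare_exceptional p e : prime p -> (0 < e)%N ->
  rare (fun n => coprime n (p ^ e) && (Aut_q (p ^ e) n != Aff_q (p ^ e) n)).
Proof.
(* Large squares then take at most x / (2k + 1) of the n; the finitely many other conditions get the
   share x / (2k). *)
move=> pp e0 k; pose Y := (2 * k).+1.
pose P l n := (count (forces_dvd (p ^ e) (l ^ (2 * Y).+1)) (primes n) < 1)%N.
pose P2 n := odd e && (count (forces_dvd (p ^ e) 2) (primes n) < 2)%N.
pose ls := [seq l <- iota 0 Y.+1 | prime l && (l != p)].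
have rR : rare (fun n => has (fun l => P l n) ls || P2 n).
  apply: rareU; first apply: rare_has => l.
    rewrite mem_filter => /andP[/andP[pl lp] _].
    exact: rare_few_primes (not_thin_forces_dvd pp e0 pl lp).
  have [oe|oe] := boolP (odd e); last first.
    by apply: (@rare_sub _ pred0) => [n _|j]; [rewrite /P2 (negPf oe)
      | exists 0%N => x _; rewrite /cnt big1 ?muln0].
  apply: rare_sub (rare_few_primes 2 (not_thin_forces_even pp oe)).
  by move=> n _ /andP[].
have [x0 Hx] := rR (2 * k)%N; exists x0 => x /Hx {}Hx.
have Hs := @cnt_big_square Y x isT.
set exc := (fun n : nat => _ && _).
have sub : (cnt exc x <= cnt (fun n => big_square Y n || (has (fun l => P l n) ls || P2 n)) x)%N.
  apply: cnt_sub => n n0 /andP[cn]; apply: contraR; rewrite negb_or => /andP[nsq].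
  rewrite negb_or => /andP[/hasPn nP nP2]; apply/eqP.
  apply: (uncovered_eq (Y := Y)) => // [l pl lY lp|oe].
    have := nP l; rewrite mem_filter pl lp mem_iota add0n ltnS lY /P ltnS leqn0 lt0n.
    by apply.
  by move: nP2; rewrite /P2 oe /= -leqNgt.
apply: (half_densities Hs Hx); apply: leq_trans sub _.
rewrite /cnt -big_split /=; apply: leq_sum => n _.
by case: (big_square Y n); case: (has _ _ || P2 n).
Qed.

Lemma exceptional_countE (R : realType) q (x : R) : exceptional_count q x =
  cnt (fun n => coprime n q && (Aut_q q n != Aff_q q n)) (Num.truncn x).
Proof.
rewrite /exceptional_count cardsE -sum1_card big_mkcond /cnt big_add1 /= big_mkord.
rewrite big_ord_recl {1}/in_mem /= add0n; apply: eq_bigr => n _.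
by rewrite /in_mem /=; case: (_ && _).
Qed.

Theorem theorem3 (R : realType) (q : nat)
    (hq : exists p e : nat, [/\ prime p, (0 < e)%N & q = (p ^ e)%N]) :
  (fun x : R => (exceptional_count q x)%:R : R^o) =o_+oo
  (fun x : R => x : R^o).
Proof.
case: hq => p [e [pp e0 ->]]; apply/eqoP => eps eps0.
(* This k = floor(1 / eps) + 1 satisfies eps k >= 1, so k c <= N <= x gives c <= eps x. *)
have [x0 Hx0] := rare_exceptional pp e0 (Num.truncn (eps^-1)).+1.
exists x0.+1%:R; split; first exact: num_real.
move=> x xx0; have x_gt0 : 0 < x by apply: lt_trans xx0; rewrite ltr0Sn.
rewrite exceptional_countE /= normr_nat gtr0_norm //.
set N := Num.truncn x; have NX : N%:R <= x by rewrite truncn_le ltW.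
have x0N : (x0 <= N)%N by rewrite truncn_ge_nat ?ltW // (lt_trans _ xx0) // ltr_nat.
have := Hx0 N x0N; set c := cnt _ N => Hc.
have k1 : 1 <= eps * (Num.truncn eps^-1).+1%:R.
  rewrite mulrC -ler_pdivrMr // mul1r ltW //; exact: truncnS_gt.
apply: (@le_trans _ _ (eps * (Num.truncn eps^-1).+1%:R * c%:R)).
  by rewrite ler_peMl ?ler0n.
rewrite -mulrA ler_pM2l // -natrM; apply: le_trans NX; by rewrite ler_nat.
Qed.
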